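(* From the proof in $\textsf{E-PA}^{\omega}$ of the statement that for all $l^{0}$ and all $f:\mathbb{R}\to\mathbb{R}$ \begin{align*} (\forall k')(\exists N')(\forall x,y\in[0,1])&\Big(|x-y|<\tfrac{1}{N'}\to |f(x)-f(y)|\le \tfrac{1}{k'}\Big)\\ &\to(\forall k)(\exists N)(\forall \varepsilon)\big(\forall x\in[\tfrac1l,1-\tfrac1l]\big)\Big[0<|\varepsilon|<\tfrac1N\to \big|\Delta_{\varepsilon}(I(f,0,x))-f(x)\big|\le\tfrac1k\Big], \end{align*} a term $t$ of the language of $\textsf{E-PA}^{\omega}$ can be extracted such that $\textsf{E-PA}^{\omega}$ proves the following statement $\textsf{FTC}_{\textsf{ef}}(t)$: for all $f:\mathbb{R}\to\mathbb{R}$, $g^{1}$ and $l^{0}$, \begin{align*} (\forall x,y\in[0,1],k')&\Big(|x-y|<\tfrac{1}{g(k')}\to|f(x)-f(y)|\le\tfrac{1}{k'}\Big)\\ &\to(\forall k)\big(\forall N\ge t(g,k,l),\,x\in[\tfrac1l,1-\tfrac1l]\big)\Big[\big|\Delta_{\frac1N}(I(f,0,x))-f(x)\big|\le\tfrac1k\Big]. \end{align*}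
   Context: $\textsf{E-PA}^{\omega}$ is classical Peano arithmetic in all finite types with the axiom of extensionality (the classical extensional theory based on Gödel's system $\textsf{T}$). Type $0$ is the type of natural numbers, $1$ is $0\to0$, and superscripts on variables denote types. ``Term'' means closed term of this language. A real number is a sequence $q_{(\cdot)}^{1}$ of (coded) rationals with $(\forall n,i)(|q_n-q_{n+i}|<2^{-n})$; every $f^1$ may be viewed as a real via Kohlenbach's ``hat'' function. Reals $x=q_{(\cdot)}$, $y=r_{(\cdot)}$ are equal, $x=_{\mathbb{R}}y$, if $(\forall n)(|q_n-r_n|\le 2^{-n+1})$; inequalities are defined similarly. The notation $f:\mathbb{R}\to\mathbb{R}$ means a functional $f^{1\to1}$ with $(\forall x^1,y^1)(x=_{\mathbb{R}}y\to f(x)=_{\mathbb{R}}f(y))$. $\Delta_\varepsilon(F(x)):=\frac{F(x+\varepsilon)-F(x)}{\varepsilon}$. $I(f,0,x)$ is the Riemann integral functional, which for $f$ (uniformly) continuous on $[0,1]$ outputs the real $\int_0^x f(s)\,ds$; it is given by the approximations $[I(f,0,x)](k)=\sum_{i=0}^{i(x)}f(\frac{i}{2^k})\frac{1}{2^k}$, where $i(x)$ is (the index of) the least partition point larger than $x$, evaluated at indices large enough (computed from a modulus of uniform continuity of $f$) to make the sequence converge fast. Numbers occurring as denominators, including values of moduli, are understood to be positive. *)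

(* Defs.v *)
(* The theory E-PA^omega as a deep embedding (finite types, combinator terms,
   formulas, natural deduction), and inside its language the representation of
   rationals, reals, the Riemann integral, and the two sentences about the
   fundamental theorem of calculus.  Only Stdlib lists are used. *)
From Stdlib Require Import List.
Import ListNotations.

Set Implicit Arguments.
Unset Strict Implicit.

(** * Language *)

Inductive ty : Type :=
| ty0 : ty
| Arr : ty -> ty -> ty.

Notation ty1 := (Arr ty0 ty0).
Notation ty2 := (Arr ty1 ty1).

(* Not imported by clients unless they ask for it. *)
Module TypeNotations.
Notation "r ~> s" := (Arr r s) (at level 55, right associativity).
End TypeNotations.
Import TypeNotations.

Definition ctx := list ty.

(* Typed de Bruijn indices. *)
Inductive var : ctx -> ty -> Type :=
| v0 : forall G r, var (r :: G) r
| vS : forall G r s, var G s -> var (r :: G) s.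
Arguments v0 {G r}.
Arguments vS {G r s}.

(* Terms have no binders: abstraction is defined from [Kc] and [Sc] below. *)
Inductive tm (G : ctx) : ty -> Type :=
| Var : forall r, var G r -> tm G r
| App : forall r s, tm G (r ~> s) -> tm G r -> tm G s
| Zero : tm G ty0
| Succ : tm G (ty0 ~> ty0)
| Kc : forall r s, tm G (r ~> s ~> r)
| Sc : forall d r s, tm G ((d ~> r ~> s) ~> (d ~> r) ~> d ~> s)
| Rec : forall r, tm G (ty0 ~> r ~> (r ~> ty0 ~> r) ~> r).
Arguments Var {G r}.
Arguments App {G r s}.
Arguments Zero {G}.
Arguments Succ {G}.
Arguments Kc {G r s}.
Arguments Sc {G d r s}.
Arguments Rec {G r}.

Module TermNotations.
Infix "·" := App (at level 11, left associativity).
End TermNotations.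
Import TermNotations.

(* Equality is primitive at type 0 only; the other connectives are classical
   abbreviations. *)
Inductive fm (G : ctx) : Type :=
| FEq : tm G ty0 -> tm G ty0 -> fm G
| FBot : fm G
| FImp : fm G -> fm G -> fm G
| FAnd : fm G -> fm G -> fm G
| FAll : forall r, fm (r :: G) -> fm G.
Arguments FBot {G}.
Arguments FAll {G} r.

Definition FNot {G} (p : fm G) : fm G := FImp p FBot.
Definition FEx {G} r (p : fm (r :: G)) : fm G := FNot (FAll r (FNot p)).

(** * Substitution *)

Definition sub (G D : ctx) := forall r, var G r -> tm D r.

Fixpoint sub_tm {G D} (s : sub G D) {r} (t : tm G r) : tm D r :=
  match t with
  | Var x => s _ x
  | App f u => sub_tm s f · sub_tm s u
  | Zero => Zero
  | Succ => Succ
  | Kc => Kc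
  | Sc => Sc
  | Rec => Rec
  end.

Definition wk {G a r} (t : tm G r) : tm (a :: G) r :=
  sub_tm (fun _ x => Var (vS x)) t.
Module LiftNotations.
Notation "↑ t" := (wk t) (at level 9, right associativity, format "↑ t").
End LiftNotations.
Import LiftNotations.

Definition scons {G D a} (u : tm D a) (s : sub G D) : sub (a :: G) D :=
  fun r x =>
    match x in var G' r return
      match G' with
      | [] => unit
      | a' :: G'' => tm D a' -> (forall r, var G'' r -> tm D r) -> tm D r
      end
    with
    | v0 => fun u _ => u
    | vS y => fun _ s => s _ y
    end u s.

Definition up {G D a} (s : sub G D) : sub (a :: G) (a :: D) :=
  scons (Var v0) (fun r x => ↑(s r x)).

Fixpoint sub_fm {G D} (s : sub G D) (p : fm G) : fm D :=
  match p with
  | FEq t u => FEq (sub_tm s t) (sub_tm s u)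
  | FBot => FBot
  | FImp p q => FImp (sub_fm s p) (sub_fm s q)
  | FAnd p q => FAnd (sub_fm s p) (sub_fm s q)
  | FAll r p => FAll r (sub_fm (up s) p)
  end.

Definition wk_fm {G a} (p : fm G) : fm (a :: G) :=
  sub_fm (fun _ x => Var (vS x)) p.

Definition inst {G a} (p : fm (a :: G)) (t : tm G a) : fm G :=
  sub_fm (scons t (fun _ x => Var x)) p.

(* [p] with its innermost variable [n] replaced by [S n]. *)
Definition step {G} (p : fm (ty0 :: G)) : fm (ty0 :: G) :=
  sub_fm (scons (Succ · Var v0) (fun _ x => Var (vS x))) p.

Definition close {G r} (t : tm [] r) : tm G r :=
  sub_tm (fun _ (x : var [] _) =>
    match x in var G' r' return
      match G' with [] => tm G r' | _ => unit end
    with v0 => tt | vS _ => tt end) t.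

(** * The theory *)

(* Equality at higher types is pointwise equality. *)
Fixpoint eqt {G} (r : ty) : tm G r -> tm G r -> fm G :=
  match r return tm G r -> tm G r -> fm G with
  | ty0 => fun t u => FEq t u
  | a ~> b => fun t u => FAll a (eqt (↑t · Var v0) (↑u · Var v0))
  end.

Inductive axiom (G : ctx) : fm G -> Prop :=
| ax_refl : forall t, axiom (FEq t t)
| ax_sym : forall t u, axiom (FImp (FEq t u) (FEq u t))
| ax_trans : forall t u v,
    axiom (FImp (FEq t u) (FImp (FEq u v) (FEq t v)))
| ax_S_neq0 : forall t, axiom (FNot (FEq (Succ · t) Zero))
| ax_S_inj : forall t u, axiom (FImp (FEq (Succ · t) (Succ · u)) (FEq t u))
| ax_K : forall r s (t : tm G r) (u : tm G s), axiom (eqt (Kc · t · u) t)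
| ax_Sc : forall d r s (t : tm G (d ~> r ~> s)) (u : tm G (d ~> r)) (v : tm G d),
    axiom (eqt (Sc · t · u · v) (t · v · (u · v)))
| ax_Rec0 : forall r (a : tm G r) (h : tm G (r ~> ty0 ~> r)),
    axiom (eqt (Rec · Zero · a · h) a)
| ax_RecS : forall r (n : tm G ty0) (a : tm G r) (h : tm G (r ~> ty0 ~> r)),
    axiom (eqt (Rec · (Succ · n) · a · h) (h · (Rec · n · a · h) · n))
| ax_ext : forall r s (z : tm G (r ~> s)) (t u : tm G r),
    axiom (FImp (eqt t u) (eqt (z · t) (z · u)))
| ax_ind : forall p : fm (ty0 :: G),
    axiom (FImp (inst p Zero)
             (FImp (FAll ty0 (FImp p (step p))) (FAll ty0 p))).

Inductive prf : forall G : ctx, list (fm G) -> fm G -> Prop :=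
| p_ax : forall G (H : list (fm G)) p, axiom p -> prf H p
| p_hyp : forall G (H : list (fm G)) p, In p H -> prf H p
| p_raa : forall G (H : list (fm G)) p, prf (FNot p :: H) FBot -> prf H p
| p_impI : forall G (H : list (fm G)) p q, prf (p :: H) q -> prf H (FImp p q)
| p_impE : forall G (H : list (fm G)) p q,
    prf H (FImp p q) -> prf H p -> prf H q
| p_andI : forall G (H : list (fm G)) p q,
    prf H p -> prf H q -> prf H (FAnd p q)
| p_andE1 : forall G (H : list (fm G)) p q, prf H (FAnd p q) -> prf H p
| p_andE2 : forall G (H : list (fm G)) p q, prf H (FAnd p q) -> prf H q
| p_allI : forall G (H : list (fm G)) r (p : fm (r :: G)),
    prf (map wk_fm H) p -> prf H (FAll r p)
| p_allE : forall G (H : list (fm G)) r (p : fm (r :: G)) (t : tm G r),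
    prf H (FAll r p) -> prf H (inst p t).

Definition EPA_proves (p : fm []) : Prop := prf [] p.

(** * Named binders *)

Definition str_var {G a r} (x : var (a :: G) r) : option (tm G r) :=
  match x in var G' r return
    match G' with [] => unit | a' :: G'' => option (tm G'' r) end
  with
  | v0 => None
  | vS y => Some (Var y)
  end.

(* [str t = Some u] iff the innermost variable does not occur in [t] and
   [t = wk u]. *)
Fixpoint str {G a r} (t : tm (a :: G) r) : option (tm G r) :=
  match t in tm _ r return option (tm G r) with
  | Var x => str_var x
  | App f u =>
      match str f, str u with
      | Some f', Some u' => Some (f' · u')
      | _, _ => None
      end
  | Zero => Some Zero
  | Succ => Some Succ
  | Kc => Some Kc
  | Sc => Some Sc
  | Rec => Some Rec
  end.

Definition lam_var {G a b} (x : var (a :: G) b) : tm G (a ~> b) :=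
  match x in var G' b return
    match G' with [] => unit | a' :: G'' => tm G'' (a' ~> b) end
  with
  | @v0 _ r => Sc · Kc · (Kc : tm _ (r ~> r ~> r))
  | vS y => Kc · Var y
  end.

(* Bracket abstraction of the innermost variable. *)
Fixpoint lam {G a b} (t : tm (a :: G) b) : tm G (a ~> b) :=
  match t in tm _ b return tm G (a ~> b) with
  | Var x => lam_var x
  | App f u =>
      match str f, str u with
      | Some f', Some u' => Kc · (f' · u')
      | _, _ => Sc · lam f · lam u
      end
  | Zero => Kc · Zero
  | Succ => Kc · Succ
  | Kc => Kc · Kc
  | Sc => Kc · Sc
  | Rec => Kc · Rec
  end.

(* Each binder names the fresh innermost variable; a term is carried under a
   further binder by an explicit [↑]. *)
Definition lamN {G} a {b} (F : tm (a :: G) a -> tm (a :: G) b) : tm G (a ~> b) :=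
  lam (F (Var v0)).
Definition allN {G} r (F : tm (r :: G) r -> fm (r :: G)) : fm G :=
  FAll r (F (Var v0)).
Definition exN {G} r (F : tm (r :: G) r -> fm (r :: G)) : fm G :=
  FEx (F (Var v0)).

Module FormulaNotations.
Notation "'λ' x : r , t" := (lamN (a := r) (fun x => t))
  (at level 200, x name, r at level 99, right associativity).
Notation "'ALL' x : r , p" := (allN (r := r) (fun x => p))
  (at level 200, x name, r at level 99, right associativity).
Notation "'EX' x : r , p" := (exN (r := r) (fun x => p))
  (at level 200, x name, r at level 99, right associativity).
Notation "p ⊃ q" := (FImp p q) (at level 90, right associativity).
Notation "p ⋏ q" := (FAnd p q) (at level 80, right associativity).
End FormulaNotations.
Import FormulaNotations.

(** * Arithmetic *)

Fixpoint num {G} (n : nat) : tm G ty0 :=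
  match n with 0 => Zero | S m => Succ · num m end.

Definition add {G} : tm G (ty0 ~> ty0 ~> ty0) :=
  λ m : ty0, λ n : ty0,
    Rec · n · ↑m · (λ r : ty0, λ i : ty0, Succ · ↑r).
Definition mul {G} : tm G (ty0 ~> ty0 ~> ty0) :=
  λ m : ty0, λ n : ty0,
    Rec · n · Zero · (λ r : ty0, λ i : ty0, add · ↑r · ↑↑↑m).
Definition pred {G} : tm G (ty0 ~> ty0) :=
  λ n : ty0, Rec · n · Zero · (λ r : ty0, λ i : ty0, i).
(* Truncated subtraction. *)
Definition monus {G} : tm G (ty0 ~> ty0 ~> ty0) :=
  λ m : ty0, λ n : ty0,
    Rec · n · ↑m · (λ r : ty0, λ i : ty0, pred · ↑r).
Definition pow2 {G} : tm G (ty0 ~> ty0) :=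
  λ n : ty0, Rec · n · num 1 · (λ r : ty0, λ i : ty0, add · ↑r · ↑r).
(* [ite · c · a · b] is [a] if [c = 0] and [b] otherwise: characteristic terms
   take the value 0 for "true". *)
Definition ite {G} : tm G (ty0 ~> ty0 ~> ty0 ~> ty0) :=
  λ c : ty0, λ a : ty0, λ b : ty0,
    Rec · ↑↑c · ↑a · (λ r : ty0, λ i : ty0, ↑↑b).
(* Integer square root. *)
Definition isqrt {G} : tm G (ty0 ~> ty0) :=
  λ n : ty0, Rec · n · Zero ·
    (λ r : ty0, λ i : ty0,
       ite · (monus · (mul · (Succ · ↑r) · (Succ · ↑r)) · (Succ · i))
           · (Succ · ↑r) · ↑r).
(* Pairing (a,b) |-> (a+b)^2 + a; the projections are total. *)
Definition pair {G} : tm G (ty0 ~> ty0 ~> ty0) :=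
  λ a : ty0, λ b : ty0,
    add · (mul · (add · ↑a · b) · (add · ↑a · b)) · ↑a.
Definition pfst {G} : tm G (ty0 ~> ty0) :=
  λ z : ty0, monus · z · (mul · (isqrt · z) · (isqrt · z)).
Definition psnd {G} : tm G (ty0 ~> ty0) :=
  λ z : ty0, monus · (isqrt · z) · (pfst · z).

Definition leN {G} (m n : tm G ty0) : fm G := FEq (monus · m · n) Zero.

(** * Coded rationals *)

(* The code of the triple ((a, b), c) stands for (a - b) / (c + 1); every
   natural number is a code. *)
Definition qcode {G} : tm G (ty0 ~> ty0 ~> ty0 ~> ty0) :=
  λ a : ty0, λ b : ty0, λ c : ty0, pair · (pair · ↑↑a · ↑b) · c.
Definition qpos {G} : tm G (ty0 ~> ty0) := λ q : ty0, pfst · (pfst · q).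
Definition qneg {G} : tm G (ty0 ~> ty0) := λ q : ty0, psnd · (pfst · q).
Definition qden {G} : tm G (ty0 ~> ty0) := λ q : ty0, Succ · (psnd · q).

(* m / n for n > 0. *)
Definition qfrac {G} : tm G (ty0 ~> ty0 ~> ty0) :=
  λ m : ty0, λ n : ty0, qcode · ↑m · Zero · (pred · n).
Definition qadd {G} : tm G (ty0 ~> ty0 ~> ty0) :=
  λ p : ty0, λ q : ty0,
    qcode · (add · (mul · (qpos · ↑p) · (qden · q)) · (mul · (qpos · q) · (qden · ↑p)))
          · (add · (mul · (qneg · ↑p) · (qden · q)) · (mul · (qneg · q) · (qden · ↑p)))
          · (pred · (mul · (qden · ↑p) · (qden · q))).
Definition qmul {G} : tm G (ty0 ~> ty0 ~> ty0) :=
  λ p : ty0, λ q : ty0,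
    qcode · (add · (mul · (qpos · ↑p) · (qpos · q)) · (mul · (qneg · ↑p) · (qneg · q)))
          · (add · (mul · (qpos · ↑p) · (qneg · q)) · (mul · (qneg · ↑p) · (qpos · q)))
          · (pred · (mul · (qden · ↑p) · (qden · q))).
Definition qopp {G} : tm G (ty0 ~> ty0) :=
  λ p : ty0, qcode · (qneg · p) · (qpos · p) · (psnd · p).
Definition qabs {G} : tm G (ty0 ~> ty0) :=
  λ p : ty0,
    qcode · (add · (monus · (qpos · p) · (qneg · p)) · (monus · (qneg · p) · (qpos · p)))
          · Zero · (psnd · p).
Definition qsub {G} : tm G (ty0 ~> ty0 ~> ty0) :=
  λ p : ty0, λ q : ty0, qadd · ↑p · (qopp · q).
(* Characteristic terms of p <= q and p < q. *)
Definition qle {G} : tm G (ty0 ~> ty0 ~> ty0) :=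
  λ p : ty0, λ q : ty0,
    monus · (add · (mul · (qpos · ↑p) · (qden · q)) · (mul · (qneg · q) · (qden · ↑p)))
          · (add · (mul · (qpos · q) · (qden · ↑p)) · (mul · (qneg · ↑p) · (qden · q))).
Definition qlt {G} : tm G (ty0 ~> ty0 ~> ty0) :=
  λ p : ty0, λ q : ty0,
    monus · (Succ · (add · (mul · (qpos · ↑p) · (qden · q)) · (mul · (qneg · q) · (qden · ↑p))))
          · (add · (mul · (qpos · q) · (qden · ↑p)) · (mul · (qneg · ↑p) · (qden · q))).

(* 2^-n, and 2^(-n+1) as 2 / 2^n. *)
Definition qeps {G} : tm G (ty0 ~> ty0) := λ n : ty0, qfrac · num 1 · (pow2 · n).
Definition qeps2 {G} : tm G (ty0 ~> ty0) := λ n : ty0, qfrac · num 2 · (pow2 · n).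

(** * Reals *)

(* The number of k < j such that |f(k) - f(j)| < 2^-k fails. *)
Definition viol {G} : tm G (ty1 ~> ty0 ~> ty0) :=
  λ f : ty1, λ j : ty0, Rec · j · Zero ·
    (λ r : ty0, λ k : ty0,
       ite · (qlt · (qabs · (qsub · (↑↑↑f · k) · (↑↑↑f · ↑↑j))) · (qeps · k))
           · ↑r · (Succ · ↑r)).
(* [hat · f] follows f as long as |f(k) - f(k+i)| < 2^-k holds on the initial
   segment read so far, and is constant from there on.  So [hat · f] is always
   a real, and it coincides with f if f is one.  (Testing consecutive terms
   against 2^-(k+1) instead would alter some sequences that are reals in the
   sense |q_n - q_(n+i)| < 2^-n.) *)
Definition hat_index {G} : tm G (ty1 ~> ty0 ~> ty0) :=
  λ f : ty1, λ n : ty0, Rec · n · Zero ·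
    (λ c : ty0, λ i : ty0,
       ite · (add · (monus · i · ↑c) · (viol · ↑↑↑f · (Succ · i)))
           · (Succ · i) · ↑c).
Definition hat {G} : tm G (ty1 ~> ty1) :=
  λ f : ty1, λ n : ty0, ↑f · (hat_index · ↑f · n).

(* Every type 1 object is read as a real through [hat]. *)
Definition Req {G} (x y : tm G ty1) : fm G :=
  ALL n : ty0,
    FEq (qle · (qabs · (qsub · (hat · ↑x · n) · (hat · ↑y · n))) · (qeps2 · n)) Zero.
Definition Rle {G} (x y : tm G ty1) : fm G :=
  ALL n : ty0,
    FEq (qle · (qsub · (hat · ↑x · n) · (hat · ↑y · n)) · (qeps2 · n)) Zero.
Definition Rlt {G} (x y : tm G ty1) : fm G :=
  EX n : ty0,
    FEq (qlt · (qeps2 · n) · (qsub · (hat · ↑y · n) · (hat · ↑x · n))) Zero.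

Definition rofq {G} : tm G (ty0 ~> ty1) := Kc.
Definition rofnat {G} : tm G (ty0 ~> ty1) := λ n : ty0, rofq · (qfrac · n · num 1).
(* 1 / n for n > 0. *)
Definition rinv {G} : tm G (ty0 ~> ty1) := λ n : ty0, rofq · (qfrac · num 1 · n).
Definition radd {G} : tm G (ty1 ~> ty1 ~> ty1) :=
  λ x : ty1, λ y : ty1, λ n : ty0,
    qadd · (hat · ↑↑x · (Succ · n)) · (hat · ↑y · (Succ · n)).
Definition ropp {G} : tm G (ty1 ~> ty1) :=
  λ x : ty1, λ n : ty0, qopp · (hat · ↑x · n).
Definition rsub {G} : tm G (ty1 ~> ty1 ~> ty1) :=
  λ x : ty1, λ y : ty1, radd · ↑x · (ropp · y).
Definition rabs {G} : tm G (ty1 ~> ty1) :=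
  λ x : ty1, λ n : ty0, qabs · (hat · ↑x · n).
(* A natural number bounding all |x_n|. *)
Definition rbound {G} : tm G (ty1 ~> ty0) :=
  λ x : ty1,
    Succ · (add · (qpos · (hat · x · Zero)) · (qneg · (hat · x · Zero))).
(* (x y)_n = x_m y_m with m = n + K, where 2^-K (bound x + bound y) <= 1. *)
Definition rmul {G} : tm G (ty1 ~> ty1 ~> ty1) :=
  λ x : ty1, λ y : ty1, λ n : ty0,
    (λ m : ty0, qmul · (hat · ↑↑↑x · m) · (hat · ↑↑y · m))
    · (add · n · (add · (rbound · ↑↑x) · (rbound · ↑y))).

(** * The Riemann integral *)

(* The least i <= 2^k with x < i / 2^k, read off the k-th approximation of x;
   it is 2^k if there is none, as f is only controlled on [0,1]. *)
Definition part_index {G} : tm G (ty1 ~> ty0 ~> ty0) :=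
  λ x : ty1, λ k : ty0, Rec · (pow2 · k) · Zero ·
    (λ r : ty0, λ i : ty0,
       ite · (qlt · (hat · ↑↑↑x · ↑↑k) · (qfrac · ↑r · (pow2 · ↑↑k)))
           · ↑r · (Succ · ↑r)).

(* sum_{i = 0}^{i(x)} f(i / 2^k) / 2^k, each f(i / 2^k) being replaced by its
   k-th approximation. *)
Definition riemann_sum {G} : tm G (ty2 ~> ty1 ~> ty0 ~> ty0) :=
  λ f : ty2, λ x : ty1, λ k : ty0,
    Rec · (Succ · (part_index · ↑x · k)) · (qfrac · Zero · num 1) ·
    (λ s : ty0, λ i : ty0,
       qadd · ↑s
            · (qmul · (hat · (↑↑↑↑f · (rofq · (qfrac · i · (pow2 · ↑↑k)))) · ↑↑k)
                    · (qeps · ↑↑k))).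

(* If g is a modulus of uniform continuity of f on [0,1], then
   B = bound (f 0) + g(1) + 1 bounds |f| on [0,1], and the k-th Riemann sum is
   off by at most (3 B + 2) 2^-k + 2^-(n+2) as soon as 2^-k < 1/g(2^(n+2)).
   Hence k = n + g(2^(n+2)) + 3 B + 4 makes the error less than 2^-(n+1), and
   the resulting sequence converges fast enough. *)
Definition int_index {G} : tm G (ty2 ~> ty1 ~> ty0 ~> ty0) :=
  λ f : ty2, λ g : ty1, λ n : ty0,
    add · (add · n · (↑g · (pow2 · (add · n · num 2))))
        · (add · (mul · num 3 ·
                    (add · (rbound · (↑↑f · (rofnat · Zero)))
                         · (add · (↑g · num 1) · num 1)))
               · num 4).

(* I(f,0,x), the indices being computed from the modulus g of f. *)
Definition integral {G} : tm G (ty2 ~> ty1 ~> ty1 ~> ty1) :=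
  λ f : ty2, λ g : ty1, λ x : ty1, λ n : ty0,
    riemann_sum · ↑↑↑f · ↑x · (int_index · ↑↑↑f · ↑↑g · n).

(** * The two sentences *)

Definition pos_nat {G} (n : tm G ty0) : fm G := leN (num 1) n.

(* f : R -> R *)
Definition real_fun {G} (f : tm G ty2) : fm G :=
  ALL x : ty1, ALL y : ty1, Req ↑x y ⊃ Req (↑↑f · ↑x) (↑↑f · y).

Definition in_itv {G} (a b x : tm G ty1) : fm G := Rle a x ⋏ Rle x b.
Definition in_unit {G} (x : tm G ty1) : fm G :=
  in_itv (rofnat · num 0) (rofnat · num 1) x.
(* x in [1/l, 1 - 1/l] *)
Definition in_inner {G} (l : tm G ty0) (x : tm G ty1) : fm G :=
  in_itv (rinv · l) (rsub · (rofnat · num 1) · (rinv · l)) x.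

(* For all x, y in [0,1], |x - y| < 1/N implies |f(x) - f(y)| <= 1/k. *)
Definition osc {G} (f : tm G ty2) (N k : tm G ty0) : fm G :=
  ALL x : ty1, ALL y : ty1,
    in_unit ↑x ⋏ in_unit y ⊃
    Rlt (rabs · (rsub · ↑x · y)) (rinv · ↑↑N) ⊃
    Rle (rabs · (rsub · (↑↑f · ↑x) · (↑↑f · y))) (rinv · ↑↑k).

Definition unif_cont {G} (f : tm G ty2) : fm G :=
  ALL k : ty0, pos_nat k ⊃
    EX N : ty0, pos_nat N ⋏ osc ↑↑f N ↑k.

Definition modulus {G} (f : tm G ty2) (g : tm G ty1) : fm G :=
  ALL k : ty0, pos_nat k ⊃
    pos_nat (↑g · k) ⋏ osc ↑f (↑g · k) k.

(* |Delta_e(I(f,0,x)) - f(x)| <= 1/k for e <> 0.  Division of reals is not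
   total, so Delta_e(I(f,0,x)) is introduced as the (unique) real d with
   d e = I(f,0,x+e) - I(f,0,x). *)
Definition diff_quot_close {G} (f : tm G ty2) (g e x : tm G ty1) (k : tm G ty0) : fm G :=
  EX d : ty1,
    Req (rmul · d · ↑e)
        (rsub · (integral · ↑f · ↑g · (radd · ↑x · ↑e)) · (integral · ↑f · ↑g · ↑x)) ⋏
    Rle (rabs · (rsub · d · (↑f · ↑x))) (rinv · ↑k).

(* Here uniform continuity comes without a modulus function.  The value of N
   depends on f, l, k only; g serves only to evaluate I(f,0,.), and any modulus
   of f may be used for that. *)
Definition FTC : fm [] :=
  ALL l : ty0, ALL f : ty2,
    pos_nat ↑l ⊃ real_fun f ⊃
    unif_cont f ⊃
    ALL k : ty0, pos_nat k ⊃
    EX N : ty0, pos_nat N ⋏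
    ALL g : ty1, modulus ↑↑↑f g ⊃
    ALL e : ty1, ALL x : ty1,
      in_inner ↑↑↑↑↑↑l x ⊃
      Rlt (rofnat · num 0) (rabs · ↑e) ⋏ Rlt (rabs · ↑e) (rinv · ↑↑↑N) ⊃
      diff_quot_close ↑↑↑↑↑f ↑↑g ↑e x ↑↑↑↑k.

Definition FTC_ef (t : tm [] (ty1 ~> ty0 ~> ty0 ~> ty0)) : fm [] :=
  ALL f : ty2, ALL g : ty1, ALL l : ty0,
    real_fun ↑↑f ⊃ pos_nat l ⊃
    modulus ↑↑f ↑g ⊃
    ALL k : ty0, pos_nat k ⊃
    ALL N : ty0, ALL x : ty1,
      pos_nat ↑N ⊃ leN (close t · ↑↑↑↑g · ↑↑k · ↑↑↑l) ↑N ⊃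
      in_inner ↑↑↑l x ⊃
      diff_quot_close ↑↑↑↑↑f ↑↑↑↑g (rinv · ↑N) x ↑↑k.

(* Main.v *)
From HB Require Import structures.
From mathcomp Require Import all_boot all_order all_algebra.
From mathcomp Require Import boolp.
From mathcomp Require Import ring lra.
From Stdlib Require Import Program.Equality.
Require Import Defs.
Import TypeNotations TermNotations LiftNotations FormulaNotations.

(** Both sentences assert the existence of formal derivations, but no derivation
    is written down. By Goedel's completeness theorem ([completeness]) a sentence
    is derivable as soon as it is true in every model, where a model is a type
    structure of combinators, possibly nonstandard, whose objects are determined
    by their values and in which induction holds for the formulas of the
    language. The fundamental theorem is then proved as ordinary mathematics in
    an arbitrary model.

    The numbers of a model form an ordered semiring, and their field of
    fractions [QM] is an ordered field. Numbers, coded rationals and the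
    approximations of reals take their values in it ([nq], [qv], [hx]), so that
    all estimates become linear arithmetic in an ordered field. Two points need
    care. Induction is limited to formulas, hence every induction displays the
    formula it is applied to. Limits are taken along the indices of the model:
    the powers [ep n] of one half fall below every positive element of [QM]
    ([ep_archi]), although [QM] need not be archimedean.

    The analytic part compares partial sums. On the partition into cells of
    length [ep K] a function with modulus of continuity is bounded
    ([value_bound]); passing to a finer partition changes a sum by little
    ([psum_at_refine]), so the approximations of the integral converge fast
    ([psum_at_cauchy]) and are not altered when they are read as a real
    ([hx_integral]). Between x and x+e there are about e / [ep K] cells, and on
    each of them the function is within 1/k of f(x) when |e| < 1/N for an N that
    controls the oscillation of f at precision 1/k ([psum_at_increment]).
    Division by e gives the theorem ([derivative_of_integral]). Besides |e| < 1/N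
    the only bound on e is |e| < 1/l, which keeps x+e in [0,1]. So it depends
    on N and l alone: N + l serves for the first sentence, and g(k) + l + 1 is
    the extracted term. *)

Set Implicit Arguments.
Unset Strict Implicit.
Unset Printing Implicit Defensive.
Unset Asymmetric Patterns.

(** * Substitution *)

Lemma var_cases {G a} (P : forall r, var (a :: G) r -> Prop) :
  P a v0 -> (forall r (x : var G r), P r (vS x)) -> forall r x, P r x.
Proof. by move=> H0 HS r x; dependent destruction x. Qed.

Lemma sub_ext {G D} (s s' : sub G D) : (forall r x, s r x = s' r x) -> s = s'.
Proof.
by move=> E; apply: functional_extensionality_dep => r;
  apply: functional_extensionality_dep => x.
Qed.

Definition sub_comp {G D E} (s2 : sub D E) (s1 : sub G D) : sub G E :=
  fun r x => sub_tm s2 (s1 r x).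

Definition sub_id {G} : sub G G := fun r x => Var x.
Definition sub_wk {G a} : sub G (a :: G) := fun r x => Var (vS x).

Lemma sub_tm_comp G D E (s2 : sub D E) (s1 : sub G D) r (t : tm G r) :
  sub_tm s2 (sub_tm s1 t) = sub_tm (sub_comp s2 s1) t.
Proof. by elim: t => //= r0 s f -> u ->. Qed.

Lemma sub_tm_id G r (t : tm G r) : sub_tm sub_id t = t.
Proof. by elim: t => //= r0 s f -> u ->. Qed.

Lemma sub_tm_wk G D a (s : sub G D) (u : tm D a) r (t : tm G r) :
  sub_tm (scons u s) (wk t) = sub_tm s t.
Proof. by rewrite /wk sub_tm_comp. Qed.

Lemma up_wk G D a (s : sub G D) r (t : tm G r) :
  sub_tm (up (a := a) s) (wk t) = wk (sub_tm s t).
Proof. by rewrite sub_tm_wk /wk sub_tm_comp. Qed.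

Lemma up_comp G D E a (s2 : sub D E) (s1 : sub G D) :
  sub_comp (up s2) (up (a := a) s1) = up (sub_comp s2 s1).
Proof.
apply: sub_ext; apply: var_cases => //= r x.
by rewrite /sub_comp /= up_wk.
Qed.

Lemma up_id G a : up (a := a) (@sub_id G) = sub_id.
Proof. by apply: sub_ext; apply: var_cases. Qed.

Lemma sub_fm_comp G D E (s2 : sub D E) (s1 : sub G D) (p : fm G) :
  sub_fm s2 (sub_fm s1 p) = sub_fm (sub_comp s2 s1) p.
Proof.
elim: p D E s1 s2 => //= {G}.
- by move=> G t u D E s1 s2; rewrite !sub_tm_comp.
- by move=> G p IHp q IHq D E s1 s2; rewrite IHp IHq.
- by move=> G p IHp q IHq D E s1 s2; rewrite IHp IHq.
- by move=> G r p IHp D E s1 s2; rewrite IHp up_comp.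
Qed.

Lemma sub_fm_id G (p : fm G) : sub_fm sub_id p = p.
Proof.
elim: p => //= {G}.
- by move=> G t u; rewrite !sub_tm_id.
- by move=> G p -> q ->.
- by move=> G p -> q ->.
- by move=> G r p IHp; rewrite up_id IHp.
Qed.

Lemma scons_comp G D E a (s2 : sub D E) (s1 : sub G D) (u : tm D a) :
  sub_comp s2 (scons u s1) = scons (sub_tm s2 u) (sub_comp s2 s1).
Proof. by apply: sub_ext; apply: var_cases. Qed.

Lemma scons_up G D E a (s2 : sub D E) (s1 : sub G D) (u : tm E a) :
  sub_comp (scons u s2) (up s1) = scons u (sub_comp s2 s1).
Proof.
apply: sub_ext; apply: var_cases => //= r x.
by rewrite /sub_comp /= sub_tm_wk.
Qed.

Lemma sub_inst G D a (s : sub G D) (p : fm (a :: G)) t :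
  sub_fm s (inst p t) = inst (sub_fm (up s) p) (sub_tm s t).
Proof.
rewrite /inst !sub_fm_comp scons_up scons_comp; congr (sub_fm (scons _ _) _).
by apply: sub_ext => r x; exact: (esym (sub_tm_id _)).
Qed.

Lemma inst_up G D a (s : sub G D) (p : fm (a :: G)) t :
  inst (sub_fm (up s) p) t = sub_fm (scons t s) p.
Proof.
rewrite /inst sub_fm_comp scons_up; congr (sub_fm (scons _ _) _).
by apply: sub_ext => r x; exact: sub_tm_id.
Qed.

Lemma sub_step G D (s : sub G D) (p : fm (ty0 :: G)) :
  sub_fm (up s) (step p) = step (sub_fm (up s) p).
Proof.
rewrite /step !sub_fm_comp scons_up scons_comp /=; congr (sub_fm (scons _ _) _).
Qed.

Lemma sub_eqt G D (s : sub G D) r (t u : tm G r) :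
  sub_fm s (eqt t u) = eqt (sub_tm s t) (sub_tm s u).
Proof.
elim: r G D s t u => //= a _ b IHb G D s t u.
by rewrite IHb /= !up_wk.
Qed.

Lemma sub_wk_fm G D a (s : sub G D) (p : fm G) :
  sub_fm (up (a := a) s) (wk_fm p) = wk_fm (sub_fm s p).
Proof. by rewrite /wk_fm !sub_fm_comp; congr sub_fm. Qed.

Lemma inst_wk G a (p : fm G) (t : tm G a) : inst (wk_fm p) t = p.
Proof. by rewrite /inst /wk_fm sub_fm_comp -[RHS]sub_fm_id; congr sub_fm. Qed.

Lemma axiom_sub G D (s : sub G D) (p : fm G) : axiom p -> axiom (sub_fm s p).
Proof.
case=> *; rewrite /= ?sub_eqt /= ?sub_inst ?sub_step; by constructor.
Qed.

(** * Derivations *)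

Lemma prf_sub G (H : list (fm G)) p : prf H p ->
  forall D (s : sub G D), prf (List.map (sub_fm s) H) (sub_fm s p).
Proof.
elim=> {G H p} G H.
- by move=> p ax D s; apply: p_ax; exact: axiom_sub.
- by move=> p pH D s; apply: p_hyp; apply: List.in_map.
- by move=> p _ IH D s; apply: p_raa; apply: IH.
- by move=> p q _ IH D s /=; apply: p_impI; apply: IH.
- by move=> p q _ IHp _ IHq D s; apply: p_impE (IHq D s); exact: (IHp D s).
- by move=> p q _ IHp _ IHq D s /=; apply: p_andI; [exact: IHp|exact: IHq].
- by move=> p q _ IH D s /=; apply: p_andE1; exact: (IH D s).
- by move=> p q _ IH D s /=; apply: p_andE2; exact: (IH D s).
- move=> r p _ IH D s /=; apply: p_allI; move: (IH _ (up s)).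
  rewrite !List.map_map; congr (prf _ _).
  by apply: List.map_ext => q; rewrite sub_wk_fm.
- by move=> r p t _ IH D s; rewrite sub_inst; apply: p_allE; exact: (IH D s).
Qed.

Lemma prf_incl G (H : list (fm G)) p : prf H p ->
  forall H', List.incl H H' -> prf H' p.
Proof.
elim=> {G H p} G H.
- by move=> *; apply: p_ax.
- by move=> p pH H' HH'; apply: p_hyp; exact: HH'.
- move=> p _ IH H' HH'; apply: p_raa; apply: IH => q [->|qH]; first by left.
  by right; exact: HH'.
- move=> p q _ IH H' HH'; apply: p_impI; apply: IH => q' [->|qH]; first by left.
  by right; exact: HH'.
- by move=> p q _ IHp _ IHq H' HH'; apply: p_impE (IHq _ HH'); exact: IHp.
- by move=> p q _ IHp _ IHq H' HH'; apply: p_andI; [exact: IHp|exact: IHq].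
- by move=> p q _ IH H' HH'; apply: p_andE1; exact: IH.
- by move=> p q _ IH H' HH'; apply: p_andE2; exact: IH.
- by move=> r p _ IH H' HH'; apply: p_allI; apply: IH; exact: List.incl_map.
- by move=> r p t _ IH H' HH'; apply: p_allE; exact: IH.
Qed.

Lemma prf_wk1 G (H : list (fm G)) p q : prf H p -> prf (q :: H) p.
Proof. by move/prf_incl; apply=> x; right. Qed.

Lemma prf_exfalso G (H : list (fm G)) p : prf H FBot -> prf H p.
Proof. by move=> Hf; apply: p_raa; exact: prf_wk1. Qed.

Lemma prf_wk_fm G (H : list (fm G)) a p :
  prf H p -> prf (List.map (@wk_fm G a) H) (wk_fm p).
Proof. by move=> Hp; exact: (prf_sub Hp sub_wk). Qed.

Lemma prf_cut G (H L : list (fm G)) p :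
  (forall q, List.In q L -> prf H q) -> prf L p -> prf H p.
Proof.
elim: L p => [|q L IH] p HL Lp; first by apply: prf_incl Lp _ _ => x [].
apply: (p_impE (p := q)); last by apply: HL; left.
by apply: IH (p_impI Lp) => x xL; apply: HL; right.
Qed.

(** * Provable equality at higher types *)

Lemma eqt_inst G a b (t u : tm G (a ~> b)) (x : tm G a) :
  inst (eqt (↑t · Var v0) (↑u · Var v0)) x = eqt (t · x) (u · x).
Proof. by rewrite /inst sub_eqt /= !sub_tm_wk !sub_tm_id. Qed.

Lemma wk_eqt G a r (t u : tm G r) : wk_fm (a := a) (eqt t u) = eqt ↑t ↑u.
Proof. exact: sub_eqt. Qed.

Lemma prf_eqt_refl G (H : list (fm G)) r (t : tm G r) : prf H (eqt t t).
Proof.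
elim: r G H t => [|a _ b IHb] G H t /=; first exact/p_ax/ax_refl.
exact/p_allI/IHb.
Qed.

Lemma prf_eqt_sym G (H : list (fm G)) r (t u : tm G r) :
  prf H (eqt t u) -> prf H (eqt u t).
Proof.
elim: r G H t u => [|a _ b IHb] G H t u /= Htu.
  by apply: p_impE Htu; exact/p_ax/ax_sym.
apply/p_allI/IHb; rewrite -eqt_inst; apply: p_allE.
by move/prf_wk_fm: Htu => /(_ a); rewrite (@wk_eqt _ _ (a ~> b)).
Qed.

Lemma prf_eqt_trans G (H : list (fm G)) r (t u v : tm G r) :
  prf H (eqt t u) -> prf H (eqt u v) -> prf H (eqt t v).
Proof.
elim: r G H t u v => [|a _ b IHb] G H t u v /= Htu Huv.
  by apply: p_impE Huv; apply: p_impE Htu; exact/p_ax/ax_trans.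
apply/p_allI/(IHb _ _ _ (↑u · Var v0)); rewrite -eqt_inst; apply: p_allE.
  by move/prf_wk_fm: Htu => /(_ a); rewrite (@wk_eqt _ _ (a ~> b)).
by move/prf_wk_fm: Huv => /(_ a); rewrite (@wk_eqt _ _ (a ~> b)).
Qed.

(** Extensionality as an axiom makes pointwise equality a congruence, which is
    what allows a model to be formed by dividing terms by provable equality. *)
Lemma prf_eqt_app G (H : list (fm G)) a b (f g : tm G (a ~> b)) (t u : tm G a) :
  prf H (eqt f g) -> prf H (eqt t u) -> prf H (eqt (f · t) (g · u)).
Proof.
move=> Hfg Htu; apply: (@prf_eqt_trans _ _ _ _ (f · u)).
  by apply: p_impE Htu; exact/p_ax/ax_ext.
by rewrite -eqt_inst; apply: p_allE.
Qed.

(** * Structures and models *)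

Record structure := Structure {
  car : ty -> Type;
  app : forall r s, car (r ~> s) -> car r -> car s;
  zero : car ty0;
  succ : car (ty0 ~> ty0);
  kc : forall r s, car (r ~> s ~> r);
  sc : forall d r s, car ((d ~> r ~> s) ~> (d ~> r) ~> d ~> s);
  rec : forall r, car (ty0 ~> r ~> (r ~> ty0 ~> r) ~> r) }.

Arguments app {M r s} : rename.
Arguments zero {M} : rename.
Arguments succ {M} : rename.
Arguments kc {M r s} : rename.
Arguments sc {M d r s} : rename.
Arguments rec {M r} : rename.

Declare Scope model_scope.
Delimit Scope model_scope with M.
Bind Scope model_scope with car.
Infix "@" := app (at level 11, left associativity) : model_scope.
Local Open Scope model_scope.

Section Semantics.
Variable M : structure.

Definition env (G : ctx) := forall r, var G r -> car M r.

Definition econs {G a} (x : car M a) (rho : env G) : env (a :: G) :=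
  fun r y =>
    match y in var G' r return
      match G' with
      | nil => unit
      | a' :: G'' => car M a' -> (forall r, var G'' r -> car M r) -> car M r
      end
    with
    | v0 => fun x _ => x
    | vS y => fun _ rho => rho _ y
    end x rho.

Definition enil : env nil :=
  fun r (x : var nil r) =>
    match x in var G' r return
      match G' with nil => car M r | _ => unit end
    with v0 => tt | vS _ => tt end.

Fixpoint eval {G} (rho : env G) {r} (t : tm G r) : car M r :=
  match t with
  | Var x => rho _ x
  | App f u => eval rho f @ eval rho u
  | Zero => zero
  | Succ => succ
  | Kc => kc
  | Sc => sc
  | Rec => rec
  end.

(** Equality of numbers is read as equality in the structure; extensional
    equality at higher types then is equality too, because models are required
    to be extensional. *)
Fixpoint sat {G} (rho : env G) (p : fm G) : Prop :=
  match p with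
  | FEq t u => eval rho t = eval rho u
  | FBot => False
  | FImp p q => sat rho p -> sat rho q
  | FAnd p q => sat rho p /\ sat rho q
  | FAll r p => forall x : car M r, sat (econs x rho) p
  end.

Lemma env_ext G (rho rho' : env G) :
  (forall r x, rho r x = rho' r x) -> rho = rho'.
Proof.
by move=> E; apply: functional_extensionality_dep => r;
  apply: functional_extensionality_dep => x.
Qed.

Lemma eval_sub G D (rho : env D) (s : sub G D) r (t : tm G r) :
  eval rho (sub_tm s t) = eval (fun r x => eval rho (s r x)) t.
Proof. by elim: t => //= r0 s0 f -> u ->. Qed.

Lemma eval_wk G a (x : car M a) (rho : env G) r (t : tm G r) :
  eval (econs x rho) (wk t) = eval rho t.
Proof. by rewrite eval_sub. Qed.

Lemma sat_sub G D (rho : env D) (s : sub G D) (p : fm G) :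
  sat rho (sub_fm s p) <-> sat (fun r x => eval rho (s r x)) p.
Proof.
elim: p D rho s => //= {G}.
- by move=> G t u D rho s; rewrite !eval_sub.
- by move=> G p IHp q IHq D rho s; rewrite IHp IHq.
- by move=> G p IHp q IHq D rho s; rewrite IHp IHq.
- move=> G r p IHp D rho s; split=> H x; have := H x; rewrite IHp;
    congr sat; apply: env_ext; apply: var_cases => //= r0 y;
    by rewrite eval_wk.
Qed.

End Semantics.

Arguments enil {M}.

(** The axioms under the reading of equality as identity. Induction stays a
    scheme over formulas with parameters: a model may be nonstandard, and its
    numbers admit no induction over arbitrary predicates. *)
Record is_model (M : structure) : Prop := IsModel {
  succ_inj : forall m n : car M ty0, succ @ m = succ @ n -> m = n;
  succ_neq0 : forall n : car M ty0, succ @ n <> zero;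
  kcE : forall r s (x : car M r) (y : car M s), kc @ x @ y = x;
  scE : forall d r s (f : car M (d ~> r ~> s)) (g : car M (d ~> r)) x,
      sc @ f @ g @ x = f @ x @ (g @ x);
  rec0 : forall r (a : car M r) h, rec @ zero @ a @ h = a;
  recS : forall r n (a : car M r) h,
      rec @ (succ @ n) @ a @ h = h @ (rec @ n @ a @ h) @ n;
  car_ext : forall r s (f g : car M (r ~> s)), (forall x, f @ x = g @ x) -> f = g;
  sat_ind : forall G (rho : env M G) (p : fm (ty0 :: G)),
      sat (econs zero rho) p ->
      (forall n, sat (econs n rho) p -> sat (econs (succ @ n) rho) p) ->
      forall n, sat (econs n rho) p }.

(** * Constants *)

(** Terms without variables over infinitely many constants in each type. The
    constants will be the witnesses of the Henkin construction. *)
Inductive ctm : ty -> Type :=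
| Cst r : nat -> ctm r
| CApp r s : ctm (r ~> s) -> ctm r -> ctm s
| CZero : ctm ty0
| CSucc : ctm (ty0 ~> ty0)
| CK r s : ctm (r ~> s ~> r)
| CS d r s : ctm ((d ~> r ~> s) ~> (d ~> r) ~> d ~> s)
| CRec r : ctm (ty0 ~> r ~> (r ~> ty0 ~> r) ~> r).

Definition cenv (G : ctx) := forall r, var G r -> ctm r.

Fixpoint tsub {G} (rho : cenv G) {r} (t : tm G r) : ctm r :=
  match t with
  | Var x => rho _ x
  | App f u => CApp (tsub rho f) (tsub rho u)
  | Zero => CZero
  | Succ => CSucc
  | Kc => CK _ _
  | Sc => CS _ _ _
  | Rec => CRec _
  end.

Definition cscons {G a} (t : ctm a) (rho : cenv G) : cenv (a :: G) :=
  fun r x =>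
    match x in var G' r return
      match G' with
      | nil => unit
      | a' :: G'' => ctm a' -> (forall r, var G'' r -> ctm r) -> ctm r
      end
    with
    | v0 => fun t _ => t
    | vS y => fun _ rho => rho _ y
    end t rho.

Definition cnil : cenv nil :=
  fun r (x : var nil r) =>
    match x in var G' r return
      match G' with nil => ctm r | _ => unit end
    with v0 => tt | vS _ => tt end.

Fixpoint cbound {r} (t : ctm r) : nat :=
  match t with
  | Cst _ i => i.+1
  | CApp f u => maxn (cbound f) (cbound u)
  | _ => 0
  end.

Lemma cenv_bound G (rho : cenv G) : exists N, forall r x, cbound (rho r x) <= N.
Proof.
elim: G rho => [|a G IH] rho; first by exists 0 => r x; dependent destruction x.
have [N HN] := IH (fun r x => rho r (vS x)).
exists (maxn N (cbound (rho a v0))); apply: var_cases => [|r x].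
  exact: leq_maxr.
exact: leq_trans (HN _ _) (leq_maxl _ _).
Qed.

(** * Enumerating the formulas *)

(** A task asks for a counterexample to [FAll tr tp] at the given values of the
    other variables. *)
Record task := Task { tG : ctx; tr : ty; tp : fm (tr :: tG); trho : cenv tG }.

Notation node := (@GenTree.Node nat).
Notation leaf := (@GenTree.Leaf nat).

Fixpoint ty_code (r : ty) : GenTree.tree nat :=
  match r with
  | ty0 => leaf 0
  | Arr a b => node 0 [:: ty_code a; ty_code b]
  end.

Fixpoint ctx_code (G : ctx) : GenTree.tree nat :=
  match G with
  | nil => leaf 0
  | r :: G => node 0 [:: ty_code r; ctx_code G]
  end.

Fixpoint var_code {G r} (x : var G r) : nat :=
  match x with v0 => 0 | vS y => (var_code y).+1 end.

Fixpoint tm_code {G r} (t : tm G r) : GenTree.tree nat :=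
  match t with
  | Var x => node 0 [:: leaf (var_code x)]
  | App f u => node 1 [:: tm_code f; tm_code u]
  | Zero => node 2 [::]
  | Succ => node 3 [::]
  | @Kc _ r s => node 4 [:: ty_code r; ty_code s]
  | @Sc _ d r s => node 5 [:: ty_code d; ty_code r; ty_code s]
  | @Rec _ r => node 6 [:: ty_code r]
  end.

Fixpoint fm_code {G} (p : fm G) : GenTree.tree nat :=
  match p with
  | FEq t u => node 0 [:: tm_code t; tm_code u]
  | FBot => node 1 [::]
  | FImp p q => node 2 [:: fm_code p; fm_code q]
  | FAnd p q => node 3 [:: fm_code p; fm_code q]
  | FAll r p => node 4 [:: ty_code r; fm_code p]
  end.

Fixpoint ctm_code {r} (t : ctm r) : GenTree.tree nat :=
  match t with
  | Cst r i => node 0 [:: ty_code r; leaf i]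
  | CApp f u => node 1 [:: ctm_code f; ctm_code u]
  | CZero => node 2 [::]
  | CSucc => node 3 [::]
  | CK r s => node 4 [:: ty_code r; ty_code s]
  | CS d r s => node 5 [:: ty_code d; ty_code r; ty_code s]
  | CRec r => node 6 [:: ty_code r]
  end.

Fixpoint cenv_code (G : ctx) : cenv G -> GenTree.tree nat :=
  match G return cenv G -> _ with
  | nil => fun _ => leaf 0
  | r :: G => fun rho =>
      node 0 [:: ctm_code (rho r v0); cenv_code (fun s x => rho s (vS x))]
  end.

Definition task_code (k : task) : nat :=
  pickle (node 0 [:: ctx_code (tG k); ty_code (tr k);
                     fm_code (tp k); cenv_code (@trho k)]).

Lemma ty_code_inj : injective ty_code.
Proof. by elim=> [|a IHa b IHb] [|a' b'] //= [/IHa -> /IHb ->]. Qed.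

Lemma ctx_code_inj : injective ctx_code.
Proof. by elim=> [|a G IH] [|a' G'] //= [/ty_code_inj -> /IH ->]. Qed.

Lemma var_code_inj G r (x : var G r) s (y : var G s) :
  var_code x = var_code y -> existT (var G) r x = existT (var G) s y.
Proof.
elim: x s y => {G r} G r.
  by move=> s y; dependent destruction y.
move=> s x IH s' y; dependent destruction y => //= -[/IH E].
by dependent destruction E.
Qed.

Lemma tm_code_inj G r (t : tm G r) s (u : tm G s) :
  tm_code t = tm_code u -> existT (tm G) r t = existT (tm G) s u.
Proof.
elim: t s u => {r}.
- move=> r x s [] //= s' y [/var_code_inj E]; by dependent destruction E.
- move=> r s f IHf t IHt s' [] //= r1 s1 f1 t1 [/IHf E1 /IHt E2].
  by dependent destruction E1; dependent destruction E2.
- by move=> s [].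
- by move=> s [].
- by move=> r s s' [] //= r1 s1 [/ty_code_inj -> /ty_code_inj ->].
- move=> d r s s' [] //= d1 r1 s1.
  by move=> [/ty_code_inj -> /ty_code_inj -> /ty_code_inj ->].
- by move=> r s' [] //= r1 [/ty_code_inj ->].
Qed.

Lemma fm_code_inj G : injective (@fm_code G).
Proof.
elim=> {G} G.
- move=> t u [] //= t' u' [/tm_code_inj E1 /tm_code_inj E2].
  by dependent destruction E1; dependent destruction E2.
- by case.
- by move=> p IHp q IHq [] //= p' q' [/IHp -> /IHq ->].
- by move=> p IHp q IHq [] //= p' q' [/IHp -> /IHq ->].
- move=> r p IHp [] //= r' p' [/ty_code_inj E].
  by case: _ / E p' => p' /IHp ->.
Qed.

Lemma ctm_code_inj r (t : ctm r) s (u : ctm s) :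
  ctm_code t = ctm_code u -> existT ctm r t = existT ctm s u.
Proof.
elim: t s u => {r}.
- by move=> r i s [] //= s' j [/ty_code_inj -> ->].
- move=> r s f IHf t IHt s' [] //= r1 s1 f1 t1 [/IHf E1 /IHt E2].
  by dependent destruction E1; dependent destruction E2.
- by move=> s [].
- by move=> s [].
- by move=> r s s' [] //= r1 s1 [/ty_code_inj -> /ty_code_inj ->].
- move=> d r s s' [] //= d1 r1 s1.
  by move=> [/ty_code_inj -> /ty_code_inj -> /ty_code_inj ->].
- by move=> r s' [] //= r1 [/ty_code_inj ->].
Qed.

Lemma cenv_code_inj G : injective (@cenv_code G).
Proof.
elim: G => [|a G IH] rho rho' /=.
  move=> _; apply: functional_extensionality_dep => r.
  by apply: functional_extensionality_dep => x; dependent destruction x.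
case=> /ctm_code_inj E1 /IH E2.
apply: functional_extensionality_dep => r.
apply: functional_extensionality_dep => x; move: r x; apply: var_cases.
  by dependent destruction E1.
by move=> r x; move/(congr1 (fun f => f r x)): E2.
Qed.

Lemma task_code_inj : injective task_code.
Proof.
case=> G r p rho [] G' r' p' rho' /(pcan_inj pickleK) /=.
case=> /ctx_code_inj E1 /ty_code_inj E2.
case: _ / E1 p' rho' => p' rho'; case: _ / E2 p' => p'.
by case=> /fm_code_inj -> /cenv_code_inj ->.
Qed.

(** Infinitely many repetitions are needed because a task can be treated only
    after the stages that introduce the constants it mentions. *)
Lemma task_enum : exists e : nat -> option task,
  forall k N, exists2 n, N <= n & e n = Some k.
Proof.
pose e0 (n : nat) : option task :=
  if pselect (exists k, task_code k = n) is left H then Some (projT1 (cid H))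
  else None.
exists (fun n => if (unpickle n : option (nat * nat)) is Some (i, _) then e0 i
                 else None).
move=> k N.
have e0k : e0 (task_code k) = Some k.
  rewrite /e0; case: pselect => [H|[]]; last by exists k.
  by case: (cid H) => k' /= /task_code_inj ->.
pose f (j : nat) : nat := pickle (task_code k, j).
have fI : injective f by move=> i j /(pcan_inj pickleK) [].
(* otherwise f would embed N + 1 indices into N values *)
have [j Nj] : exists j, N <= f j.
  apply: contrapT => /forallNP H.
  have fN j : f j < N by rewrite ltnNge; apply/negP/H.
  pose g (j : 'I_N.+1) : 'I_N := Ordinal (fN j).
  have /leq_card : injective g by move=> i j [/fI /val_inj].
  by rewrite !card_ord ltnn.
by exists (f j) => //; rewrite /f pickleK.
Qed.

(** * Henkin extensions *)

(** All types are inhabited; this is why a fresh variable can be discarded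
    again in a derivation. *)
Fixpoint dflt {G} (r : ty) : tm G r :=
  match r with ty0 => Zero | Arr a b => Kc · dflt b end.

Definition ty_eq_dec (r s : ty) : {r = s} + {r <> s}.
Proof. decide equality. Defined.

Lemma ty_eq_dec_refl r : ty_eq_dec r r = left (erefl r).
Proof. by case: (ty_eq_dec r r) => // e; rewrite (Prop_irrelevance e (erefl r)). Qed.

Definition task_ty (o : option task) : ty :=
  if o is Some k then tr k else ty0.

Section Stage.
Variables (G : ctx) (rd : forall r, nat -> tm G r).

(** [rd] will map the constants introduced so far to the variables of the current
    context and all others to default terms. So reading is total, and no record
    of the constants in a formula has to be carried along. *)
Fixpoint read {r} (t : ctm r) : tm G r :=
  match t with
  | Cst r i => rd r i
  | CApp f u => read f · read u
  | CZero => Zero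
  | CSucc => Succ
  | CK r s => Kc
  | CS d r s => Sc
  | CRec r => Rec
  end.

Definition read_env {D} (rho : cenv D) : sub D G := fun r x => read (rho r x).

Lemma read_tsub D (rho : cenv D) r (t : tm D r) :
  read (tsub rho t) = sub_tm (read_env rho) t.
Proof. by elim: t => //= r0 s f -> u ->. Qed.

Lemma read_env_cscons D a (t : ctm a) (rho : cenv D) :
  read_env (cscons t rho) = scons (read t) (read_env rho).
Proof. by apply: sub_ext; apply: var_cases. Qed.

(** The constant of index [n] whose type is the one of the task of stage [n]
    becomes the newest variable. *)
Definition next_rd (o : option task) (n : nat) : forall r, nat -> tm (task_ty o :: G) r :=
  fun r i =>
    if i == n then
      match ty_eq_dec (task_ty o) r with
      | left e => match e in _ = r return tm (task_ty o :: G) r with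
                  | erefl => Var v0 end
      | right _ => dflt r
      end
    else ↑(rd r i).

(** If there is a counterexample to [p], then the newest variable is one. *)
Definition henkin_ax D r (p : fm (r :: D)) (rho : cenv D) : fm (r :: G) :=
  FImp (sub_fm (up (read_env rho)) p) (wk_fm (sub_fm (read_env rho) (FAll r p))).

(** Apart from the Henkin axiom the universal statement itself is assumed
    whenever this is consistent. The same device decides every formula, since a
    formula can be quantified vacuously. *)
Definition next_hyps (o : option task) (H : list (fm G)) : list (fm (task_ty o :: G)) :=
  match o return list (fm (task_ty o :: G)) with
  | None => List.map wk_fm H
  | Some (@Task D r p rho) =>
      let q := wk_fm (sub_fm (read_env rho) (FAll r p)) in
      let H1 := henkin_ax p rho :: List.map wk_fm H in
      if pselect (prf (q :: H1) FBot) then H1 else q :: H1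
  end.

Lemma prf_unwk (H : list (fm G)) a :
  prf (List.map (@wk_fm G a) H) FBot -> prf H FBot.
Proof. by move=> /p_allI /p_allE -/(_ (dflt a)). Qed.

(** If the axiom were refutable, its premise would be provable for the fresh
    variable; generalization then gives its conclusion, which contradicts the
    refutation. *)
Lemma henkin_ax_consistent D r (p : fm (r :: D)) (rho : cenv D) H :
  prf (henkin_ax p rho :: List.map wk_fm H) FBot -> prf H FBot.
Proof.
rewrite /henkin_ax; set A := sub_fm (up (read_env rho)) p; set B := wk_fm _ => /p_impI HAB.
apply: (@prf_unwk _ r).
have HA : prf (List.map wk_fm H) A.
  apply: p_raa; apply: (p_impE (prf_wk1 _ HAB)); apply: p_impI.
  apply: prf_exfalso; apply: (p_impE (p := A)); apply: p_hyp; [right|]; by left.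
apply: (p_impE HAB); apply: p_impI; apply: prf_wk1.
exact: (prf_wk_fm r (p_allI HA)).
Qed.

Lemma next_consistent o H : ~ prf H FBot -> ~ prf (next_hyps o H) FBot.
Proof.
move=> HH; case: o => [[D r p rho]|] /=; last by move=> /prf_unwk.
by case: pselect => [Hq|//]; move/henkin_ax_consistent.
Qed.

Lemma next_hyps_wk o H p : prf H p -> prf (next_hyps o H) (wk_fm p).
Proof.
case: o => [[D r q rho]|] /=; last exact: prf_wk_fm.
move/prf_wk_fm => /(_ r) Hp; case: pselect => Hq; do ?[apply: prf_wk1]; exact: Hp.
Qed.

End Stage.

Lemma read_next G (rd : forall r, nat -> tm G r) o n r (t : ctm r) :
  cbound t <= n -> read (next_rd rd o n) t = ↑(read rd t).
Proof.
elim: t => //= {r}.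
  by move=> r i lin; rewrite /next_rd ltn_eqF.
by move=> r s f IHf u IHu; rewrite geq_max => /andP[/IHf -> /IHu ->].
Qed.

Lemma read_env_next G (rd : forall r, nat -> tm G r) o n D (rho : cenv D) (p : fm D) :
  (forall r x, cbound (rho r x) <= n) ->
  sub_fm (read_env (next_rd rd o n) rho) p = wk_fm (sub_fm (read_env rd rho) p).
Proof.
move=> Hrho; rewrite /wk_fm sub_fm_comp; congr sub_fm; apply: sub_ext => r x.
by rewrite /read_env read_next.
Qed.

(** Either the universal statement has been added, or its refutation together
    with the Henkin axiom refutes the instance at the newest constant. *)
Lemma next_dichotomy G (rd : forall r, nat -> tm G r) n H D r (p : fm (r :: D)) rho :
  (forall r x, cbound (rho r x) <= n) ->
  let o := Some (Task p rho) in
  prf (next_hyps rd o H) (sub_fm (read_env (next_rd rd o n) rho) (FAll r p)) \/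
  prf (next_hyps rd o H)
    (sub_fm (read_env (next_rd rd o n) (cscons (Cst r n) rho)) (FNot p)).
Proof.
move=> Hrho o; rewrite (read_env_next _ _ _ Hrho) /=.
case: pselect => [Hq|Hq]; [right|left]; last by apply: p_hyp; left.
apply: p_impI; apply: (p_impE (prf_wk1 _ (p_impI Hq))).
apply: (p_impE (p := sub_fm (up (read_env rd rho)) p)).
  by apply: p_hyp; right; left.
apply: p_hyp; left; rewrite read_env_cscons; congr sub_fm.
apply: sub_ext; apply: var_cases => [|s x] /=.
  by rewrite /next_rd eqxx /= ty_eq_dec_refl.
exact: (read_next rd o (Hrho _ x)).
Qed.

Section Henkin.
Variables (e : nat -> option task) (p0 : fm nil).
Hypothesis eP : forall k N, exists2 n, N <= n & e n = Some k.
Hypothesis p0P : ~ prf nil p0.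

Fixpoint stage_ctx (n : nat) : ctx :=
  if n is m.+1 then task_ty (e m) :: stage_ctx m else nil.

Fixpoint stage_rd (n : nat) : forall r, nat -> tm (stage_ctx n) r :=
  match n return forall r, nat -> tm (stage_ctx n) r with
  | 0 => fun r _ => dflt r
  | m.+1 => next_rd (stage_rd m) (e m) m
  end.

Fixpoint stage_hyps (n : nat) : list (fm (stage_ctx n)) :=
  match n return list (fm (stage_ctx n)) with
  | 0 => FNot p0 :: nil
  | m.+1 => next_hyps (stage_rd m) (e m) (stage_hyps m)
  end.

Lemma stage_consistent n : ~ prf (stage_hyps n) FBot.
Proof.
elim: n => [|n IHn] /=; last exact: next_consistent.
by move=> /p_raa.
Qed.

Definition at_stage n {G} (rho : cenv G) (p : fm G) :=
  prf (stage_hyps n) (sub_fm (read_env (stage_rd n) rho) p).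

(** Hypotheses persist only from the stage on at which all constants of [rho]
    are known, hence provability at all large stages. *)
Definition thy {G} (rho : cenv G) (p : fm G) : Prop :=
  exists N, forall n, N <= n -> at_stage n rho p.

Lemma thy_intro G (rho : cenv G) p n :
  (forall r x, cbound (rho r x) <= n) -> at_stage n rho p -> thy rho p.
Proof.
move=> Hrho Hp; exists n; elim=> [|m IHm].
  by rewrite leqn0 => /eqP E; move: Hp; rewrite E.
rewrite leq_eqVlt => /orP[/eqP E|]; first by move: Hp; rewrite E.
rewrite ltnS => nm; have {}Hp := IHm nm.
have Hm r x : cbound (rho r x) <= m by apply: leq_trans nm.
by rewrite /at_stage /= read_env_next //; exact: next_hyps_wk.
Qed.

Lemma thy_deduce G (rho : cenv G) (L : list (fm G)) p :
  (forall q, List.In q L -> thy rho q) -> prf L p -> thy rho p.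
Proof.
move=> HL Lp.
have [N HN] : exists N, forall n, N <= n -> forall q, List.In q L -> at_stage n rho q.
  elim: L {Lp} HL => [|q L IH] HL; first by exists 0.
  have [N1 H1] := HL q (or_introl (erefl _)).
  have [N2 H2] := IH (fun q' qL => HL q' (or_intror qL)).
  exists (maxn N1 N2) => n; rewrite geq_max => /andP[n1 n2] q' [<-|q'L].
    exact: H1.
  exact: H2.
exists N => n Nn; apply: prf_cut (prf_sub Lp _) => q' /List.in_map_iff[q [<- qL]].
exact: HN.
Qed.

Lemma thy_mp G (rho : cenv G) p q : thy rho (FImp p q) -> thy rho p -> thy rho q.
Proof.
move=> Hpq Hp; apply: (@thy_deduce _ _ [:: FImp p q; p]).
  by move=> _ [<-|[<-|[]]].
by apply: (p_impE (p := p)); apply: p_hyp; [left|right; left].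
Qed.

Lemma thy_consistent G (rho : cenv G) : ~ thy rho FBot.
Proof. by case=> N /(_ N (leqnn N)) /stage_consistent. Qed.

Lemma thy_henkin G (rho : cenv G) r (p : fm (r :: G)) :
  thy rho (FAll r p) \/ exists t, thy (cscons t rho) (FNot p).
Proof.
have [N HN] := cenv_bound rho.
have [n Nn en] := eP (Task p rho) N.
have Hn s x : cbound (rho s x) <= n by apply: leq_trans Nn.
have [Hall|Hnot] : at_stage n.+1 rho (FAll r p) \/
    at_stage n.+1 (cscons (Cst r n) rho) (FNot p).
  have := next_dichotomy (stage_rd n) (stage_hyps n) p Hn.
  by rewrite /at_stage /=; move: (e n) en => _ ->.
- by left; apply: thy_intro Hall => s x; apply: leq_trans (Hn _ _) _.
- right; exists (Cst r n); apply: thy_intro Hnot; apply: var_cases => //= s x.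
  exact: leq_trans (Hn _ _) _.
Qed.

Lemma thy_inst G (rho : cenv G) r (p : fm (r :: G)) t :
  thy rho (FAll r p) -> thy (cscons t rho) p.
Proof.
case=> N HN; exists N => n /HN /(p_allE (read (stage_rd n) t)).
by rewrite -/sub_fm inst_up /at_stage read_env_cscons.
Qed.

(** The dichotomy for a vacuous quantifier. *)
Lemma thy_dec G (rho : cenv G) p : thy rho p \/ thy rho (FNot p).
Proof.
have [Hp|[t [N HN]]] := thy_henkin rho (wk_fm (a := ty0) p); [left|right].
  apply: (@thy_deduce _ _ [:: FAll ty0 (wk_fm p)]); first by move=> _ [<-|[]].
  by rewrite -[p in prf _ p](inst_wk p (Zero : tm _ ty0)); apply/p_allE/p_hyp; left.
exists N => n /HN; rewrite /at_stage read_env_cscons /FNot /=.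
by rewrite /wk_fm sub_fm_comp.
Qed.

(** * The term model *)

Definition ceq {r} (t u : ctm r) : Prop :=
  exists N, forall n, N <= n ->
    prf (stage_hyps n) (eqt (read (stage_rd n) t) (read (stage_rd n) u)).

Lemma thy_eqt G (rho : cenv G) r (t u : tm G r) :
  thy rho (eqt t u) <-> ceq (tsub rho t) (tsub rho u).
Proof.
by split=> -[N HN]; exists N => n /HN; rewrite /at_stage sub_eqt !read_tsub.
Qed.

Lemma ceq_refl r (t : ctm r) : ceq t t.
Proof. by exists 0 => n _; exact: prf_eqt_refl. Qed.

Lemma ceq_sym r (t u : ctm r) : ceq t u -> ceq u t.
Proof. by case=> N HN; exists N => n /HN; exact: prf_eqt_sym. Qed.

Lemma ceq_trans r (t u v : ctm r) : ceq t u -> ceq u v -> ceq t v.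
Proof.
case=> N1 H1 [N2 H2]; exists (maxn N1 N2) => n; rewrite geq_max.
by move=> /andP[/H1 + /H2]; exact: prf_eqt_trans.
Qed.

Lemma ceq_app r s (f g : ctm (r ~> s)) (t u : ctm r) :
  ceq f g -> ceq t u -> ceq (CApp f t) (CApp g u).
Proof.
case=> N1 H1 [N2 H2]; exists (maxn N1 N2) => n; rewrite geq_max.
by move=> /andP[/H1 + /H2]; exact: prf_eqt_app.
Qed.

(** The quotient of terms by provable equality; classes are predicates, so that
    equal classes are identical objects. *)
Definition class_of (r : ty) := {P : ctm r -> Prop | exists t, P = ceq t}.

Definition cls {r} (t : ctm r) : class_of r := exist _ (ceq t) (ex_intro _ t (erefl _)).

Definition crepr {r} (c : class_of r) : ctm r := projT1 (cid (proj2_sig c)).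

Lemma clsP r (t u : ctm r) : cls t = cls u <-> ceq t u.
Proof.
split=> [[E]|E]; first by rewrite E; exact: ceq_refl.
rewrite /cls; have E' : ceq t = ceq u.
  apply: funext => v; apply: propext.
  by split; apply: ceq_trans => //; exact: ceq_sym.
by apply: eq_exist.
Qed.

Lemma creprK r (c : class_of r) : cls (crepr c) = c.
Proof.
case: c => P PP; rewrite /crepr /=; case: cid => t /= E.
exact: eq_exist.
Qed.

Lemma cls_surj r (c : class_of r) : exists t, c = cls t.
Proof. by exists (crepr c); rewrite creprK. Qed.

Definition term_model : structure := {|
  car := class_of;
  app := fun r s f t => cls (CApp (crepr f) (crepr t));
  zero := cls CZero;
  succ := cls CSucc;
  kc := fun r s => cls (CK r s);
  sc := fun d r s => cls (CS d r s);
  rec := fun r => cls (CRec r) |}.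

Lemma app_cls r s (f : ctm (r ~> s)) (t : ctm r) :
  app (M := term_model) (cls f) (cls t) = cls (CApp f t).
Proof. by apply/clsP/ceq_app; apply/clsP; rewrite creprK. Qed.

Lemma eval_cls G (rho : cenv G) r (t : tm G r) :
  eval (M := term_model) (fun s x => cls (rho s x)) t = cls (tsub rho t).
Proof. by elim: t => //= r0 s f -> u ->; exact: app_cls. Qed.

Lemma econs_cls G (rho : cenv G) a (t : ctm a) :
  econs (M := term_model) (cls t) (fun s x => cls (rho s x)) =
  (fun s x => cls (cscons t rho x)).
Proof. by apply: (env_ext (M := term_model)); apply: var_cases. Qed.

(** The cases of implication and of the universal quantifier use that the theory
    decides every formula and that it contains a counterexample for each
    universal formula it refutes. *)
Lemma truth G (p : fm G) (rho : cenv G) :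
  sat (M := term_model) (fun s x => cls (rho s x)) p <-> thy rho p.
Proof.
elim: p rho => {G} G /=.
- by move=> t u rho; rewrite !eval_cls clsP -(thy_eqt _ (r := ty0)).
- by move=> rho; split=> // /thy_consistent.
- move=> p IHp q IHq rho; rewrite IHp IHq; split=> [Hpq|]; last exact: thy_mp.
  have [/Hpq Hq|Hp] := thy_dec rho p.
    apply: (@thy_deduce _ _ [:: q]); first by move=> _ [<-|[]].
    by apply/p_impI/p_hyp; right; left.
  apply: (@thy_deduce _ _ [:: FNot p]); first by move=> _ [<-|[]].
  apply/p_impI/prf_exfalso/(p_impE (p := p)); apply: p_hyp; first by right; left.
  by left.
- move=> p IHp q IHq rho; rewrite IHp IHq; split=> [[Hp Hq]|Hpq].
    apply: (@thy_deduce _ _ [:: p; q]); first by move=> _ [<-|[<-|[]]].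
    by apply: p_andI; apply: p_hyp; [left|right; left].
  split; apply: (@thy_deduce _ _ [:: FAnd p q]); try by move=> _ [<-|[]].
    by apply/p_andE1/p_hyp; left.
  by apply/p_andE2/p_hyp; left.
- move=> r p IHp rho; split=> [Hp|Hp x]; last first.
    have [t ->] := cls_surj x; rewrite econs_cls IHp; exact: thy_inst.
  have [//|[t Ht]] := thy_henkin rho p; exfalso.
  move/(_ (cls t)): Hp; rewrite econs_cls IHp => Hp.
  exact: (thy_consistent (thy_mp Ht Hp)).
Qed.

Lemma thy_axiom G (rho : cenv G) p : axiom p -> thy rho p.
Proof. by move=> ax; apply: (@thy_deduce _ _ nil) => //; exact: p_ax. Qed.

Lemma term_model_sound G (p : fm G) (rho : env term_model G) :
  axiom p -> sat rho p.
Proof.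
have -> : rho = (fun s x => cls (crepr (rho s x))).
  by apply: env_ext => s x; rewrite creprK.
by move=> ax; apply/truth; exact: thy_axiom.
Qed.

Lemma sat_eqt G (rho : env term_model G) r (t u : tm G r) :
  sat rho (eqt t u) -> eval rho t = eval rho u.
Proof.
have -> : rho = (fun s x => cls (crepr (rho s x))).
  by apply: env_ext => s x; rewrite creprK.
by move/truth/thy_eqt/clsP; rewrite !eval_cls.
Qed.

Definition env1 {M a} (x : car M a) : env M (a :: nil) := econs x enil.
Definition env2 {M a b} (x : car M a) (y : car M b) : env M (a :: b :: nil) :=
  econs x (env1 y).
Definition env3 {M a b c} (x : car M a) (y : car M b) (z : car M c) :
  env M (a :: b :: c :: nil) := econs x (env2 y z).

(** Every axiom belongs to the theory, and by [truth] the theory holds in the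
    term model; the clauses are the axioms applied to variables. *)
Lemma term_model_is_model : is_model term_model.
Proof.
split.
- by move=> m n; exact: (term_model_sound (env2 m n) (ax_S_inj (Var v0) (Var (vS v0)))).
- by move=> n; exact: (term_model_sound (env1 n) (ax_S_neq0 (Var v0))).
- move=> r s x y.
  exact: (sat_eqt (term_model_sound (env2 x y) (ax_K (Var v0) (Var (vS v0))))).
- move=> d r s f g x.
  exact: (sat_eqt (term_model_sound (env3 f g x)
    (ax_Sc (Var v0) (Var (vS v0)) (Var (vS (vS v0)))))).
- move=> r a h.
  exact: (sat_eqt (term_model_sound (env2 a h) (ax_Rec0 (Var v0) (Var (vS v0))))).
- move=> r n a h.
  exact: (sat_eqt (term_model_sound (env3 n a h)
    (ax_RecS (Var v0) (Var (vS v0)) (Var (vS (vS v0)))))).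
- move=> r s f g fg.
  apply: (sat_eqt (rho := env2 f g) (t := Var v0) (u := Var (vS v0))).
  move=> /= x; have [f' Ef] := cls_surj f; have [g' Eg] := cls_surj g.
  have [x' Ex] := cls_surj x.
  have -> : econs (M := term_model) x (env2 f g) =
      (fun s y => cls (cscons x' (cscons f' (cscons g' cnil)) y)).
    rewrite Ex Ef Eg /env2 /env1 -!econs_cls; do 3!congr (econs _ _).
    by apply: env_ext => t y; dependent destruction y.
  apply/truth/thy_eqt/clsP => /=; rewrite -!app_cls -Ef -Eg -Ex; exact: fg.
- move=> G rho p p0' pS n.
  have /= := term_model_sound rho (ax_ind p); apply.
    apply/sat_sub; move: p0'; congr sat.
    by apply: env_ext; apply: var_cases.
  move=> m Hm; apply/sat_sub; move: (pS m Hm); congr sat.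
  by apply: env_ext; apply: var_cases.
Qed.

Lemma term_model_refutes : ~ sat (enil : env term_model nil) p0.
Proof.
have -> : (enil : env term_model nil) = (fun s x => cls (cnil x)).
  by apply: env_ext => s x; dependent destruction x.
move/truth => Hp; apply: (@thy_consistent _ (@cnil)); apply: thy_mp Hp.
apply: (@thy_intro _ _ _ 0) => [r x|]; first by dependent destruction x.
apply: p_hyp; left; rewrite /= /FNot; congr FImp.
rewrite -[LHS]sub_fm_id; congr sub_fm.
by apply: sub_ext => r x; dependent destruction x.
Qed.

End Henkin.

(** If [p] is not derivable, then its negation is consistent and the term model
    built from it refutes [p]. *)
Theorem completeness (p : fm nil) :
  (forall M, is_model M -> sat (enil : env M nil) p) -> EPA_proves p.
Proof.
move=> Hp; apply: contrapT => p0; have [e eP] := task_enum.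
exact: (term_model_refutes eP p0 (Hp _ (term_model_is_model eP p0))).
Qed.

(** * Evaluation of terms *)

Section Eval.
Variables (M : structure) (HM : is_model M).
Implicit Types G : ctx.

Lemma str_wk G a r (t : tm (a :: G) r) u : str t = Some u -> t = ↑u.
Proof.
elim: t u => //=; try by [move=> * ; match goal with H : Some _ = Some _ |- _ => case: H => <- end].
- by move=> r0 x u; dependent destruction x => //= -[<-].
- move=> r0 s f IHf t IHt u; case: (str f) IHf => // f' /(_ _ (erefl _)) ->.
  by case: (str t) IHt => // t' /(_ _ (erefl _)) -> [<-].
Qed.

(** The bracket abstraction of the language computes as expected; the case
    distinction on [str] only chooses a shorter combinator. *)
Lemma eval_lam G a b (rho : env M G) (t : tm (a :: G) b) x :
  eval rho (lam t) @ x = eval (econs x rho) t.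
Proof.
elim: t => /=; try by [move=> *; rewrite (kcE HM)].
- move=> r y; dependent destruction y => /=; last by rewrite (kcE HM).
  by rewrite (scE HM) !(kcE HM).
- move=> r s f IHf t IHt.
  case Ef: (str f) => [f'|] /=; last by rewrite (scE HM) IHf IHt.
  case Et: (str t) => [t'|] /=; last by rewrite (scE HM) IHf IHt.
  by rewrite (kcE HM) (str_wk Ef) (str_wk Et) !eval_wk.
Qed.

Lemma eval_lamN G a b (rho : env M G) (F : tm (a :: G) a -> tm (a :: G) b) x :
  eval rho (lamN F) @ x = eval (econs x rho) (F (Var v0)).
Proof. exact: eval_lam. Qed.

Lemma eval_lamN_congr G D a b (rho : env M G) (rho' : env M D)
    (F : tm (a :: G) a -> tm (a :: G) b) (F' : tm (a :: D) a -> tm (a :: D) b) :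
  (forall x, eval (econs x rho) (F (Var v0)) = eval (econs x rho') (F' (Var v0))) ->
  eval rho (lamN F) = eval rho' (lamN F').
Proof. by move=> E; apply: (car_ext HM) => x; rewrite !eval_lamN. Qed.

Lemma eval_App G r s (rho : env M G) (f : tm G (r ~> s)) t u v :
  eval rho f = u -> eval rho t = v -> eval rho (f · t) = u @ v.
Proof. by move=> <- <-. Qed.

Lemma eval_Zero G (rho : env M G) : eval rho Zero = zero. Proof. by []. Qed.
Lemma eval_Succ G (rho : env M G) : eval rho Succ = succ. Proof. by []. Qed.
Lemma eval_Rec G r (rho : env M G) : eval rho (Rec (r := r)) = rec. Proof. by []. Qed.
Lemma eval_Kc G r s (rho : env M G) : eval rho (Kc (r := r) (s := s)) = kc.
Proof. by []. Qed.

Lemma eval_wk' G a (x : car M a) (rho : env M G) r (t : tm G r) u :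
  eval rho t = u -> eval (econs x rho) ↑t = u.
Proof. by rewrite eval_wk. Qed.

Lemma eval_v0 G a (x : car M a) (rho : env M G) : eval (econs x rho) (Var v0) = x.
Proof. by []. Qed.

Lemma eval_vS G a (x : car M a) (rho : env M G) r (y : var G r) u :
  eval rho (Var y) = u -> eval (econs x rho) (Var (vS y)) = u.
Proof. by []. Qed.

Lemma eval_congr_App G D r s (rho : env M G) (rho' : env M D)
    (f : tm G (r ~> s)) (f' : tm D (r ~> s)) t t' :
  eval rho f = eval rho' f' -> eval rho t = eval rho' t' ->
  eval rho (f · t) = eval rho' (f' · t').
Proof. by move=> /= -> ->. Qed.

Lemma eval_congr_wk G D a b (x : car M a) (y : car M b) r (rho : env M G) (rho' : env M D)
    (t : tm G r) (t' : tm D r) :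
  eval rho t = eval rho' t' -> eval (econs x rho) ↑t = eval (econs y rho') ↑t'.
Proof. by rewrite !eval_wk. Qed.

Fixpoint nm (n : nat) : car M ty0 := if n is m.+1 then succ @ nm m else zero.

Lemma eval_num G (rho : env M G) n : eval rho (num n) = nm n.
Proof. by elim: n => //= n <-. Qed.

Lemma eval_close G (rho : env M G) r (t : tm nil r) : eval rho (close t) = eval enil t.
Proof.
rewrite /close eval_sub; apply: (f_equal (fun e => eval e t)); apply: env_ext => s x.
by dependent destruction x.
Qed.

End Eval.

Arguments econs {M G a} x rho r !y /.
Arguments nm M n : clear implicits.

(** * Symbols for the defined terms *)

Inductive sym :=
  | s_add | s_mul | s_pred | s_monus | s_pow2 | s_ite | s_isqrt | s_pair
  | s_pfst | s_psnd | s_qcode | s_qpos | s_qneg | s_qden | s_qfrac | s_qadd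
  | s_qmul | s_qopp | s_qabs | s_qsub | s_qle | s_qlt | s_qeps | s_qeps2
  | s_viol | s_hat_index | s_hat | s_rofq | s_rofnat | s_rinv | s_radd
  | s_ropp | s_rsub | s_rabs | s_rbound | s_rmul | s_part_index
  | s_riemann_sum | s_int_index | s_integral.

Definition sym_ty (s : sym) : ty :=
  match s with
  | s_add => ty0 ~> ty0 ~> ty0
  | s_mul => ty0 ~> ty0 ~> ty0
  | s_pred => ty0 ~> ty0
  | s_monus => ty0 ~> ty0 ~> ty0
  | s_pow2 => ty0 ~> ty0
  | s_ite => ty0 ~> ty0 ~> ty0 ~> ty0
  | s_isqrt => ty0 ~> ty0
  | s_pair => ty0 ~> ty0 ~> ty0
  | s_pfst => ty0 ~> ty0
  | s_psnd => ty0 ~> ty0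
  | s_qcode => ty0 ~> ty0 ~> ty0 ~> ty0
  | s_qpos => ty0 ~> ty0
  | s_qneg => ty0 ~> ty0
  | s_qden => ty0 ~> ty0
  | s_qfrac => ty0 ~> ty0 ~> ty0
  | s_qadd => ty0 ~> ty0 ~> ty0
  | s_qmul => ty0 ~> ty0 ~> ty0
  | s_qopp => ty0 ~> ty0
  | s_qabs => ty0 ~> ty0
  | s_qsub => ty0 ~> ty0 ~> ty0
  | s_qle => ty0 ~> ty0 ~> ty0
  | s_qlt => ty0 ~> ty0 ~> ty0
  | s_qeps => ty0 ~> ty0
  | s_qeps2 => ty0 ~> ty0
  | s_viol => ty1 ~> ty0 ~> ty0
  | s_hat_index => ty1 ~> ty0 ~> ty0
  | s_hat => ty1 ~> ty1
  | s_rofq => ty0 ~> ty1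
  | s_rofnat => ty0 ~> ty1
  | s_rinv => ty0 ~> ty1
  | s_radd => ty1 ~> ty1 ~> ty1
  | s_ropp => ty1 ~> ty1
  | s_rsub => ty1 ~> ty1 ~> ty1
  | s_rabs => ty1 ~> ty1
  | s_rbound => ty1 ~> ty0
  | s_rmul => ty1 ~> ty1 ~> ty1
  | s_part_index => ty1 ~> ty0 ~> ty0
  | s_riemann_sum => ty2 ~> ty1 ~> ty0 ~> ty0
  | s_int_index => ty2 ~> ty1 ~> ty0 ~> ty0
  | s_integral => ty2 ~> ty1 ~> ty1 ~> ty0 ~> ty0
  end.

Definition sym_tm (s : sym) : forall G, tm G (sym_ty s) :=
  match s return forall G, tm G (sym_ty s) with
  | s_add => @add
  | s_mul => @mul
  | s_pred => @pred
  | s_monus => @monus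
  | s_pow2 => @pow2
  | s_ite => @ite
  | s_isqrt => @isqrt
  | s_pair => @pair
  | s_pfst => @pfst
  | s_psnd => @psnd
  | s_qcode => @qcode
  | s_qpos => @qpos
  | s_qneg => @qneg
  | s_qden => @qden
  | s_qfrac => @qfrac
  | s_qadd => @qadd
  | s_qmul => @qmul
  | s_qopp => @qopp
  | s_qabs => @qabs
  | s_qsub => @qsub
  | s_qle => @qle
  | s_qlt => @qlt
  | s_qeps => @qeps
  | s_qeps2 => @qeps2
  | s_viol => @viol
  | s_hat_index => @hat_index
  | s_hat => @hat
  | s_rofq => @rofq
  | s_rofnat => @rofnat
  | s_rinv => @rinv
  | s_radd => @radd
  | s_ropp => @ropp
  | s_rsub => @rsub
  | s_rabs => @rabs
  | s_rbound => @rbound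
  | s_rmul => @rmul
  | s_part_index => @part_index
  | s_riemann_sum => @riemann_sum
  | s_int_index => @int_index
  | s_integral => @integral
  end.

(** The value of a symbol is known only through the equation [cvE]. What is used
    about it later are the recursion equations derived from that one, and its
    combinator form never matters. *)
Lemma sym_val M :
  {f : forall s : sym, car M (sym_ty s) | forall s, f s = eval enil (sym_tm s nil)}.
Proof. by exists (fun s => eval enil (sym_tm s nil)). Qed.

Definition cv M (s : sym) : car M (sym_ty s) := proj1_sig (sym_val M) s.

Lemma cvE M s : cv M s = eval enil (sym_tm s nil).
Proof. exact: (proj2_sig (sym_val M)). Qed.

(** The defined terms are closed but polymorphic in the context; their value does
    not depend on the context in which they are placed. *)
Class CtxFree r (c : forall G, tm G r) (v : forall M, car M r) :=
  ctx_free : forall M, is_model M -> forall G (rho : env M G), eval rho (c G) = v M.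
Arguments ctx_free {r} c {v _ M} HM {G} rho.

Ltac ev_congr HM :=
  cbn beta;
  lazymatch goal with
  | |- eval _ (lamN _) = eval _ (lamN _) =>
      refine (eval_lamN_congr HM _); intro; ev_congr HM
  | |- eval _ (App _ _) = eval _ (App _ _) =>
      refine (eval_congr_App _ _); ev_congr HM
  | |- eval (econs _ _) (wk _) = eval _ (wk _) =>
      refine (eval_congr_wk _ _ _); ev_congr HM
  | |- eval _ (Var _) = _ => reflexivity
  | |- eval _ Zero = _ => reflexivity
  | |- eval _ Succ = _ => reflexivity
  | |- eval _ Rec = _ => reflexivity
  | |- eval _ Kc = _ => reflexivity
  | |- eval ?rho (num ?n) = eval ?rho' _ =>
      exact (etrans (eval_num rho n) (esym (eval_num rho' n)))
  | |- eval ?rho (?c _) = eval ?rho' _ =>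
      exact (etrans (ctx_free c HM rho) (esym (ctx_free c HM rho')))
  end.

Tactic Notation "uncv" constr(s) reference(c) :=
  rewrite !(cvE _ s); cbv beta iota delta [sym_tm sym_ty]; unfold c.

(** * Context independence of the defined terms *)

#[export] Instance free_add : CtxFree (@add) (fun M => cv M s_add).
Proof. by move=> M HM G rho; uncv s_add add; ev_congr HM. Qed.
#[export] Hint Opaque add : typeclass_instances.
#[export] Instance free_mul : CtxFree (@mul) (fun M => cv M s_mul).
Proof. by move=> M HM G rho; uncv s_mul mul; ev_congr HM. Qed.
#[export] Hint Opaque mul : typeclass_instances.
#[export] Instance free_pred : CtxFree (@pred) (fun M => cv M s_pred).
Proof. by move=> M HM G rho; uncv s_pred pred; ev_congr HM. Qed.
#[export] Hint Opaque pred : typeclass_instances.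
#[export] Instance free_monus : CtxFree (@monus) (fun M => cv M s_monus).
Proof. by move=> M HM G rho; uncv s_monus monus; ev_congr HM. Qed.
#[export] Hint Opaque monus : typeclass_instances.
#[export] Instance free_pow2 : CtxFree (@pow2) (fun M => cv M s_pow2).
Proof. by move=> M HM G rho; uncv s_pow2 pow2; ev_congr HM. Qed.
#[export] Hint Opaque pow2 : typeclass_instances.
#[export] Instance free_ite : CtxFree (@ite) (fun M => cv M s_ite).
Proof. by move=> M HM G rho; uncv s_ite ite; ev_congr HM. Qed.
#[export] Hint Opaque ite : typeclass_instances.
#[export] Instance free_isqrt : CtxFree (@isqrt) (fun M => cv M s_isqrt).
Proof. by move=> M HM G rho; uncv s_isqrt isqrt; ev_congr HM. Qed.
#[export] Hint Opaque isqrt : typeclass_instances.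
#[export] Instance free_pair : CtxFree (@pair) (fun M => cv M s_pair).
Proof. by move=> M HM G rho; uncv s_pair pair; ev_congr HM. Qed.
#[export] Hint Opaque pair : typeclass_instances.
#[export] Instance free_pfst : CtxFree (@pfst) (fun M => cv M s_pfst).
Proof. by move=> M HM G rho; uncv s_pfst pfst; ev_congr HM. Qed.
#[export] Hint Opaque pfst : typeclass_instances.
#[export] Instance free_psnd : CtxFree (@psnd) (fun M => cv M s_psnd).
Proof. by move=> M HM G rho; uncv s_psnd psnd; ev_congr HM. Qed.
#[export] Hint Opaque psnd : typeclass_instances.
#[export] Instance free_qcode : CtxFree (@qcode) (fun M => cv M s_qcode).
Proof. by move=> M HM G rho; uncv s_qcode qcode; ev_congr HM. Qed.
#[export] Hint Opaque qcode : typeclass_instances.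
#[export] Instance free_qpos : CtxFree (@qpos) (fun M => cv M s_qpos).
Proof. by move=> M HM G rho; uncv s_qpos qpos; ev_congr HM. Qed.
#[export] Hint Opaque qpos : typeclass_instances.
#[export] Instance free_qneg : CtxFree (@qneg) (fun M => cv M s_qneg).
Proof. by move=> M HM G rho; uncv s_qneg qneg; ev_congr HM. Qed.
#[export] Hint Opaque qneg : typeclass_instances.
#[export] Instance free_qden : CtxFree (@qden) (fun M => cv M s_qden).
Proof. by move=> M HM G rho; uncv s_qden qden; ev_congr HM. Qed.
#[export] Hint Opaque qden : typeclass_instances.
#[export] Instance free_qfrac : CtxFree (@qfrac) (fun M => cv M s_qfrac).
Proof. by move=> M HM G rho; uncv s_qfrac qfrac; ev_congr HM. Qed.
#[export] Hint Opaque qfrac : typeclass_instances.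
#[export] Instance free_qadd : CtxFree (@qadd) (fun M => cv M s_qadd).
Proof. by move=> M HM G rho; uncv s_qadd qadd; ev_congr HM. Qed.
#[export] Hint Opaque qadd : typeclass_instances.
#[export] Instance free_qmul : CtxFree (@qmul) (fun M => cv M s_qmul).
Proof. by move=> M HM G rho; uncv s_qmul qmul; ev_congr HM. Qed.
#[export] Hint Opaque qmul : typeclass_instances.
#[export] Instance free_qopp : CtxFree (@qopp) (fun M => cv M s_qopp).
Proof. by move=> M HM G rho; uncv s_qopp qopp; ev_congr HM. Qed.
#[export] Hint Opaque qopp : typeclass_instances.
#[export] Instance free_qabs : CtxFree (@qabs) (fun M => cv M s_qabs).
Proof. by move=> M HM G rho; uncv s_qabs qabs; ev_congr HM. Qed.
#[export] Hint Opaque qabs : typeclass_instances.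
#[export] Instance free_qsub : CtxFree (@qsub) (fun M => cv M s_qsub).
Proof. by move=> M HM G rho; uncv s_qsub qsub; ev_congr HM. Qed.
#[export] Hint Opaque qsub : typeclass_instances.
#[export] Instance free_qle : CtxFree (@qle) (fun M => cv M s_qle).
Proof. by move=> M HM G rho; uncv s_qle qle; ev_congr HM. Qed.
#[export] Hint Opaque qle : typeclass_instances.
#[export] Instance free_qlt : CtxFree (@qlt) (fun M => cv M s_qlt).
Proof. by move=> M HM G rho; uncv s_qlt qlt; ev_congr HM. Qed.
#[export] Hint Opaque qlt : typeclass_instances.
#[export] Instance free_qeps : CtxFree (@qeps) (fun M => cv M s_qeps).
Proof. by move=> M HM G rho; uncv s_qeps qeps; ev_congr HM. Qed.
#[export] Hint Opaque qeps : typeclass_instances.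
#[export] Instance free_qeps2 : CtxFree (@qeps2) (fun M => cv M s_qeps2).
Proof. by move=> M HM G rho; uncv s_qeps2 qeps2; ev_congr HM. Qed.
#[export] Hint Opaque qeps2 : typeclass_instances.
#[export] Instance free_viol : CtxFree (@viol) (fun M => cv M s_viol).
Proof. by move=> M HM G rho; uncv s_viol viol; ev_congr HM. Qed.
#[export] Hint Opaque viol : typeclass_instances.
#[export] Instance free_hat_index : CtxFree (@hat_index) (fun M => cv M s_hat_index).
Proof. by move=> M HM G rho; uncv s_hat_index hat_index; ev_congr HM. Qed.
#[export] Hint Opaque hat_index : typeclass_instances.
#[export] Instance free_hat : CtxFree (@hat) (fun M => cv M s_hat).
Proof. by move=> M HM G rho; uncv s_hat hat; ev_congr HM. Qed.
#[export] Hint Opaque hat : typeclass_instances.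
#[export] Instance free_rofq : CtxFree (@rofq) (fun M => cv M s_rofq).
Proof. by move=> M HM G rho; uncv s_rofq rofq; ev_congr HM. Qed.
#[export] Hint Opaque rofq : typeclass_instances.
#[export] Instance free_rofnat : CtxFree (@rofnat) (fun M => cv M s_rofnat).
Proof. by move=> M HM G rho; uncv s_rofnat rofnat; ev_congr HM. Qed.
#[export] Hint Opaque rofnat : typeclass_instances.
#[export] Instance free_rinv : CtxFree (@rinv) (fun M => cv M s_rinv).
Proof. by move=> M HM G rho; uncv s_rinv rinv; ev_congr HM. Qed.
#[export] Hint Opaque rinv : typeclass_instances.
#[export] Instance free_radd : CtxFree (@radd) (fun M => cv M s_radd).
Proof. by move=> M HM G rho; uncv s_radd radd; ev_congr HM. Qed.
#[export] Hint Opaque radd : typeclass_instances.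
#[export] Instance free_ropp : CtxFree (@ropp) (fun M => cv M s_ropp).
Proof. by move=> M HM G rho; uncv s_ropp ropp; ev_congr HM. Qed.
#[export] Hint Opaque ropp : typeclass_instances.
#[export] Instance free_rsub : CtxFree (@rsub) (fun M => cv M s_rsub).
Proof. by move=> M HM G rho; uncv s_rsub rsub; ev_congr HM. Qed.
#[export] Hint Opaque rsub : typeclass_instances.
#[export] Instance free_rabs : CtxFree (@rabs) (fun M => cv M s_rabs).
Proof. by move=> M HM G rho; uncv s_rabs rabs; ev_congr HM. Qed.
#[export] Hint Opaque rabs : typeclass_instances.
#[export] Instance free_rbound : CtxFree (@rbound) (fun M => cv M s_rbound).
Proof. by move=> M HM G rho; uncv s_rbound rbound; ev_congr HM. Qed.
#[export] Hint Opaque rbound : typeclass_instances.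
#[export] Instance free_rmul : CtxFree (@rmul) (fun M => cv M s_rmul).
Proof. by move=> M HM G rho; uncv s_rmul rmul; ev_congr HM. Qed.
#[export] Hint Opaque rmul : typeclass_instances.
#[export] Instance free_part_index : CtxFree (@part_index) (fun M => cv M s_part_index).
Proof. by move=> M HM G rho; uncv s_part_index part_index; ev_congr HM. Qed.
#[export] Hint Opaque part_index : typeclass_instances.
#[export] Instance free_riemann_sum : CtxFree (@riemann_sum) (fun M => cv M s_riemann_sum).
Proof. by move=> M HM G rho; uncv s_riemann_sum riemann_sum; ev_congr HM. Qed.
#[export] Hint Opaque riemann_sum : typeclass_instances.
#[export] Instance free_int_index : CtxFree (@int_index) (fun M => cv M s_int_index).
Proof. by move=> M HM G rho; uncv s_int_index int_index; ev_congr HM. Qed.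
#[export] Hint Opaque int_index : typeclass_instances.
#[export] Instance free_integral : CtxFree (@integral) (fun M => cv M s_integral).
Proof. by move=> M HM G rho; uncv s_integral integral; ev_congr HM. Qed.
#[export] Hint Opaque integral : typeclass_instances.

(** [evp HM rho t] is a proof of an equation between [eval rho t] and a term in
    which variables are replaced by their values and symbols by [cv]; functions
    defined by abstraction are left alone until they are applied. *)
Ltac evp HM rho t :=
  lazymatch t with
  | App ?f ?u =>
      let pf := evp HM rho f in let pu := evp HM rho u in constr:(eval_App pf pu)
  | wk ?u =>
      lazymatch rho with
      | econs ?x ?rho' => let p := evp HM rho' u in constr:(eval_wk' x p)
      | _ => constr:(erefl (eval rho t))
      end
  | Var (vS ?y) =>
      lazymatch rho with
      | econs ?x ?rho' =>
          let p := evp HM rho' constr:(Var y) in constr:(eval_vS x p)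
      | _ => constr:(erefl (eval rho t))
      end
  | Var v0 =>
      lazymatch rho with
      | econs ?x ?rho' => constr:(eval_v0 x rho')
      | _ => constr:(erefl (eval rho t))
      end
  | Var _ => constr:(erefl (eval rho t))
  | Zero => constr:(eval_Zero rho)
  | Succ => constr:(eval_Succ rho)
  | @Rec _ ?r => constr:(eval_Rec r rho)
  | @Kc _ ?r ?s => constr:(eval_Kc r s rho)
  | num ?n => constr:(eval_num rho n)
  | lamN _ => constr:(erefl (eval rho t))
  | close ?u => constr:(eval_close rho u)
  | ?c _ => constr:(ctx_free c HM rho)
  | _ => constr:(erefl (eval rho t))
  end.

Ltac subst_eq p x :=
  pattern x; lazymatch goal with |- ?P _ => refine (@eq_ind_r _ _ P _ _ p) end;
  cbn beta.

(** Computes all values in the goal, including those of applied abstractions. *)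
Ltac evs HM :=
  cbn [sat FNot leN];
  repeat match goal with
  | |- context [eval ?rho (lamN ?F) @ ?x] =>
      subst_eq constr:(eval_lamN HM rho F x) constr:(eval rho (lamN F) @ x)
  | |- context [eval ?rho ?t] =>
      lazymatch t with lamN _ => fail | _ => idtac end;
      let p := evp HM rho t in
      lazymatch type of p with ?a = ?b => tryif constr_eq a b then fail else idtac end;
      subst_eq p constr:(eval rho t)
  end.

Notation "⟪ x , .. , y ⟫" := (econs x .. (econs y enil) ..)
  (x at level 99, y at level 99) : model_scope.
Notation "#0" := (Var v0) (at level 0).
Notation "#1" := (Var (vS v0)) (at level 0).
Notation "#2" := (Var (vS (vS v0))) (at level 0).
Notation "#3" := (Var (vS (vS (vS v0)))) (at level 0).
Notation "#4" := (Var (vS (vS (vS (vS v0))))) (at level 0).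
Notation "#5" := (Var (vS (vS (vS (vS (vS v0)))))) (at level 0).
Notation "#6" := (Var (vS (vS (vS (vS (vS (vS v0))))))) (at level 0).

(** The step function of a recursion is the value of an abstraction in some
    environment; by extensionality only its values count, not the environment. *)
Lemma rec_congr M (HM : is_model M) r (n : car M ty0) (a : car M r) h h' :
  (forall x y, h @ x @ y = h' @ x @ y) -> rec @ n @ a @ h = rec @ n @ a @ h'.
Proof. by move=> E; congr (_ @ _); do 2!apply: (car_ext HM) => ?. Qed.

Ltac unify_rec HM :=
  repeat match goal with
  | |- context [rec @ ?n @ ?a @ ?h] =>
      match goal with
      | |- context [rec @ n @ a @ ?h'] =>
          tryif constr_eq h h' then fail else
          let E := fresh in
          assert (E : rec @ n @ a @ h' = rec @ n @ a @ h)
            by (apply: (rec_congr HM) => ? ?; evs HM; reflexivity);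
          subst_eq E constr:(rec @ n @ a @ h'); clear E
      end
  end.

(** * Arithmetic in a model *)

(** A copy of the numbers of a model to which the algebraic structures are
    attached. *)
Definition NM M (HM : is_model M) : Type := car M ty0.
Definition nadd M (HM : is_model M) (m n : NM HM) : NM HM := cv M s_add @ m @ n.
Definition nmul M (HM : is_model M) (m n : NM HM) : NM HM := cv M s_mul @ m @ n.
Definition nzero M (HM : is_model M) : NM HM := zero.
Definition nsucc M (HM : is_model M) (n : NM HM) : NM HM := succ @ n.
Definition nmonus M (HM : is_model M) (m n : NM HM) : NM HM := cv M s_monus @ m @ n.
Definition npred M (HM : is_model M) (n : NM HM) : NM HM := cv M s_pred @ n.

Section Arithmetic.
Variables (M : structure) (HM : is_model M).
Notation N := (NM HM).
Notation "m + n" := (nadd m n) : model_scope.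
Notation "m * n" := (nmul m n) : model_scope.
Notation "m - n" := (nmonus m n) : model_scope.
Notation "0" := (nzero HM) : model_scope.
Notation S := (nsucc (HM := HM)).
Implicit Types m n k : N.

Lemma model_ind G (rho : env M G) (p : fm (ty0 :: G)) (P : N -> Prop) :
  (forall n, sat (econs (n : car M ty0) rho) p <-> P n) ->
  P 0 -> (forall n, P n -> P (S n)) -> forall n, P n.
Proof.
move=> E P0 PS n; apply/E; move: n; apply: (sat_ind HM); first exact/E.
by move=> n /E /PS /E.
Qed.

Lemma addn0 m : m + 0 = m.
Proof. by rewrite /nadd; uncv s_add add; evs HM; rewrite (rec0 HM). Qed.

Ltac nstep HM := rewrite (recS HM); evs HM; unify_rec HM.
Ltac ind_tac r p := refine (@model_ind _ r p _ _ _ _); first by move=> *; evs HM.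
Tactic Notation "ind" constr(r) uconstr(p) := ind_tac r p.

Lemma addnS m n : m + S n = S (m + n).
Proof. by rewrite /nadd; uncv s_add add; evs HM; nstep HM. Qed.

Lemma add0n n : 0 + n = n.
Proof.
move: n; ind (enil : env M nil) (FEq (add · Zero · #0) #0); first exact: addn0.
by move=> n IHn; rewrite addnS IHn.
Qed.

Lemma addSn m n : S m + n = S (m + n).
Proof.
move: n; ind ⟪m⟫ (FEq (add · (Succ · #1) · #0) (Succ · (add · #1 · #0))).
  by rewrite !addn0.
by move=> n IHn; rewrite !addnS IHn.
Qed.

Lemma addnC m n : m + n = n + m.
Proof.
move: n; ind ⟪m⟫ (FEq (add · #1 · #0) (add · #0 · #1)).
  by rewrite addn0 add0n.
by move=> n IHn; rewrite addnS addSn IHn.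
Qed.

Lemma addnA m n k : m + (n + k) = m + n + k.
Proof.
move: k; ind ⟪m, n⟫ (FEq (add · #1 · (add · #2 · #0)) (add · (add · #1 · #2) · #0)).
  by rewrite !addn0.
by move=> k IHk; rewrite !addnS IHk.
Qed.

Lemma muln0 m : m * 0 = 0.
Proof. by rewrite /nmul; uncv s_mul mul; evs HM; rewrite (rec0 HM). Qed.

Lemma mulnS m n : m * S n = m * n + m.
Proof.
by rewrite /nadd /nmul; uncv s_mul mul; evs HM; nstep HM.
Qed.

Lemma mul0n n : 0 * n = 0.
Proof.
move: n; ind (enil : env M nil) (FEq (mul · Zero · #0) Zero); first exact: muln0.
by move=> n IHn; rewrite mulnS IHn addn0.
Qed.

Lemma mulSn m n : S m * n = m * n + n.
Proof.
move: n; ind ⟪m⟫ (FEq (mul · (Succ · #1) · #0) (add · (mul · #1 · #0) · #0)).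
  by rewrite !muln0 addn0.
move=> n IHn; rewrite !mulnS IHn !addnS; congr S.
by rewrite -!addnA (addnC n).
Qed.

Lemma mulnC m n : m * n = n * m.
Proof.
move: n; ind ⟪m⟫ (FEq (mul · #1 · #0) (mul · #0 · #1)).
  by rewrite muln0 mul0n.
by move=> n IHn; rewrite mulnS mulSn IHn.
Qed.

Lemma mulnDl m n k : (m + n) * k = m * k + n * k.
Proof.
move: k; ind ⟪m, n⟫ (FEq (mul · (add · #1 · #2) · #0) (add · (mul · #1 · #0) · (mul · #2 · #0))).
  by rewrite !muln0 addn0.
move=> k IHk; rewrite !mulnS IHk -!addnA; congr (_ + _).
by rewrite !addnA; congr (_ + _); rewrite addnC.
Qed.

Lemma mulnA m n k : m * (n * k) = m * n * k.
Proof.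
move: k; ind ⟪m, n⟫ (FEq (mul · #1 · (mul · #2 · #0)) (mul · (mul · #1 · #2) · #0)).
  by rewrite !muln0.
by move=> k IHk; rewrite !mulnS mulnC mulnDl !(mulnC _ m) IHk.
Qed.

Lemma pred0 : npred 0 = 0.
Proof. by rewrite /npred; uncv s_pred pred; evs HM; rewrite (rec0 HM). Qed.

Lemma predS n : npred (S n) = n.
Proof. by rewrite /npred; uncv s_pred pred; evs HM; nstep HM. Qed.

Lemma nsuccI m n : S m = S n -> m = n.
Proof. exact: (succ_inj HM). Qed.

Lemma nsucc_neq0 n : S n <> 0.
Proof. exact: (succ_neq0 HM). Qed.

Lemma nat_case n : n = 0 \/ exists m, n = S m.
Proof.
have [->|n0] := pselect (n = 0); [by left|right; exists (npred n)].
suff H k : ~ k = 0 -> k = S (npred k) by exact: H.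
move: k; ind (enil : env M nil) (FImp (FNot (FEq #0 Zero)) (FEq #0 (Succ · (pred · #0)))).
  by [].
by move=> k _ _; rewrite predS.
Qed.

Lemma addIn m n k : m + k = n + k -> m = n.
Proof.
move: k; ind ⟪m, n⟫ (FImp (FEq (add · #1 · #0) (add · #2 · #0)) (FEq #1 #2)).
  by rewrite !addn0.
by move=> k IHk; rewrite !addnS => /nsuccI.
Qed.

Lemma monusn0 m : m - 0 = m.
Proof. by rewrite /nmonus; uncv s_monus monus; evs HM; rewrite (rec0 HM). Qed.

Lemma monusnS m n : m - S n = npred (m - n).
Proof.
by rewrite /npred /nmonus; uncv s_monus monus; evs HM; nstep HM.
Qed.

Lemma monusSS m n : S m - S n = m - n.
Proof.
move: n; ind ⟪m⟫ (FEq (monus · (Succ · #1) · (Succ · #0)) (monus · #1 · #0)).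
  by rewrite monusnS !monusn0 predS.
by move=> n IHn; rewrite monusnS IHn monusnS.
Qed.

Lemma monus0n n : 0 - n = 0.
Proof.
move: n; ind (enil : env M nil) (FEq (monus · Zero · #0) Zero); first exact: monusn0.
by move=> n IHn; rewrite monusnS IHn pred0.
Qed.

Lemma monusDl m n : m + n - m = n.
Proof.
move: m; ind ⟪n⟫ (FEq (monus · (add · #0 · #1) · #0) #1).
  by rewrite add0n monusn0.
by move=> m IHm; rewrite addSn monusSS.
Qed.

Lemma monusDr m n : m - (m + n) = 0.
Proof.
move: m; ind ⟪n⟫ (FEq (monus · #0 · (add · #0 · #1)) Zero).
  by rewrite monus0n.
by move=> m IHm; rewrite addSn monusSS.
Qed.

(** The maximum of two numbers is m + (n - m) and also n + (m - n), and one of the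
    two truncated differences vanishes. *)
Lemma nat_total m n : (exists k, m = n + k) \/ (exists k, n = m + k).
Proof.
have H1 : m + (n - m) = n + (m - n).
  move: m n; apply: (@model_ind _ (enil : env M nil)
    (FAll ty0 (FEq (add · #1 · (monus · #0 · #1)) (add · #0 · (monus · #1 · #0))))).
  - by move=> m; evs HM; split=> H n; move: (H n); evs HM => h; exact h.
  - by move=> n; rewrite monusn0 monus0n add0n addn0.
  move=> m IHm n; have [->|[k ->]] := nat_case n.
    by rewrite monusn0 monus0n add0n addn0.
  by rewrite !monusSS !addSn IHm.
have H2 : m - n <> 0 -> n - m = 0.
  clear H1; move: m n; apply: (@model_ind _ (enil : env M nil)
    (FAll ty0 (FImp (FNot (FEq (monus · #1 · #0) Zero)) (FEq (monus · #0 · #1) Zero)))).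
  - by move=> m; evs HM; split=> H n; move: (H n); evs HM => h; exact h.
  - by move=> n; rewrite monus0n.
  move=> m IHm n; have [->|[k ->]] := nat_case n; first by rewrite monus0n.
  by rewrite !monusSS; exact: IHm.
have [E|/H2 E] := pselect (m - n = 0).
  by right; exists (n - m); rewrite H1 E addn0.
by left; exists (m - n); rewrite -H1 E addn0.
Qed.

Lemma add_eq0 m n : m + n = 0 -> m = 0.
Proof. by have [->|[k ->]] := nat_case m => //; rewrite addSn => /nsucc_neq0. Qed.

Lemma mul_eq0 m n : m * n = 0 -> m = 0 \/ n = 0.
Proof.
have [->|[k ->]] := nat_case n; first by right.
by rewrite mulnS addnC => /add_eq0; left.
Qed.

End Arithmetic.

Import Order.TTheory GRing.Theory Num.Theory.
(** * The ordered field of fractions of a model *)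

Local Open Scope ring_scope.
Local Open Scope quotient_scope.

HB.instance Definition _ M (HM : is_model M) := gen_eqMixin (NM HM).
HB.instance Definition _ M (HM : is_model M) := gen_choiceMixin (NM HM).
HB.instance Definition _ M (HM : is_model M) :=
  GRing.isNmodule.Build (NM HM) (@addnA M HM) (@addnC M HM) (@add0n M HM).

Section SemiRing.
Variables (M : structure) (HM : is_model M).

Lemma mul1n : left_id (nsucc (nzero HM)) (@nmul M HM).
Proof. by move=> n; rewrite mulSn mul0n add0n. Qed.

Lemma one_neq0 : nsucc (nzero HM) != 0.
Proof. by apply/eqP; exact: nsucc_neq0. Qed.

HB.instance Definition _ := GRing.Nmodule_isComNzSemiRing.Build (NM HM)
  (@mulnA M HM) (@mulnC M HM) mul1n (@mulnDl M HM) (@mul0n M HM) one_neq0.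
End SemiRing.

Section Fractions.
Variables (M : structure) (HM : is_model M).
Notation N := (NM HM).

Lemma nsuccE (n : N) : nsucc n = n + 1.
Proof. by rewrite -[LHS]/(nsucc n) -[n in LHS]addr0 -addnS. Qed.

Lemma addrIn (m n k : N) : m + k = n + k -> m = n.
Proof. exact: addIn. Qed.

Lemma mulf0 (m n : N) : m * n = 0 -> m = 0 \/ n = 0.
Proof. exact: mul_eq0. Qed.

Lemma addf0 (m n : N) : m + n = 0 -> m = 0.
Proof. exact: add_eq0. Qed.

(** In the absence of subtraction, an equation is used by adding a multiple of it
    crosswise and cancelling. *)
Lemma lincomb1 (x y p q k : N) : p = q -> x + k * q = y + k * p -> x = y.
Proof. by move=> ->; exact: addrIn. Qed.

Lemma mulrIS (m n k : N) : m * (k + 1) = n * (k + 1) -> m = n.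
Proof.
have H (a b : N) : a * (k + 1) = (a + b) * (k + 1) -> a = a + b.
  move=> E; have : b * (k + 1) = 0.
    by apply: (@addrIn _ _ (a * (k + 1))); rewrite add0r {2}E; ring.
  case/mulf0 => [->|]; first by rewrite addr0.
  by rewrite -nsuccE => /nsucc_neq0.
by have [[j ->]|[j ->]] := nat_total m n => [/esym/H/esym|/H].
Qed.

(** The triple (a, b, c) stands for (a - b) / (c + 1), as in the coding of
    rationals in the language. *)
Record frac := Frac { fpos : N; fneg : N; fden : N }.
Definition frac_prod (x : frac) : N * N * N := (fpos x, fneg x, fden x).
Definition prod_frac (x : N * N * N) : frac := Frac x.1.1 x.1.2 x.2.
Lemma frac_prodK : cancel frac_prod prod_frac. Proof. by case. Qed.
HB.instance Definition _ := Equality.copy frac (can_type frac_prodK).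
HB.instance Definition _ := Choice.copy frac (can_type frac_prodK).

Definition feq (x y : frac) : bool :=
  fpos x * (fden y + 1) + fneg y * (fden x + 1) ==
  fpos y * (fden x + 1) + fneg x * (fden y + 1).

Lemma feq_equiv : equiv_class_of feq.
Proof.
split=> [x|x y|y x z]; first exact: eqxx.
  by rewrite /feq eq_sym.
case: x y z => [a b c] [a' b' c'] [a2 b2 c2]; rewrite /feq /= => /eqP H1 /eqP H2.
apply/eqP/(@mulrIS _ _ c'); apply: (lincomb1 (k := c2 + 1) H1).
apply: (lincomb1 (k := c + 1) H2); ring.
Qed.

Canonical feq_equiv_rel := EquivRelPack feq_equiv.
Definition QM := {eq_quot feq_equiv_rel}%qT.
HB.instance Definition _ := Choice.on QM.
HB.instance Definition _ := EqQuotient.on QM.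

Lemma QM_eq (x y : frac) : feq x y -> \pi_QM x = \pi_QM y.
Proof. by move=> E; apply/eqmodP. Qed.

Lemma feq_repr (x : frac) : feq (repr (\pi_QM x)) x.
Proof. by apply/eqmodP; rewrite reprK. Qed.

Lemma QM_ind (P : QM -> Prop) : (forall a b c, P (\pi_QM (Frac a b c))) -> forall x, P x.
Proof. by move=> H x; rewrite -[x]reprK; case: (repr x). Qed.

Definition faddf (x y : frac) : frac :=
  Frac (fpos x * (fden y + 1) + fpos y * (fden x + 1))
       (fneg x * (fden y + 1) + fneg y * (fden x + 1))
       (fden x * fden y + fden x + fden y).
Definition fmulf (x y : frac) : frac :=
  Frac (fpos x * fpos y + fneg x * fneg y)
       (fpos x * fneg y + fneg x * fpos y)
       (fden x * fden y + fden x + fden y).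
Definition foppf (x : frac) : frac := Frac (fneg x) (fpos x) (fden x).
Definition fposf (x : frac) : Prop := exists k, fpos x = fneg x + k.

Definition Qadd (x y : QM) : QM := \pi_QM (faddf (repr x) (repr y)).
Definition Qmul (x y : QM) : QM := \pi_QM (fmulf (repr x) (repr y)).
Definition Qopp (x : QM) : QM := \pi_QM (foppf (repr x)).
Definition Q0 : QM := \pi_QM (Frac 0 0 0).
Definition Q1 : QM := \pi_QM (Frac 1 0 0).

Lemma QaddE x y : Qadd (\pi_QM x) (\pi_QM y) = \pi_QM (faddf x y).
Proof.
apply: QM_eq; move: (feq_repr x) (feq_repr y).
case: (repr _) => [a b c]; case: (repr _) => [a' b' c'].
case: x y => [p q r] [p' q' r']; rewrite /feq /= => /eqP H1 /eqP H2; apply/eqP.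
apply: (lincomb1 (k := (c' + 1) * (r' + 1)) H1).
apply: (lincomb1 (k := (c + 1) * (r + 1)) H2); ring.
Qed.

Lemma QmulE x y : Qmul (\pi_QM x) (\pi_QM y) = \pi_QM (fmulf x y).
Proof.
apply: QM_eq; move: (feq_repr x) (feq_repr y).
case: (repr _) => [a b c]; case: (repr _) => [a' b' c'].
case: x y => [p q r] [p' q' r']; rewrite /feq /= => /eqP H1 /eqP H2; apply/eqP.
apply: (@lincomb1 _ _ _ _ (a' * (r' + 1)) H1).
apply: (@lincomb1 _ _ _ _ (b' * (r' + 1)) (esym H1)).
apply: (@lincomb1 _ _ _ _ (p * (c + 1)) H2).
apply: (@lincomb1 _ _ _ _ (q * (c + 1)) (esym H2)); ring.
Qed.

Lemma QoppE x : Qopp (\pi_QM x) = \pi_QM (foppf x).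
Proof.
apply: QM_eq; move: (feq_repr x); case: (repr _) => [a b c]; case: x => [p q r].
by rewrite /feq /= => /eqP H; apply/eqP; rewrite addrC -H addrC.
Qed.

Ltac Qring := repeat (elim/QM_ind => ???);
  rewrite ?(QaddE, QmulE, QoppE); apply: QM_eq; rewrite /feq /=;
  apply/eqP; ring.

Lemma QaddA : associative Qadd. Proof. by Qring. Qed.
Lemma QaddC : commutative Qadd. Proof. by Qring. Qed.
Lemma Qadd0 : left_id Q0 Qadd. Proof. by Qring. Qed.
Lemma QaddN : left_inverse Q0 Qopp Qadd. Proof. by Qring. Qed.
Lemma QmulA : associative Qmul. Proof. by Qring. Qed.
Lemma QmulC : commutative Qmul. Proof. by Qring. Qed.
Lemma Qmul1 : left_id Q1 Qmul. Proof. by Qring. Qed.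
Lemma QmulDl : left_distributive Qmul Qadd. Proof. by Qring. Qed.

Lemma Q1_neq0 : Q1 != Q0.
Proof.
apply/eqP => /eqmodP; rewrite /= /feq /= !(add0r, addr0, mul0r, mul1r) => /eqP.
exact/eqP/one_neq0.
Qed.

HB.instance Definition _ := GRing.isZmodule.Build QM QaddA QaddC Qadd0 QaddN.
HB.instance Definition _ :=
  GRing.Zmodule_isComNzRing.Build QM QmulA QmulC Qmul1 QmulDl Q1_neq0.

Definition finv (x : frac) : frac :=
  let d := nmonus (fpos x) (fneg x) in
  let e := nmonus (fneg x) (fpos x) in
  if d != 0 then Frac (fden x + 1) 0 (npred d) else Frac 0 (fden x + 1) (npred e).

Definition Qinv (x : QM) : QM := if x == 0 then 0 else \pi_QM (finv (repr x)).

Lemma nonzeroP (n : N) : n <> 0 -> exists m, n = m + 1.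
Proof.
by move=> n0; have [//|[m ->]] := nat_case n; exists m; rewrite nsuccE.
Qed.

Lemma npred1 (n : N) : npred (n + 1) = n.
Proof. by rewrite -nsuccE predS. Qed.

(** A nonzero fraction has a > b or b > a, and the nonzero difference is one more
    than a number, so that it can serve as a denominator. *)
Lemma QmulVf (x : QM) : x != 0 -> Qinv x * x = 1.
Proof.
rewrite /Qinv => x0; rewrite (negbTE x0).
rewrite -[x in _ * x]reprK -[x in x != 0]reprK in x0 *.
case: (repr x) x0 => [a b c] x0; rewrite -[LHS]/(Qmul _ _) QmulE.
apply: QM_eq; rewrite /feq /finv /=; apply/eqP.
have ab : a <> b.
  by move=> E; case/eqP: x0; apply: QM_eq; rewrite /feq /= E; apply/eqP; ring.
have [[k E]|[k E]] := nat_total a b.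
  have Ed : nmonus a b = k by rewrite E monusDl.
  have [|j Ej] := @nonzeroP k; first by move=> k0; apply: ab; rewrite E k0 addn0.
  have jn0 : j + 1 != 0 by rewrite -nsuccE; apply/eqP/nsucc_neq0.
  rewrite Ed E {E Ed}Ej jn0 /= npred1 -[nadd _ _]/(b + (j + 1)); ring.
have Ed : nmonus b a = k by rewrite E monusDl.
have Ed' : nmonus a b = 0 by rewrite E monusDr.
have [|j Ej] := @nonzeroP k; first by move=> k0; apply: ab; rewrite E k0 addn0.
rewrite Ed Ed' eqxx E {E Ed Ed'}Ej /= npred1 -[nadd _ _]/(a + (j + 1)); ring.
Qed.

Lemma Qinv0 : Qinv 0 = 0. Proof. by rewrite /Qinv eqxx. Qed.

HB.instance Definition _ := GRing.ComNzRing_isField.Build QM QmulVf Qinv0.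

Definition Qnn (x : QM) : Prop := fposf (repr x).

Lemma QnnE x : Qnn (\pi_QM x) <-> fposf x.
Proof.
have H y z : feq y z -> fposf y -> fposf z.
  case: y z => [a b c] [a' b' c']; rewrite /feq /fposf /= => /eqP E [k Ek].
  have [//|[j Ej]] := nat_total a' b'.
  have : k * (c' + 1) + j * (c + 1) = 0.
    apply: (@addrIn _ _ (a' * (c + 1) + b * (c' + 1))); rewrite add0r -[RHS]E Ek Ej.
    by rewrite -[nadd a' j]/(a' + j); ring.
  rewrite addrC => /addf0/mulf0[j0|]; last by rewrite -nsuccE => /nsucc_neq0.
  by exists 0; rewrite Ej j0 -[nadd a' 0]/(a' + 0) !addr0.
by split; apply: H; rewrite ?feq_repr // /feq eq_sym -/(feq _ _) feq_repr.
Qed.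

Definition Qle (x y : QM) : bool := `[< Qnn (y - x) >].
Definition Qlt (x y : QM) : bool := (y != x) && Qle x y.
Definition Qnorm (x : QM) : QM := if Qle 0 x then x else - x.

Lemma Qle0P x : Qle 0 x <-> Qnn x.
Proof. by rewrite /Qle subr0; split=> /asboolP. Qed.

Lemma Qle0_pi x : Qle 0 (\pi_QM x) <-> fposf x.
Proof. by rewrite Qle0P QnnE. Qed.

Lemma Qle0_add x y : Qle 0 x -> Qle 0 y -> Qle 0 (x + y).
Proof.
elim/QM_ind: x => a b c; elim/QM_ind: y => a' b' c'.
rewrite -[_ + _]/(Qadd _ _) QaddE => /Qle0_pi [/= k ->] /Qle0_pi [/= k' ->].
apply/Qle0_pi; exists (k * (c' + 1) + k' * (c + 1)) => /=.
ring.
Qed.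

Lemma Qle0_mul x y : Qle 0 x -> Qle 0 y -> Qle 0 (x * y).
Proof.
elim/QM_ind: x => a b c; elim/QM_ind: y => a' b' c'.
rewrite -[_ * _]/(Qmul _ _) QmulE => /Qle0_pi [/= k ->] /Qle0_pi [/= k' ->].
apply/Qle0_pi; exists (k * k') => /=.
ring.
Qed.

Lemma Qle0_anti x : Qle 0 x -> Qle x 0 -> x = 0.
Proof.
elim/QM_ind: x => a b c /Qle0_pi [/= k Ek].
rewrite {1}/Qle -/Q0 => /asboolP; rewrite sub0r -[- _]/(Qopp _) QoppE.
move/QnnE => [/= j Ej]; apply: QM_eq; rewrite /feq /=; apply/eqP.
suff -> : a = b by ring.
suff k0 : k = 0 by rewrite Ek k0 addr0.
apply: (@addf0 _ j); apply: (@addrIn _ _ b); rewrite add0r [in RHS]Ej Ek.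
ring.
Qed.

Lemma Qsub_ge0 x y : Qle 0 (y - x) = Qle x y.
Proof. by rewrite /Qle subr0. Qed.

Lemma Qle0_total x : Qle 0 x || Qle x 0.
Proof.
elim/QM_ind: x => a b c; apply/orP.
have [[k E]|[k E]] := nat_total a b; [left|right].
  by apply/Qle0_pi; exists k.
rewrite -Qsub_ge0 sub0r -[- _]/(Qopp _) QoppE; apply/Qle0_pi; by exists k.
Qed.

Lemma QnormN x : Qnorm (- x) = Qnorm x.
Proof.
rewrite /Qnorm -{1}[- x]sub0r Qsub_ge0 opprK.
have := Qle0_total x; case E1: (Qle 0 x); case E2: (Qle x 0) => //= _.
by rewrite (Qle0_anti E1 E2) oppr0.
Qed.

Lemma Qge0_norm x : Qle 0 x -> Qnorm x = x.
Proof. by rewrite /Qnorm => ->. Qed.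

Lemma Qlt_def x y : Qlt x y = (y != x) && Qle x y. Proof. by []. Qed.

HB.instance Definition _ := Num.IntegralDomain_isLeReal.Build QM
  Qle0_add Qle0_mul Qle0_anti Qsub_ge0 Qle0_total QnormN Qge0_norm Qlt_def.

End Fractions.

(** * Coded numbers and rationals *)

(** The embedding of numbers into the field of fractions; only its characteristic
    equations are used. *)
Lemma nq_val M (HM : is_model M) : {f : car M ty0 -> QM HM |
  forall n, f n = \pi_(QM HM)%qT (Frac (n : NM HM) 0 0)}.
Proof. by exists (fun n => \pi_(QM HM)%qT (Frac (n : NM HM) 0 0)). Qed.

Definition nq M (HM : is_model M) : car M ty0 -> QM HM := proj1_sig (nq_val HM).

Lemma nqE M (HM : is_model M) n : nq HM n = \pi_(QM HM)%qT (Frac (n : NM HM) 0 0).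
Proof. exact: (proj2_sig (nq_val HM)). Qed.

Lemma frac_add (F : fieldType) (a b c d p q : F) : p != 0 -> q != 0 ->
  (a * q + b * p - (c * q + d * p)) / (p * q) = (a - c) / p + (b - d) / q.
Proof. by move=> p0 q0; field; rewrite p0 q0. Qed.

Lemma frac_mul (F : fieldType) (a b c d p q : F) : p != 0 -> q != 0 ->
  (a * b + c * d - (a * d + c * b)) / (p * q) = (a - c) / p * ((b - d) / q).
Proof. by move=> p0 q0; field; rewrite p0 q0. Qed.

Section Numbers.
Variables (M : structure) (HM : is_model M).
Notation N := (car M ty0).
Notation nq := (nq HM).
Notation "m ⊕ n" := (cv M s_add @ m @ n) (at level 50, left associativity).
Notation "m ⊗ n" := (cv M s_mul @ m @ n) (at level 40, left associativity).
Implicit Types m n k : N.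

Lemma absurd_lt : 0 < 0 :> QM HM -> False.
Proof. by rewrite ltxx. Qed.

(** Induction for a predicate that is expressed by a formula with parameters
    [rho] from the model. *)
Lemma formula_ind G (rho : env M G) (p : fm (ty0 :: G)) (P : N -> Prop) :
  (forall n, sat (econs n rho) p <-> P n) ->
  P zero -> (forall n, P n -> P (succ @ n)) -> forall n, P n.
Proof.
move=> E P0 PS n; apply/E; move: n; apply: (sat_ind HM); first exact/E.
by move=> n /E /PS /E.
Qed.

Lemma ncase n : n = zero \/ exists m, n = succ @ m.
Proof. exact: (@nat_case M HM). Qed.

Lemma nq_add m n : nq (m ⊕ n) = nq m + nq n.
Proof.
rewrite !nqE -[RHS]/(Qadd _ _) QaddE; apply: QM_eq; rewrite /feq /=; apply/eqP.
rewrite -[cv M s_add @ m @ n]/((m : NM HM) + n); ring.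
Qed.

Lemma nq_mul m n : nq (m ⊗ n) = nq m * nq n.
Proof.
rewrite !nqE -[RHS]/(Qmul _ _) QmulE; apply: QM_eq; rewrite /feq /=; apply/eqP.
rewrite -[cv M s_mul @ m @ n]/((m : NM HM) * n); ring.
Qed.

Lemma nq_zero : nq zero = 0.
Proof. by rewrite nqE. Qed.

Lemma nq_succ n : nq (succ @ n) = nq n + 1.
Proof.
rewrite !nqE -[RHS]/(Qadd _ _) QaddE; apply: QM_eq; rewrite /feq /=; apply/eqP.
rewrite -[succ @ n]/(nsucc (n : NM HM)) nsuccE; ring.
Qed.

Lemma nq_num i : nq (nm M i) = i%:R.
Proof. by elim: i => [|i IH] /=; rewrite ?nq_zero // nq_succ IH -natr1. Qed.

Lemma nq_ge0 n : 0 <= nq n.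
Proof. by rewrite nqE -[_ <= _]/(Qle 0 _); apply/Qle0_pi; exists (n : NM HM); rewrite add0r. Qed.

Lemma nq_le_ex m n : nq m <= nq n -> exists k, n = m ⊕ k.
Proof.
rewrite !nqE -[_ <= _]/(Qle _ _) -Qsub_ge0 -[_ - _]/(Qadd _ (Qopp _)) QoppE QaddE.
move/Qle0_pi => [k]; rewrite /= !(mulr1, add0r, mul0r, mul1r, addr0, mulr0) => ->.
by exists k.
Qed.

Lemma nq_inj : injective nq.
Proof.
move=> m n E; have [|k Ek] := @nq_le_ex m n; first by rewrite E.
have : nq k = 0 by have := nq_add m k; rewrite -Ek E => /eqP; rewrite -subr_eq0 => /eqP; lra.
rewrite nqE => /eqmodP; rewrite /= /feq /= !(mulr1, add0r, mul0r, mul1r, addr0, mulr0).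
by move/eqP => k0; rewrite Ek k0; apply/esym/(@addn0 M HM).
Qed.

(** Numbers are discrete, also in a nonstandard model. *)
Lemma nq_lt m n : nq m < nq n -> nq m + 1 <= nq n.
Proof.
move=> mn; have [k Ek] := nq_le_ex (ltW mn).
have [k0|[j Ej]] := ncase k.
  by move: mn; rewrite Ek k0 nq_add nq_zero addr0 ltxx.
by rewrite Ek Ej nq_add nq_succ; have := nq_ge0 j; lra.
Qed.

Lemma nq_ge1 n : nq n != 0 -> 1 <= nq n.
Proof.
by move=> n0; have := @nq_lt zero n; rewrite nq_zero add0r; apply; rewrite lt_def n0 nq_ge0.
Qed.

Lemma nq_lt_le m n : nq m < nq n + 1 -> nq m <= nq n.
Proof. by move=> h; rewrite leNgt; apply/negP => /nq_lt h2; apply: absurd_lt; lra. Qed.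

Lemma nq_monus_le m n : nq m <= nq n -> cv M s_monus @ m @ n = zero.
Proof. by move/nq_le_ex => [k ->]; exact: (@monusDr M HM). Qed.

Lemma nq_monus_ge m n : nq n <= nq m -> nq (cv M s_monus @ m @ n) = nq m - nq n.
Proof.
move/nq_le_ex => [k ->]; rewrite nq_add addrC addKr; congr nq.
exact: (@monusDl M HM).
Qed.

Lemma monusE m n : (cv M s_monus @ m @ n = zero) = (nq m <= nq n).
Proof.
apply: propext; split=> [E|]; last exact: nq_monus_le.
have [//|mn] := leP (nq m) (nq n); have := nq_monus_ge (ltW mn).
by rewrite E nq_zero => h; exfalso; apply: absurd_lt; clear E; lra.
Qed.

Lemma nq_pred n : 1 <= nq n -> nq (cv M s_pred @ n) = nq n - 1.
Proof.
have [->|[m ->]] := ncase n; first by rewrite nq_zero ler10.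
by rewrite nq_succ -[cv M s_pred @ _]/(npred (nsucc (m : NM HM))) predS addrK.
Qed.

Lemma iteE c (a b : N) : cv M s_ite @ c @ a @ b = if nq c == 0 then a else b.
Proof.
uncv s_ite ite; evs HM; have [->|[m ->]] := ncase c.
  by rewrite nq_zero eqxx (rec0 HM).
rewrite nq_succ (recS HM); evs HM; case: eqP => // E; exfalso.
by apply: absurd_lt; have := nq_ge0 m; lra.
Qed.

Lemma pow2_0 : nq (cv M s_pow2 @ zero) = 1.
Proof. by uncv s_pow2 pow2; evs HM; rewrite (rec0 HM) nq_num. Qed.

Lemma pow2_S n : nq (cv M s_pow2 @ (succ @ n)) = 2 * nq (cv M s_pow2 @ n).
Proof.
uncv s_pow2 pow2; evs HM; rewrite (recS HM); evs HM; rewrite nq_add.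
by unify_rec HM; rewrite -mulr2n mulr_natl.
Qed.

Lemma formula_ind_eq G (rho : env M G) (p : fm (ty0 :: G)) (P : N -> Prop) :
  (forall n, sat (econs n rho) p = P n) ->
  P zero -> (forall n, P n -> P (succ @ n)) -> forall n, P n.
Proof. by move=> E; apply: (formula_ind (rho := rho) (p := p)) => n; rewrite E. Qed.

Lemma isqrt_S n (r := cv M s_isqrt @ n) : cv M s_isqrt @ (succ @ n) =
  if (nq r + 1) * (nq r + 1) <= nq n + 1 then succ @ r else r.
Proof.
have -> : cv M s_isqrt @ (succ @ n) =
    cv M s_ite @ (cv M s_monus @ ((succ @ r) ⊗ (succ @ r)) @ (succ @ n)) @ (succ @ r) @ r.
  rewrite {}/r; uncv s_isqrt isqrt; evs HM; rewrite (recS HM); evs HM.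
  by unify_rec HM.
rewrite iteE; have <- : (cv M s_monus @ (succ @ r ⊗ (succ @ r)) @ (succ @ n) == zero :> NM HM) =
  ((nq r + 1) * (nq r + 1) <= nq n + 1).
  by apply/eqP/idP; rewrite monusE nq_mul !nq_succ.
by congr (if _ then _ else _); apply/eqP/eqP => [|->]; [rewrite -nq_zero => /nq_inj|rewrite nq_zero].
Qed.

Lemma isqrt_spec n (r := nq (cv M s_isqrt @ n)) :
  r * r <= nq n /\ nq n + 1 <= (r + 1) * (r + 1).
Proof.
rewrite {}/r; move: n; apply: (formula_ind_eq (rho := enil) (p := FAnd
  (FEq (monus · (mul · (isqrt · #0) · (isqrt · #0)) · #0) Zero)
  (FEq (monus · (Succ · #0) · (mul · (Succ · (isqrt · #0)) · (Succ · (isqrt · #0)))) Zero))).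
- by move=> n; evs HM; rewrite !monusE !nq_mul !nq_succ.
- have -> : cv M s_isqrt @ zero = zero by uncv s_isqrt isqrt; evs HM; rewrite (rec0 HM).
  by rewrite nq_zero; split; lra.
- move=> n [h1 h2]; rewrite isqrt_S nq_succ; have r0 := nq_ge0 (cv M s_isqrt @ n).
  case: ifP => [h3|/negbT]; rewrite ?nq_succ -?ltNge; last move=> h3; first by split; lra.
  split; first lra.
  move: (@nq_lt (succ @ n) (succ @ (cv M s_isqrt @ n) ⊗ (succ @ (cv M s_isqrt @ n)))).
  by rewrite nq_mul !nq_succ => /(_ h3).
Qed.

Lemma nq_pair a b : nq (cv M s_pair @ a @ b) = (nq a + nq b) * (nq a + nq b) + nq a.
Proof. by uncv s_pair pair; evs HM; rewrite !(nq_add, nq_mul). Qed.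

(** The code of a pair lies between (a + b)^2 and (a + b + 1)^2. *)
Lemma isqrt_pair a b : cv M s_isqrt @ (cv M s_pair @ a @ b) = a ⊕ b.
Proof.
apply: nq_inj; rewrite nq_add; have := isqrt_spec (cv M s_pair @ a @ b).
rewrite nq_pair; move: (nq_ge0 a) (nq_ge0 b) (nq_ge0 (cv M s_isqrt @ (cv M s_pair @ a @ b))).
have := @nq_lt (cv M s_isqrt @ (cv M s_pair @ a @ b)) (a ⊕ b).
have := @nq_lt (a ⊕ b) (cv M s_isqrt @ (cv M s_pair @ a @ b)); rewrite nq_add.
move: (nq a) (nq b) (nq _) => x y r H1 H2 x0 y0 r0 [h1 h2].
apply: le_anti; rewrite !leNgt; apply/andP; split; apply/negP.
  by move/H1 => h; apply: absurd_lt; nra.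
by move/H2 => h; apply: absurd_lt; nra.
Qed.

Lemma pfst_pair a b : cv M s_pfst @ (cv M s_pair @ a @ b) = a.
Proof.
apply: nq_inj; uncv s_pfst pfst; evs HM; rewrite isqrt_pair.
have a0 := nq_ge0 a; rewrite nq_monus_ge ?nq_mul ?nq_pair ?nq_add; last lra.
ring.
Qed.

Lemma psnd_pair a b : cv M s_psnd @ (cv M s_pair @ a @ b) = b.
Proof.
apply: nq_inj; uncv s_psnd psnd; evs HM; rewrite isqrt_pair pfst_pair.
have b0 := nq_ge0 b; rewrite nq_monus_ge ?nq_add; last lra.
ring.
Qed.

Lemma qpos_code a b c : cv M s_qpos @ (cv M s_qcode @ a @ b @ c) = a.
Proof. by uncv s_qpos qpos; uncv s_qcode qcode; evs HM; rewrite !pfst_pair. Qed.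

Lemma qneg_code a b c : cv M s_qneg @ (cv M s_qcode @ a @ b @ c) = b.
Proof. by uncv s_qneg qneg; uncv s_qcode qcode; evs HM; rewrite !pfst_pair psnd_pair. Qed.

Lemma qden_code a b c : cv M s_qden @ (cv M s_qcode @ a @ b @ c) = succ @ c.
Proof. by uncv s_qden qden; uncv s_qcode qcode; evs HM; rewrite psnd_pair. Qed.

Lemma nq_den q : nq (cv M s_qden @ q) = nq (cv M s_psnd @ q) + 1.
Proof. by uncv s_qden qden; evs HM; rewrite nq_succ. Qed.

Lemma den_gt0 q : 0 < nq (cv M s_qden @ q).
Proof. by rewrite nq_den; have := nq_ge0 (cv M s_psnd @ q); lra. Qed.

(** The rational number with a given code. *)
Definition qv (q : N) : QM HM :=
  (nq (cv M s_qpos @ q) - nq (cv M s_qneg @ q)) / nq (cv M s_qden @ q).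

Lemma qv_code a b c : qv (cv M s_qcode @ a @ b @ c) = (nq a - nq b) / (nq c + 1).
Proof. by rewrite /qv qpos_code qneg_code qden_code nq_succ. Qed.

Lemma qv_frac m n : 1 <= nq n -> qv (cv M s_qfrac @ m @ n) = nq m / nq n.
Proof.
move=> n1; uncv s_qfrac qfrac; evs HM.
by rewrite qv_code nq_zero subr0 nq_pred // subrK.
Qed.

Lemma den2 p q :
  nq (cv M s_pred @ (cv M s_qden @ p ⊗ (cv M s_qden @ q))) + 1 =
  nq (cv M s_qden @ p) * nq (cv M s_qden @ q).
Proof.
have := nq_ge0 (cv M s_psnd @ q); have := nq_ge0 (cv M s_psnd @ p).
move=> p0 q0; rewrite nq_pred nq_mul ?subrK // !nq_den; nra.
Qed.

Lemma den_neq0 q : nq (cv M s_qden @ q) != 0.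
Proof. by rewrite gt_eqF // den_gt0. Qed.

Lemma qv_add p q : qv (cv M s_qadd @ p @ q) = qv p + qv q.
Proof.
uncv s_qadd qadd; evs HM; rewrite /qv qpos_code qneg_code qden_code nq_succ den2 !(nq_add, nq_mul).
move: (den_neq0 p) (den_neq0 q).
exact: frac_add.
Qed.

Lemma qv_mul p q : qv (cv M s_qmul @ p @ q) = qv p * qv q.
Proof.
uncv s_qmul qmul; evs HM; rewrite /qv qpos_code qneg_code qden_code nq_succ den2 !(nq_add, nq_mul).
move: (den_neq0 p) (den_neq0 q).
exact: frac_mul.
Qed.

Lemma qv_opp p : qv (cv M s_qopp @ p) = - qv p.
Proof.
uncv s_qopp qopp; evs HM; rewrite qv_code /qv nq_den.
by rewrite -mulNr opprB.
Qed.

Lemma qv_sub p q : qv (cv M s_qsub @ p @ q) = qv p - qv q.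
Proof. by uncv s_qsub qsub; evs HM; rewrite qv_add qv_opp. Qed.

Lemma qv_abs p : qv (cv M s_qabs @ p) = `|qv p|.
Proof.
uncv s_qabs qabs; evs HM; rewrite qv_code nq_zero subr0 nq_add /qv -nq_den.
rewrite normrM normfV (gtr0_norm (den_gt0 p)); congr (_ / _).
have [h|/ltW h] := lerP (nq (cv M s_qpos @ p)) (nq (cv M s_qneg @ p)).
  by rewrite (nq_monus_le h) nq_zero (nq_monus_ge h) add0r.
by rewrite (nq_monus_le h) nq_zero (nq_monus_ge h) addr0.
Qed.

Lemma qleE p q : (cv M s_qle @ p @ q = zero) = (qv p <= qv q).
Proof.
uncv s_qle qle; evs HM; rewrite monusE !(nq_add, nq_mul).
rewrite /qv ler_pdivrMr ?den_gt0 // mulrAC ler_pdivlMr ?den_gt0 //.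
by congr (is_true _); apply/idP/idP => h; lra.
Qed.

Lemma qltE p q : (cv M s_qlt @ p @ q = zero) = (qv p < qv q).
Proof.
uncv s_qlt qlt; evs HM; rewrite monusE nq_succ.
set x := _ ⊕ _; set y := _ ⊕ _.
have -> : (nq x + 1 <= nq y) = (nq x < nq y).
  by apply/idP/idP => [h|/nq_lt //]; lra.
rewrite /x /y !(nq_add, nq_mul) /qv ltr_pdivrMr ?den_gt0 // mulrAC ltr_pdivlMr ?den_gt0 //.
by congr (is_true _); apply/idP/idP => h; lra.
Qed.

(** * Powers of one half *)

(** 2^-n, for an index of the model. *)
Definition ep (n : N) : QM HM := (nq (cv M s_pow2 @ n))^-1.

Lemma pow2_ge n : nq n + 1 <= nq (cv M s_pow2 @ n).
Proof.
move: n; apply: (formula_ind_eq (rho := enil) (p :=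
  FEq (monus · (Succ · #0) · (pow2 · #0)) Zero)).
- by move=> n; evs HM; rewrite monusE nq_succ.
- by rewrite pow2_0 nq_zero add0r.
- by move=> n IH; rewrite pow2_S nq_succ; have := nq_ge0 n; lra.
Qed.

Lemma pow2_ge1 n : 1 <= nq (cv M s_pow2 @ n).
Proof. by have := pow2_ge n; have := nq_ge0 n; lra. Qed.

Lemma pow2_gt0 n : 0 < nq (cv M s_pow2 @ n).
Proof. by have := pow2_ge1 n; lra. Qed.

Lemma pow2_add m n : nq (cv M s_pow2 @ (m ⊕ n)) = nq (cv M s_pow2 @ m) * nq (cv M s_pow2 @ n).
Proof.
move: n; apply: (formula_ind_eq (rho := ⟪m⟫) (p :=
  FEq (pow2 · (add · #1 · #0)) (mul · (pow2 · #1) · (pow2 · #0)))).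
- by move=> n; evs HM; apply: propext; rewrite -nq_mul; split=> [-> //|/nq_inj].
- by rewrite pow2_0 mulr1; congr (nq (_ @ _)); exact: (@addn0 M HM).
- move=> n IH; have -> : m ⊕ (succ @ n) = succ @ (m ⊕ n) by exact: (@addnS M HM).
  by rewrite !pow2_S IH; ring.
Qed.

Lemma ep_gt0 n : 0 < ep n.
Proof. by rewrite invr_gt0 pow2_gt0. Qed.

Lemma ep_0 : ep zero = 1.
Proof. by rewrite /ep pow2_0 invr1. Qed.

Lemma ep_S n : ep (succ @ n) = ep n / 2.
Proof. by rewrite /ep pow2_S invfM mulrC. Qed.

Lemma ep_add m n : ep (m ⊕ n) = ep m * ep n.
Proof. by rewrite /ep pow2_add invfM. Qed.

Lemma ep_le1 n : ep n <= 1.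
Proof. by rewrite invf_le1 ?pow2_gt0 // pow2_ge1. Qed.

Lemma ep_le m n : nq m <= nq n -> ep n <= ep m.
Proof.
by move/nq_le_ex => [k ->]; rewrite ep_add ger_pMr ?ep_gt0 // ep_le1.
Qed.

Lemma ep_small n : (nq n + 1) * ep n <= 1.
Proof. by rewrite ler_pdivrMr ?pow2_gt0 // mul1r pow2_ge. Qed.

Lemma qv_surj (x : QM HM) : exists q, x = qv q.
Proof.
elim/QM_ind: x => a b c; exists (cv M s_qcode @ a @ b @ c).
have c0 : nq c + 1 != 0 by rewrite gt_eqF //; have := nq_ge0 c; lra.
rewrite qv_code; apply: (mulIf c0); rewrite divfK //.
rewrite -nq_succ !nqE -[_ * _]/(Qmul _ _) QmulE -[_ - _]/(Qadd _ (Qopp _)) QoppE QaddE.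
apply: QM_eq; rewrite /feq /= -[succ @ c]/(nsucc (c : NM HM)) nsuccE; apply/eqP; ring.
Qed.

(** A positive fraction with denominator D is at least 1/D, and 2^D exceeds D by
    induction in the model. So the field is archimedean from the viewpoint of
    the model. *)
Lemma ep_archi (x : QM HM) : 0 < x -> exists n, ep n < x.
Proof.
have [q ->] := qv_surj x; rewrite /qv => x0.
exists (cv M s_qden @ q); have d0 := den_gt0 q; have := ep_small (cv M s_qden @ q).
have : 1 <= nq (cv M s_qpos @ q) - nq (cv M s_qneg @ q).
  have : nq (cv M s_qneg @ q) < nq (cv M s_qpos @ q).
    by rewrite -subr_gt0; move: x0; rewrite pmulr_lgt0 // invr_gt0.
  by move/nq_lt; lra.
rewrite ltr_pdivlMr //; have := ep_gt0 (cv M s_qden @ q).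
move: (ep _) (_ - _) (nq _) d0 => *; nra.
Qed.

Lemma qv_eps n : qv (cv M s_qeps @ n) = ep n.
Proof. by uncv s_qeps qeps; evs HM; rewrite qv_frac ?pow2_ge1 // nq_num mul1r. Qed.

Lemma qv_eps2 n : qv (cv M s_qeps2 @ n) = 2 * ep n.
Proof. by uncv s_qeps2 qeps2; evs HM; rewrite qv_frac ?pow2_ge1 // nq_num. Qed.

End Numbers.

(** * Real numbers of a model *)

(** The error of a product is the error of the factors times the sum of their
    bounds B + C, and this sum is absorbed by r, the power of one half by which
    multiplication of reals shifts its index. *)
Lemma mul_close (R : realFieldType) (a b c d B C e r : R) :
  0 < e -> 0 < r -> (B + C + 1) * r <= 1 -> `|b| <= B -> `|c| <= C ->
  `|a - b| < e * r -> `|c - d| < e * r -> `|a * c - b * d| < e.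
Proof.
move=> e0 r0 h bB cC ab cd.
have -> : a * c - b * d = (a - b) * c + b * (c - d) by ring.
apply: le_lt_trans (ler_normD _ _) _; rewrite !normrM.
have k1 : `|a - b| * `|c| <= (e * r) * C by apply: ler_pM => //; exact: ltW.
have k2 : `|b| * `|c - d| <= B * (e * r) by apply: ler_pM => //; exact: ltW.
have k3 : e * ((B + C + 1) * r) <= e * 1 by rewrite ler_pM2l.
have k4 : 0 < e * r by apply: mulr_gt0.
lra.
Qed.

Section Reals.
Variables (M : structure) (HM : is_model M).
Notation N := (car M ty0).
Notation nq := (nq HM).
Notation qv := (qv HM).
Notation ep := (ep HM).
Implicit Types (m n k i j : N) (x y f : car M ty1).

(** Counting the failures of a test below [i] gives zero exactly when no test
    fails; both directions go through one induction. *)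
Lemma count_eq0 (c : car M ty1) (h : car M (ty0 ~> ty0 ~> ty0)) :
  (forall r k, h @ r @ k = cv M s_ite @ (c @ k) @ r @ (succ @ r)) ->
  forall i, rec @ i @ zero @ h = zero <-> (forall k, nq k < nq i -> c @ k = zero).
Proof.
move=> Hh i; suff : (rec @ i @ zero @ h = zero ->
    forall k, nq (succ @ k) <= nq i -> c @ k = zero) /\
   ((forall k, nq (succ @ k) <= nq i -> c @ k = zero) -> rec @ i @ zero @ h = zero).
  case=> H1 H2; split=> [/H1 + k ki|H]; first by apply; rewrite nq_succ; exact: nq_lt.
  by apply: H2 => k; rewrite nq_succ => ki; apply: H; lra.
move: i; apply: (formula_ind HM (rho := ⟪h, c⟫) (p := FAnd
  (FImp (FEq (Rec · #0 · Zero · #1) Zero)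
     (FAll ty0 (FImp (FEq (monus · (Succ · #0) · #1) Zero) (FEq (#3 · #0) Zero))))
  (FImp (FAll ty0 (FImp (FEq (monus · (Succ · #0) · #1) Zero) (FEq (#3 · #0) Zero)))
     (FEq (Rec · #0 · Zero · #1) Zero)))).
- move=> i; evs HM; split=> -[H1 H2]; split.
  + by move=> /H1 H k; move: (H k); evs HM; rewrite (monusE HM); exact: id.
  + by move=> H; apply: H2 => k; move: (H k); evs HM; rewrite (monusE HM); exact: id.
  + by move=> /H1 H k; move: (H k); evs HM; rewrite (monusE HM); exact: id.
  + by move=> H; apply: H2 => k; move: (H k); evs HM; rewrite (monusE HM); exact: id.
- split; last by rewrite (rec0 HM).
  by move=> _ k; rewrite nq_succ nq_zero => H; exfalso; apply: (@absurd_lt _ HM);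
    have := nq_ge0 HM k; lra.
move=> i [H1 H2]; rewrite (recS HM) Hh (iteE HM).
have cz : (nq (c @ i) == 0) = `[< c @ i = zero >].
  by apply/eqP/asboolP => [E|->]; rewrite ?nq_zero //; apply: (@nq_inj _ HM); rewrite nq_zero.
rewrite cz; case: asboolP => ci; split.
- move=> /H1 H k; rewrite !nq_succ => ki.
  have [E|ne] := pselect (k = i); first by rewrite E.
  apply: H; rewrite nq_succ; apply: nq_lt; rewrite lt_def.
  by apply/andP; split; [apply/eqP => /nq_inj/esym|lra].
- by move=> H; apply: H2 => k; rewrite nq_succ => ki; apply: H; rewrite !nq_succ; lra.
- by move/(succ_neq0 HM).
- by move=> H; exfalso; apply: ci; apply: H; rewrite lexx.
Qed.

(** The sequences that [hat] leaves unchanged. *)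
Definition is_real f : Prop :=
  forall k j, nq k < nq j -> `|qv (f @ k) - qv (f @ j)| < ep k.

Lemma violE f j : cv M s_viol @ f @ j = zero <->
  (forall k, nq k < nq j -> `|qv (f @ k) - qv (f @ j)| < ep k).
Proof.
pose c : car M ty1 := eval ⟪f, j⟫ (λ k : ty0,
  qlt · (qabs · (qsub · (↑#0 · k) · (↑#0 · ↑#1))) · (qeps · k)).
uncv s_viol viol; evs HM.
set h := eval _ (lamN _); have Hh r k : h @ r @ k = cv M s_ite @ (c @ k) @ r @ (succ @ r).
  by rewrite /h /c; evs HM.
rewrite (count_eq0 Hh); split=> H k /H.
  by rewrite /c; evs HM; rewrite qltE qv_abs qv_sub qv_eps.
by rewrite /c => ?; evs HM; rewrite qltE qv_abs qv_sub qv_eps.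
Qed.

Notation ci f n := (cv M s_hat_index @ f @ n).

Lemma hat_index_0 f : ci f zero = zero.
Proof. by uncv s_hat_index hat_index; evs HM; rewrite (rec0 HM). Qed.

Lemma hat_index_S f i : ci f (succ @ i) =
  if (nq i <= nq (ci f i)) && `[< cv M s_viol @ f @ (succ @ i) = zero >]
  then succ @ i else ci f i.
Proof.
have -> : ci f (succ @ i) = cv M s_ite @
    (cv M s_add @ (cv M s_monus @ i @ (ci f i)) @ (cv M s_viol @ f @ (succ @ i)))
    @ (succ @ i) @ (ci f i).
  by uncv s_hat_index hat_index; evs HM; rewrite (recS HM); evs HM; unify_rec HM.
rewrite iteE nq_add; congr (if _ then _ else _).
have a0 := nq_ge0 HM (cv M s_monus @ i @ (ci f i)).
have b0 := nq_ge0 HM (cv M s_viol @ f @ (succ @ i)).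
rewrite paddr_eq0 //; congr (_ && _).
  apply/eqP/idP; last by move/nq_monus_le => ->; rewrite nq_zero.
  by rewrite -(monusE HM) -[X in _ = X](nq_zero HM) => /nq_inj.
apply/eqP/asboolP; last by move=> ->; rewrite nq_zero.
by rewrite -[X in _ = X](nq_zero HM) => /nq_inj.
Qed.

Lemma hat_at f n : cv M s_hat @ f @ n = f @ (ci f n).
Proof. by uncv s_hat hat; evs HM. Qed.

Lemma hat_id f n : is_real f -> cv M s_hat @ f @ n = f @ n.
Proof.
move=> Hf; rewrite hat_at; congr (_ @ _); move: n.
apply: (formula_ind_eq HM (rho := ⟪f⟫) (p := FEq (hat_index · #1 · #0) #0)).
- by move=> n; evs HM.
- exact: hat_index_0.
move=> n IH; rewrite hat_index_S IH lexx asboolT //.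
by apply/violE => k; exact: Hf.
Qed.

(** With c the last good index up to m, the index used at n is the minimum of n
    and c. *)
Lemma hat_index_spec f m :
  [/\ nq (ci f m) <= nq m, cv M s_viol @ f @ (ci f m) = zero &
   forall n, nq n <= nq m ->
     (nq n <= nq (ci f m) -> ci f n = n) /\
     (nq (ci f m) <= nq n -> ci f n = ci f m)].
Proof.
suff [H1 [H2 H3]] : nq (ci f m) <= nq m /\ cv M s_viol @ f @ (ci f m) = zero /\
   forall n, nq n <= nq m ->
     (nq n <= nq (ci f m) -> ci f n = n) /\
     (nq (ci f m) <= nq n -> ci f n = ci f m) by split.
move: m; apply: (formula_ind HM (rho := ⟪f⟫) (p := FAnd
  (FEq (monus · (hat_index · #1 · #0) · #0) Zero)
  (FAnd (FEq (viol · #1 · (hat_index · #1 · #0)) Zero)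
  (FAll ty0 (FImp (FEq (monus · #0 · #1) Zero)
    (FAnd (FImp (FEq (monus · #0 · (hat_index · #2 · #1)) Zero) (FEq (hat_index · #2 · #0) #0))
      (FImp (FEq (monus · (hat_index · #2 · #1) · #0) Zero)
         (FEq (hat_index · #2 · #0) (hat_index · #2 · #1))))))))).
- move=> m; evs HM; rewrite !(monusE HM); split=> -[H1 [H2 H3]]; split=> //; split=> // n;
  by move: (H3 n); evs HM; rewrite !(monusE HM); exact: id.
- rewrite hat_index_0; split; first by []; split.
    apply/violE => k; rewrite nq_zero => k0; exfalso; apply: (@absurd_lt _ HM).
    by have := nq_ge0 HM k; lra.
  move=> n n0; have -> : n = zero; last by rewrite hat_index_0.
  by apply: (@nq_inj _ HM); apply: le_anti; rewrite n0 nq_zero nq_ge0.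
move=> m [H1 [H2 H3]]; rewrite hat_index_S nq_succ.
case: ifP => [/andP[h1 /asboolP h2]|nb].
  have E : ci f m = m by apply: (@nq_inj _ HM); apply: le_anti; rewrite h1 H1.
  split; [by rewrite nq_succ|split=> // n nm].
  have [->|ne] := pselect (n = succ @ m).
    by rewrite hat_index_S E (asboolT h2) !lexx.
  have nm' : nq n <= nq m.
    apply: (nq_lt_le (HM := HM)); rewrite lt_def nm andbT.
    by apply/eqP; rewrite -nq_succ => /nq_inj/esym.
  have [H4 H5] := H3 n nm'; rewrite nq_succ; split=> [_|h]; first by apply: H4; rewrite E.
  by exfalso; apply: (@absurd_lt _ HM); lra.
split; [lra|split=> // n nm].
have [->|ne] := pselect (n = succ @ m).
  split; rewrite nq_succ; first by move=> h; exfalso; apply: (@absurd_lt _ HM); lra.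
  by move=> _; rewrite hat_index_S nb.
apply: H3; apply: (nq_lt_le (HM := HM)); rewrite lt_def nm andbT.
by apply/eqP; rewrite -nq_succ => /nq_inj/esym.
Qed.

(** The n-th approximation of the real that is denoted by [x]. All statements
    about reals are statements about these elements of the field. *)
Definition hx x n : QM HM := qv (cv M s_hat @ x @ n).

(** If the sequence has been frozen at an index c, then comparing indices beyond c
    is trivial and comparing n < c with a later index is comparing n with c. *)
Lemma hat_is_real x : is_real (cv M s_hat @ x).
Proof.
move=> n m nm; rewrite !hat_at.
have [cm vm H] := hat_index_spec x m.
have [H1 H2] := H n (ltW nm).
have [h|h] := lerP (nq (ci x m)) (nq n).
  by rewrite (H2 h) subrr normr0 ep_gt0.
by rewrite (H1 (ltW h)); move/violE: vm; apply.
Qed.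

Lemma hx_lt x n m : nq n < nq m -> `|hx x n - hx x m| < ep n.
Proof. exact: hat_is_real. Qed.

Lemma hx_le x n m : nq n <= nq m -> `|hx x n - hx x m| <= ep n.
Proof.
rewrite le_eqVlt => /orP[/eqP/nq_inj ->|/hx_lt/ltW //].
by rewrite subrr normr0 ltW // ep_gt0.
Qed.

Lemma hx_real f n : is_real f -> hx f n = qv (f @ n).
Proof. by move=> Hf; rewrite /hx hat_id. Qed.

Lemma hx_rofq q n : hx (cv M s_rofq @ q) n = qv q.
Proof.
have E k : cv M s_rofq @ q @ k = q by uncv s_rofq rofq; evs HM; rewrite (kcE HM).
by rewrite hx_real ?E // => i j _; rewrite !E subrr normr0 ep_gt0.
Qed.

Lemma hx_rofnat m n : hx (cv M s_rofnat @ m) n = nq m.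
Proof.
by uncv s_rofnat rofnat; evs HM; rewrite hx_rofq qv_frac nq_num // divr1.
Qed.

Lemma hx_rinv m n : 1 <= nq m -> hx (cv M s_rinv @ m) n = (nq m)^-1.
Proof.
by move=> m1; uncv s_rinv rinv; evs HM; rewrite hx_rofq qv_frac ?nq_num // mul1r.
Qed.

Lemma hx_radd x y n : hx (cv M s_radd @ x @ y) n = hx x (succ @ n) + hx y (succ @ n).
Proof.
have E k : qv (cv M s_radd @ x @ y @ k) = hx x (succ @ k) + hx y (succ @ k).
  by uncv s_radd radd; evs HM; rewrite qv_add.
rewrite hx_real // => i j ij; rewrite !E.
have ij' : nq (succ @ i) < nq (succ @ j) by rewrite !nq_succ; lra.
have := hx_lt x ij'; have := hx_lt y ij'; rewrite ep_S.
rewrite !ltr_norml => /andP[h1 h2] /andP[h3 h4]; apply/andP; split; lra.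
Qed.

Lemma hx_ropp x n : hx (cv M s_ropp @ x) n = - hx x n.
Proof.
have E k : qv (cv M s_ropp @ x @ k) = - hx x k.
  by uncv s_ropp ropp; evs HM; rewrite qv_opp.
rewrite hx_real // => i j ij; rewrite !E -opprD normrN; exact: hx_lt.
Qed.

Lemma hx_rsub x y n : hx (cv M s_rsub @ x @ y) n = hx x (succ @ n) - hx y (succ @ n).
Proof. by uncv s_rsub rsub; evs HM; rewrite hx_radd hx_ropp. Qed.

Lemma hx_rabs x n : hx (cv M s_rabs @ x) n = `|hx x n|.
Proof.
have E k : qv (cv M s_rabs @ x @ k) = `|hx x k|.
  by uncv s_rabs rabs; evs HM; rewrite qv_abs.
rewrite hx_real // => i j ij; rewrite !E.
exact: le_lt_trans (ler_dist_dist _ _) (hx_lt x ij).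
Qed.

Lemma hx_bound x n : `|hx x n| + 1 <= nq (cv M s_rbound @ x) + ep zero.
Proof.
uncv s_rbound rbound; evs HM; rewrite nq_succ nq_add ep_0.
set a := nq _; set b := nq _.
have h0 : `|hx x zero| <= a + b.
  rewrite /hx /qv -/a -/b normrM normfV (gtr0_norm (den_gt0 HM _)).
  have a0 : 0 <= a by apply: nq_ge0.
  have b0 : 0 <= b by apply: nq_ge0.
  rewrite ler_pdivrMr ?den_gt0 //.
  have := ler_normB a b; rewrite (ger0_norm a0) (ger0_norm b0) => /le_trans; apply.
  rewrite ler_peMr ?addr_ge0 // nq_den; have := nq_ge0 HM (cv M s_psnd @ (cv M s_hat @ x @ zero)); lra.
have n0 : nq zero <= nq n by rewrite nq_zero nq_ge0.
have := hx_le x n0; rewrite ep_0.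
have := ler_normB (hx x zero) (hx x zero - hx x n); rewrite opprB addrC subrK.
move: (`|_|) (`|_|) (`|_|) h0 => u v w; lra.
Qed.

Lemma hx_rmul x y n (m := cv M s_add @ n @ (cv M s_add @ (cv M s_rbound @ x) @ (cv M s_rbound @ y))) :
  hx (cv M s_rmul @ x @ y) n = hx x m * hx y m.
Proof.
have E k (i := cv M s_add @ k @ (cv M s_add @ (cv M s_rbound @ x) @ (cv M s_rbound @ y))) :
    qv (cv M s_rmul @ x @ y @ k) = hx x i * hx y i.
  by uncv s_rmul rmul; evs HM; rewrite qv_mul.
rewrite hx_real // => i j ij; rewrite !E.
have ij' : nq (cv M s_add @ i @ (cv M s_add @ (cv M s_rbound @ x) @ (cv M s_rbound @ y))) <
  nq (cv M s_add @ j @ (cv M s_add @ (cv M s_rbound @ x) @ (cv M s_rbound @ y))).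
  by rewrite !nq_add; lra.
apply: (mul_close (B := nq (cv M s_rbound @ x)) (C := nq (cv M s_rbound @ y))
  (r := ep (cv M s_add @ (cv M s_rbound @ x) @ (cv M s_rbound @ y))) (ep_gt0 HM i)).
- exact: ep_gt0.
- by rewrite -nq_add; exact: ep_small.
- by have := hx_bound x (cv M s_add @ j @ (cv M s_add @ (cv M s_rbound @ x) @ (cv M s_rbound @ y)));
    rewrite ep_0; lra.
- by have := hx_bound y (cv M s_add @ i @ (cv M s_add @ (cv M s_rbound @ x) @ (cv M s_rbound @ y)));
    rewrite ep_0; lra.
- by rewrite -ep_add; exact: hx_lt.
- by rewrite -ep_add; exact: hx_lt.
Qed.
End Reals.

(** * Formulas about reals *)

Section RealFormulas.
Variables (M : structure) (HM : is_model M).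
Notation N := (car M ty0).
Notation nq := (nq HM).
Notation qv := (qv HM).
Notation ep := (ep HM).
Notation hx := (hx HM).
Notation Q := (QM HM).
Implicit Types (m n k i j p l : N) (x y e d : car M ty1) (f : car M ty2) (g : car M ty1).

Definition mReq x y := forall n, `|hx x n - hx y n| <= 2 * ep n.
Definition mRle x y := forall n, hx x n - hx y n <= 2 * ep n.
Definition mRlt x y := exists n, 2 * ep n < hx y n - hx x n.

Lemma sat_exN G (rho : env M G) r (F : tm (r :: G) r -> fm (r :: G)) :
  sat rho (exN F) <-> exists a : car M r, sat (econs a rho) (F (Var v0)).
Proof.
split=> [H|[x Hx] H]; last exact: (H x).
by apply: contrapT => /forallNP Hn; apply: H => x; exact: Hn.
Qed.

Lemma sat_Req G (rho : env M G) s t :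
  sat rho (Req s t) <-> mReq (eval rho s) (eval rho t).
Proof.
by split=> H n; move: (H n); evs HM; rewrite (qleE HM) qv_abs qv_sub qv_eps2; exact: id.
Qed.

Lemma sat_Rle G (rho : env M G) s t :
  sat rho (Rle s t) <-> mRle (eval rho s) (eval rho t).
Proof.
by split=> H n; move: (H n); evs HM; rewrite (qleE HM) qv_sub qv_eps2; exact: id.
Qed.

Lemma sat_Rlt G (rho : env M G) s t :
  sat rho (Rlt s t) <-> mRlt (eval rho s) (eval rho t).
Proof.
rewrite sat_exN; split=> -[n Hn]; exists n; move: Hn; evs HM;
  by rewrite (qltE HM) qv_sub qv_eps2; exact: id.
Qed.

Lemma ep_below (x : Q) n0 : 0 < x -> exists2 n, nq n0 <= nq n & ep n < x.
Proof.
move=> x0; have [n nx] := ep_archi x0; exists (cv M s_add @ n0 @ n).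
  by rewrite nq_add; have := nq_ge0 HM n; lra.
by apply: le_lt_trans (ep_le _) nx; rewrite nq_add; have := nq_ge0 HM n0; lra.
Qed.

(** Passing to the limit in an inequality. *)
Lemma ep_limit (a b C : Q) n0 :
  0 <= C -> (forall n, nq n0 <= nq n -> a <= b + C * ep n) -> a <= b.
Proof.
move=> C0 H; rewrite leNgt; apply/negP => ba.
have [|n nn0 nd] := @ep_below ((a - b) / (C + 1)) n0; first by apply: divr_gt0; lra.
apply: (@absurd_lt _ HM); move: (H n nn0) (ep_gt0 HM n) nd.
rewrite ltr_pdivlMr; last lra.
move: (ep n) => u; nra.
Qed.

Lemma hx_close x n p : nq n <= nq p -> hx x n - ep n <= hx x p <= hx x n + ep n.
Proof. by move/(hx_le x); rewrite ler_norml => /andP[h1 h2]; apply/andP; split; lra. Qed.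

(** Compare both sides with a common late index p and let p grow. *)
Lemma mRle_close x y n m : mRle x y -> hx x n <= hx y m + ep n + ep m.
Proof.
move=> H; apply: (@ep_limit _ _ 2 (cv M s_add @ n @ m)) => // p; rewrite nq_add => np.
have n0 := nq_ge0 HM n; have m0 := nq_ge0 HM m.
have /andP[h1 h2] : hx x n - ep n <= hx x p <= hx x n + ep n by apply: hx_close; lra.
have /andP[h3 h4] : hx y m - ep m <= hx y p <= hx y m + ep m by apply: hx_close; lra.
have h5 := H p; lra.
Qed.

(** Since both sequences converge fast, an inequality up to every positive error
    at late indices implies the one with error 2^(-n+1) at every index n. *)
Lemma mRle_intro x y :
  (forall dl : Q, 0 < dl -> exists n0, forall n, nq n0 <= nq n -> hx x n <= hx y n + dl) ->
  mRle x y.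
Proof.
move=> H n; apply: (@ep_limit _ _ 1 n) => // q nq_q; rewrite mul1r.
have [n0 Hn0] := H _ (ep_gt0 HM q).
have m0 := nq_ge0 HM n; have m1 := nq_ge0 HM n0.
have := Hn0 (cv M s_add @ n @ n0); rewrite nq_add => /(_ ltac:(lra)) h1.
have /andP[h2 h3] : hx x n - ep n <= hx x (cv M s_add @ n @ n0) <= hx x n + ep n.
  by apply: hx_close; rewrite nq_add; lra.
have /andP[h4 h5] : hx y n - ep n <= hx y (cv M s_add @ n @ n0) <= hx y n + ep n.
  by apply: hx_close; rewrite nq_add; lra.
lra.
Qed.

Lemma mReq_intro x y :
  (forall dl : Q, 0 < dl -> exists n0, forall n, nq n0 <= nq n -> `|hx x n - hx y n| <= dl) ->
  mReq x y.
Proof.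
move=> H n; rewrite ler_norml; apply/andP; split.
  have : mRle y x.
    apply: mRle_intro => dl /H[n0 Hn0]; exists n0 => p /Hn0.
    by rewrite ler_norml => /andP[h1 h2]; lra.
  by move/(_ n) => h; lra.
suff: mRle x y by exact.
apply: mRle_intro => dl /H[n0 Hn0]; exists n0 => p /Hn0.
by rewrite ler_norml => /andP[h1 h2]; lra.
Qed.

Lemma mRlt_gap x y : mRlt x y ->
  exists2 dl : Q, 0 < dl & exists n0, forall n, nq n0 <= nq n -> hx x n + dl <= hx y n.
Proof.
case=> n0 H; exists (hx y n0 - hx x n0 - 2 * ep n0); first lra.
exists n0 => n nn0; have /andP[h1 h2] := hx_close x nn0.
by have /andP[h3 h4] := hx_close y nn0; lra.
Qed.

Lemma mRlt_intro x y (dl : Q) n0 : 0 < dl ->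
  (forall n, nq n0 <= nq n -> hx x n + dl <= hx y n) -> mRlt x y.
Proof.
move=> d0 H; have [|n nn0 nd] := @ep_below (dl / 2) n0; first lra.
by exists n; have := H n nn0; lra.
Qed.

Definition munit x := mRle (cv M s_rofnat @ nm M 0) x /\ mRle x (cv M s_rofnat @ nm M 1).
Definition minner l x := mRle (cv M s_rinv @ l) x /\
  mRle x (cv M s_rsub @ (cv M s_rofnat @ nm M 1) @ (cv M s_rinv @ l)).
Definition mosc f l k := forall x y, munit x -> munit y ->
  mRlt (cv M s_rabs @ (cv M s_rsub @ x @ y)) (cv M s_rinv @ l) ->
  mRle (cv M s_rabs @ (cv M s_rsub @ (f @ x) @ (f @ y))) (cv M s_rinv @ k).
Definition mmodulus f g := forall k, 1 <= nq k -> 1 <= nq (g @ k) /\ mosc f (g @ k) k.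
(** The difference quotient is the real d with d e = I(f,0,x+e) - I(f,0,x). *)
Definition mdq f g e x k := exists d,
  mReq (cv M s_rmul @ d @ e)
    (cv M s_rsub @ (cv M s_integral @ f @ g @ (cv M s_radd @ x @ e)) @
                   (cv M s_integral @ f @ g @ x)) /\
  mRle (cv M s_rabs @ (cv M s_rsub @ d @ (f @ x))) (cv M s_rinv @ k).

Lemma sat_unit G (rho : env M G) t : sat rho (in_unit t) <-> munit (eval rho t).
Proof. by rewrite /munit /in_unit /in_itv; cbn [sat]; rewrite !sat_Rle; evs HM. Qed.

Lemma sat_inner G (rho : env M G) (l : tm G ty0) t :
  sat rho (in_inner l t) <-> minner (eval rho l) (eval rho t).
Proof. by rewrite /minner /in_inner /in_itv; cbn [sat]; rewrite !sat_Rle; evs HM. Qed.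

Lemma sat_pos G (rho : env M G) t : sat rho (pos_nat t) <-> 1 <= nq (eval rho t).
Proof. by rewrite /pos_nat; evs HM; rewrite (monusE HM) nq_num. Qed.

Lemma sat_osc G (rho : env M G) (f : tm G ty2) (l k : tm G ty0) :
  sat rho (osc f l k) <-> mosc (eval rho f) (eval rho l) (eval rho k).
Proof.
rewrite /osc /allN; cbn [sat]; split=> H x y; have := H x y;
  rewrite !sat_unit sat_Rlt sat_Rle; evs HM.
  by move=> h ux uy; exact: h.
by move=> h [ux uy]; exact: h.
Qed.

Lemma sat_modulus G (rho : env M G) (f : tm G ty2) (g : tm G ty1) :
  sat rho (modulus f g) <-> mmodulus (eval rho f) (eval rho g).
Proof.
rewrite /modulus /allN; cbn [sat]; split=> H k; have := H k;
  rewrite !sat_pos sat_osc; evs HM; exact: id.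
Qed.

Lemma sat_dq G (rho : env M G) (f : tm G ty2) (g e x : tm G ty1) (k : tm G ty0) :
  sat rho (diff_quot_close f g e x k) <->
  mdq (eval rho f) (eval rho g) (eval rho e) (eval rho x) (eval rho k).
Proof.
rewrite /diff_quot_close sat_exN; cbn [sat]; split=> -[d Hd]; exists d; move: Hd;
  by rewrite sat_Req sat_Rle; evs HM.
Qed.

End RealFormulas.

(** * Riemann sums *)

Section Sums.
Variables (M : structure) (HM : is_model M).
Notation N := (car M ty0).
Notation nq := (nq HM).
Notation qv := (qv HM).
Notation ep := (ep HM).
Notation hx := (hx HM).
Notation Q := (QM HM).
Notation "m ⊕ n" := (cv M s_add @ m @ n) (at level 50, left associativity).
Notation "m ⊗ n" := (cv M s_mul @ m @ n) (at level 40, left associativity).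
Implicit Types (m n k i j p l K : N) (x y e d : car M ty1) (f : car M ty2) (g : car M ty1).

Lemma qv_nat n : qv (cv M s_qfrac @ n @ nm M 1) = nq n.
Proof. by rewrite qv_frac nq_num // divr1. Qed.

(** Adding t - s terms within c of b changes a sum by (t - s) b up to (t - s) c.
    All estimates of Riemann sums below are instances of this induction. *)
Lemma sum_deviation (a : car M ty1) (h : car M (ty0 ~> ty0 ~> ty0)) u0 s t (b c : Q) :
  (forall r i, h @ r @ i = cv M s_qadd @ r @ (a @ i)) ->
  (forall i, nq s <= nq i -> nq i < nq t -> `|qv (a @ i) - b| <= c) ->
  nq s <= nq t ->
  `|qv (rec @ t @ u0 @ h) - qv (rec @ s @ u0 @ h) - (nq t - nq s) * b| <=
  (nq t - nq s) * c.
Proof.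
have [b' ->] := qv_surj b; have [c' ->] := qv_surj c => Hh Ha st.
have [i0 Ei0] := nq_le_ex st.
suff H i : nq s + nq i <= nq t ->
    `|qv (rec @ (s ⊕ i) @ u0 @ h) - qv (rec @ s @ u0 @ h) - nq i * qv b'| <= nq i * qv c'.
  have E : nq t - nq s = nq i0 by rewrite Ei0 nq_add addrC addKr.
  by rewrite E {1}Ei0; apply: H; rewrite Ei0 nq_add.
move: i; apply: (formula_ind_eq HM (rho := ⟪h, u0, s, t, b', c'⟫) (p :=
  FImp (FEq (monus · (add · #3 · #0) · #4) Zero)
    (FEq (qle · (qabs · (qsub · (qsub · (Rec · (add · #3 · #0) · #2 · #1) ·
                                        (Rec · #3 · #2 · #1)) ·
                                (qmul · (qfrac · #0 · num 1) · #5)))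
              · (qmul · (qfrac · #0 · num 1) · #6)) Zero))).
- move=> i; evs HM.
  by rewrite (monusE HM) (qleE HM) qv_abs !qv_sub !qv_mul !qv_nat nq_add.
- have -> : s ⊕ zero = s by exact: (@addn0 M HM).
  by rewrite nq_zero !mul0r subrr subr0 normr0.
move=> i IH; rewrite nq_succ => si.
have -> : s ⊕ (succ @ i) = succ @ (s ⊕ i) by exact: (@addnS M HM).
rewrite (recS HM) Hh qv_add.
have h1 : nq s + nq i <= nq t by lra.
have h2 : `|qv (a @ (s ⊕ i)) - qv b'| <= qv c'.
  by apply: Ha; rewrite nq_add; have := nq_ge0 HM i; lra.
move: {IH}(IH h1) h2; move: (qv (rec @ _ @ _ @ _)) (qv (rec @ _ @ _ @ _)).
move: (qv (a @ _)) (qv b') (qv c') (nq i) => A B C I U V.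
rewrite !ler_norml => /andP[k1 k2] /andP[k3 k4]; apply/andP; split; lra.
Qed.

Definition pt K i : car M ty1 := cv M s_rofq @ (cv M s_qfrac @ i @ (cv M s_pow2 @ K)).
Definition Fv f K i : Q := hx (f @ pt K i) K.
(** Sums are formed by recursion in the model, hence their terms have to be the
    values of an object of the model. *)
Lemma summand_val f K : {a : car M ty1 | forall i,
  a @ i = cv M s_qmul @ (cv M s_hat @ (f @ pt K i) @ K) @ (cv M s_qeps @ K)}.
Proof.
exists (eval ⟪f, K⟫ (λ i : ty0,
  qmul · (hat · (↑#0 · (rofq · (qfrac · i · (pow2 · ↑#1)))) · ↑#1) · (qeps · ↑#1))).
by move=> i; evs HM.
Qed.

Definition summand f K := proj1_sig (summand_val f K).

Lemma hsum_val f K : {h : car M (ty0 ~> ty0 ~> ty0) | forall r i,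
  h @ r @ i = cv M s_qadd @ r @ (summand f K @ i)}.
Proof.
exists (eval ⟪summand f K⟫ (λ s : ty0, λ i : ty0, qadd · ↑s · (↑↑#0 · i))).
by move=> r i; evs HM.
Qed.

Definition hsum f K := proj1_sig (hsum_val f K).

Lemma hsumE f K r i : hsum f K @ r @ i = cv M s_qadd @ r @ (summand f K @ i).
Proof. exact: (proj2_sig (hsum_val f K)). Qed.

Lemma qv_summand f K i : qv (summand f K @ i) = Fv f K i * ep K.
Proof. by rewrite (proj2_sig (summand_val f K)) qv_mul qv_eps. Qed.

Definition psum f K i : Q := qv (rec @ i @ (cv M s_qfrac @ zero @ nm M 1) @ hsum f K).

Lemma psum_0 f K : psum f K zero = 0.
Proof. by rewrite /psum (rec0 HM) qv_nat nq_zero. Qed.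

Lemma psum_S f K i : psum f K (succ @ i) = psum f K i + Fv f K i * ep K.
Proof. by rewrite /psum (recS HM) hsumE qv_add qv_summand. Qed.

Lemma psum_deviation f K s t (b c : Q) :
  (forall i, nq s <= nq i -> nq i < nq t -> `|Fv f K i - b| <= c) ->
  nq s <= nq t ->
  `|psum f K t - psum f K s - (nq t - nq s) * ep K * b| <= (nq t - nq s) * ep K * c.
Proof.
move=> H st; rewrite -![_ * ep K * _]mulrA.
apply: (sum_deviation _ (hsumE f K)) => // i si it.
rewrite qv_summand mulrC -mulrBr normrM gtr0_norm ?ep_gt0 // ler_pM2l ?ep_gt0 //.
exact: H.
Qed.

Lemma riemann_sumE f x K :
  qv (cv M s_riemann_sum @ f @ x @ K) = psum f K (succ @ (cv M s_part_index @ x @ K)).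
Proof.
uncv s_riemann_sum riemann_sum; evs HM; rewrite /psum.
apply: (f_equal qv); apply: (rec_congr HM) => r i.
by evs HM; rewrite hsumE (proj2_sig (summand_val f K)).
Qed.

Lemma pow2_ep K : nq (cv M s_pow2 @ K) * ep K = 1.
Proof. by rewrite /ep divff // gt_eqF // pow2_gt0. Qed.

(** Each cell of level [K] consists of [J] cells of level [K'], on which the
    samples differ from the one of the large cell by at most [c]; by
    [psum_deviation] a cell contributes an error of [ep K * c]. *)
Lemma psum_refine f K j (c : Q) L (K' := K ⊕ j) (J := cv M s_pow2 @ j) :
  (forall m r, nq m < nq L -> nq r < nq J ->
     `|Fv f K' (m ⊗ J ⊕ r) - Fv f K m| <= c) ->
  forall m, nq m <= nq L ->
  `|psum f K' (m ⊗ J) - psum f K m| <= nq m * (ep K * c).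
Proof.
have [c' Ec] := qv_surj (ep K * c); rewrite Ec => H.
apply: (formula_ind_eq HM (rho := ⟪hsum f K, hsum f K', J, L, c', cv M s_qfrac @ zero @ nm M 1⟫) (p :=
  FImp (FEq (monus · #0 · #4) Zero)
    (FEq (qle · (qabs · (qsub · (Rec · (mul · #0 · #3) · #6 · #2) · (Rec · #0 · #6 · #1)))
              · (qmul · (qfrac · #0 · num 1) · #5)) Zero))).
- move=> i; evs HM; by rewrite (monusE HM) (qleE HM) qv_abs !qv_sub !qv_mul !qv_nat.
- have -> : zero ⊗ J = zero by exact: (@mul0n M HM).
  by rewrite !psum_0 subrr normr0 nq_zero mul0r.
move=> m IH; rewrite nq_succ => mL.
have h1 : nq m <= nq L by lra.
have J0 := pow2_gt0 HM j.
have := @psum_deviation f K' (m ⊗ J) (succ @ m ⊗ J) (Fv f K m) c.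
have -> : (nq (succ @ m ⊗ J) - nq (m ⊗ J)) * ep K' = ep K.
  have -> : nq (succ @ m ⊗ J) - nq (m ⊗ J) = nq J by rewrite !nq_mul nq_succ; ring.
  by rewrite ep_add mulrCA pow2_ep mulr1.
move=> Hdev; have {Hdev} : `|psum f K' (succ @ m ⊗ J) - psum f K' (m ⊗ J) - ep K * Fv f K m| <= ep K * c.
  apply: Hdev; last by rewrite !nq_mul nq_succ; have := nq_ge0 HM J; rewrite mulrDl mul1r; lra.
  move=> i /nq_le_ex[r ->]; rewrite nq_add nq_mul nq_mul nq_succ => ri.
  by apply: H; [lra|move: ri; rewrite mulrDl mul1r; lra].
rewrite psum_S Ec; move: (IH h1).
rewrite !ler_norml (mulrC (Fv f K m)) => /andP[k1 k2] /andP[k3 k4].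
by apply/andP; split; lra.
Qed.

End Sums.

(** * Estimates for functions with a modulus *)

Section Integral.
Variables (M : structure) (HM : is_model M).
Notation N := (car M ty0).
Notation nq := (nq HM).
Notation qv := (qv HM).
Notation ep := (ep HM).
Notation hx := (hx HM).
Notation Q := (QM HM).
Notation mosc := (mosc HM).
Notation munit := (munit HM).
Notation mmodulus := (mmodulus HM).
Notation Fv := (Fv HM).
Notation psum := (psum HM).
Notation "m ⊕ n" := (cv M s_add @ m @ n) (at level 50, left associativity).
Notation "m ⊗ n" := (cv M s_mul @ m @ n) (at level 40, left associativity).
Implicit Types (m n k i j p l K : N) (x y e d : car M ty1) (f : car M ty2) (g : car M ty1).

Lemma munit_bounds x n : munit x -> - ep n <= hx x n <= 1 + ep n.
Proof.
case=> h0 h1; apply/andP; split.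
  apply: (@ep_limit _ HM _ _ 1 zero) => // m _; rewrite mul1r.
  by have := mRle_close m n h0; rewrite hx_rofnat nq_num; lra.
apply: (@ep_limit _ HM _ _ 1 zero) => // m _; rewrite mul1r.
by have := mRle_close n m h1; rewrite hx_rofnat nq_num; lra.
Qed.

Lemma munit_rofq q : 0 <= qv q <= 1 -> munit (cv M s_rofq @ q).
Proof.
move=> /andP[q0 q1]; split=> n; rewrite hx_rofq hx_rofnat nq_num.
  by have := ep_gt0 HM n; lra.
by have := ep_gt0 HM n; lra.
Qed.

(** The use of an oscillation bound: from sequences that are closer than 1/l by a
    positive amount to approximations of the values at any two indices. *)
Lemma osc_close f l k x y (dl : Q) n0 :
  1 <= nq l -> 1 <= nq k -> mosc f l k -> munit x -> munit y -> 0 < dl ->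
  (forall n, nq n0 <= nq n -> `|hx x n - hx y n| <= (nq l)^-1 - dl) ->
  forall n m, `|hx (f @ x) n - hx (f @ y) m| <= (nq k)^-1 + ep n + ep m.
Proof.
move=> l1 k1 Ho ux uy d0 Hxy n m.
have Hlt : mRlt HM (cv M s_rabs @ (cv M s_rsub @ x @ y)) (cv M s_rinv @ l).
  apply: (mRlt_intro (dl := dl) (n0 := n0)) => // p np.
  rewrite hx_rabs hx_rsub hx_rinv //.
  by have := Hxy (succ @ p); rewrite nq_succ => /(_ ltac:(lra)); lra.
have H := Ho x y ux uy Hlt.
apply: (@ep_limit _ HM _ _ 2 (n ⊕ m)) => // p; rewrite nq_add => np.
have n1 := nq_ge0 HM n; have m1 := nq_ge0 HM m.
have := H p; rewrite hx_rabs hx_rsub hx_rinv //.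
have /andP[h1 h2] : hx (f @ x) n - ep n <= hx (f @ x) (succ @ p) <= hx (f @ x) n + ep n.
  by apply: hx_close; rewrite nq_succ; lra.
have /andP[h3 h4] : hx (f @ y) m - ep m <= hx (f @ y) (succ @ p) <= hx (f @ y) m + ep m.
  by apply: hx_close; rewrite nq_succ; lra.
rewrite lerBlDr ler_norml => /andP[h5 h6].
by rewrite ler_norml; apply/andP; split; lra.
Qed.

Lemma osc_close_rat f l k q q' : 1 <= nq l -> 1 <= nq k -> mosc f l k ->
  0 <= qv q <= 1 -> 0 <= qv q' <= 1 -> `|qv q - qv q'| < (nq l)^-1 ->
  forall n m, `|hx (f @ (cv M s_rofq @ q)) n - hx (f @ (cv M s_rofq @ q')) m|
    <= (nq k)^-1 + ep n + ep m.
Proof.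
move=> l1 k1 Ho uq uq' qq'.
apply: (osc_close l1 k1 Ho (munit_rofq uq) (munit_rofq uq')
  (dl := (nq l)^-1 - `|qv q - qv q'|) (n0 := zero)); first lra.
by move=> n _; rewrite !hx_rofq; lra.
Qed.

(** The bound B of the language: a bound of f(0) plus g(1) + 1. *)
Definition bound_of f g : N := (cv M s_rbound @ (f @ (cv M s_rofnat @ zero)))
  ⊕ ((g @ nm M 1) ⊕ nm M 1).

Lemma nq_one : nq (nm M 1) = 1.
Proof. by rewrite nq_num. Qed.

(** The way from 0 to [qv q] is divided into g(1) + 1 equal steps. Each step is
    shorter than 1/g(1), so f changes by at most 1 along it. *)
Lemma chain_bound f g q : mmodulus f g -> 0 <= qv q <= 1 ->
  forall j, nq j <= nq (succ @ (g @ nm M 1)) -> forall n,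
  `|hx (f @ (cv M s_rofq @ (cv M s_qmul @ q @ (cv M s_qfrac @ j @ (succ @ (g @ nm M 1)))))) n
    - hx (f @ (cv M s_rofnat @ zero)) n| <= nq (succ @ j) + 2 * ep n.
Proof.
move=> Hg /andP[q0 q1].
have [G1 Ho] : 1 <= nq (g @ nm M 1) /\ mosc f (g @ nm M 1) (nm M 1).
  by apply: Hg; rewrite nq_one.
set G := g @ nm M 1 in G1 Ho *.
have SG1 : 1 <= nq (succ @ G) by rewrite nq_succ; lra.
have pv j : qv (cv M s_qmul @ q @ (cv M s_qfrac @ j @ (succ @ G))) =
    qv q * (nq j / nq (succ @ G)) by rewrite qv_mul qv_frac.
have pv01 j : nq j <= nq (succ @ G) ->
    0 <= qv (cv M s_qmul @ q @ (cv M s_qfrac @ j @ (succ @ G))) <= 1.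
  move=> jG; rewrite pv; apply/andP; split.
    by rewrite mulr_ge0 // divr_ge0 ?nq_ge0.
  by rewrite mulr_ile1 // ?divr_ge0 ?nq_ge0 // ler_pdivrMr ?mul1r //; lra.
have rofnat0 : cv M s_rofnat @ zero = cv M s_rofq @ (cv M s_qfrac @ zero @ nm M 1).
  by uncv s_rofnat rofnat; evs HM.
have q00 : qv (cv M s_qfrac @ zero @ nm M 1) = 0 by rewrite qv_nat nq_zero.
have one1 : 1 <= nq (nm M 1) by rewrite nq_one.
apply: (formula_ind_eq HM (rho := ⟪f, q, G⟫) (p :=
  FImp (FEq (monus · #0 · (Succ · #3)) Zero)
   (FAll ty0 (FEq (qle ·
      (qabs · (qsub · (hat · (#2 · (rofq · (qmul · #3 · (qfrac · #1 · (Succ · #4))))) · #0)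
                    · (hat · (#2 · (rofnat · Zero)) · #0)))
      · (qadd · (qfrac · (Succ · #1) · num 1) · (qeps2 · #0))) Zero)))).
- move=> j; apply: propext; evs HM; rewrite (monusE HM).
  split=> H jG n; have := H jG n; evs HM;
    by rewrite (qleE HM) qv_abs qv_sub qv_add qv_nat qv_eps2; exact: id.
- move=> _ n; rewrite rofnat0.
  have := @osc_close_rat f G (nm M 1) (cv M s_qmul @ q @ (cv M s_qfrac @ zero @ (succ @ G)))
    (cv M s_qfrac @ zero @ nm M 1) G1 one1 Ho.
  rewrite pv q00 nq_zero mul0r mulr0 subrr normr0 lexx ler01 invr_gt0 => /(_ isT isT).
  move=> H; have := H ltac:(lra) n n; rewrite nq_one invr1; lra.
move=> j IH jG n; rewrite nq_succ in jG.
have jG' : nq j <= nq (succ @ G) by lra.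
(* the link from the j-th to the next point is evaluated at a late index m *)
apply: (@ep_limit _ HM _ _ 3 n) => // m n_m.
have h1 := IH jG' m.
have h2 := @osc_close_rat f G (nm M 1) (cv M s_qmul @ q @ (cv M s_qfrac @ (succ @ j) @ (succ @ G)))
  (cv M s_qmul @ q @ (cv M s_qfrac @ j @ (succ @ G))) G1 one1 Ho.
have jS : nq (succ @ j) <= nq (succ @ G) by rewrite (nq_succ HM j).
have {}h2 := h2 (pv01 _ jS) (pv01 _ jG').
have dist : `|qv (cv M s_qmul @ q @ (cv M s_qfrac @ (succ @ j) @ (succ @ G))) -
    qv (cv M s_qmul @ q @ (cv M s_qfrac @ j @ (succ @ G)))| < (nq G)^-1.
  rewrite !pv -mulrBr -mulrBl (nq_succ HM j) (addrC (nq j)) addrK mul1r.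
  have qS : 0 <= qv q * (nq (succ @ G))^-1 by apply: divr_ge0 => //; lra.
  rewrite (ger0_norm qS).
  apply: (@le_lt_trans _ _ (nq (succ @ G))^-1).
    by rewrite ger_pMl // invr_gt0; lra.
  rewrite ltf_pV2 ?posrE; last lra; last lra.
  by rewrite nq_succ; lra.
have {}h2 := h2 dist n m.
have /andP[h3 h4] := hx_close (f @ (cv M s_rofnat @ zero)) n_m.
move: h1 h2; rewrite nq_one invr1 !nq_succ.
move: (hx _ m) (hx _ m) (hx _ n) (hx _ n) h3 h4 => a b c d h3 h4.
rewrite !ler_norml => /andP[h5 h6] /andP[h7 h8]; apply/andP; split; lra.
Qed.

(** The constant 6 covers the two ends of the chain, whose points are other codes
    of 0 and of [qv q], and the errors of the approximations. *)
Lemma value_bound f g q n : mmodulus f g -> 0 <= qv q <= 1 ->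
  `|hx (f @ (cv M s_rofq @ q)) n| <= nq (bound_of f g) + 6.
Proof.
move=> Hg uq.
have [G1 Ho] : 1 <= nq (g @ nm M 1) /\ mosc f (g @ nm M 1) (nm M 1).
  by apply: Hg; rewrite nq_one.
set G := g @ nm M 1 in G1 Ho *.
have SG1 : 1 <= nq (succ @ G) by rewrite nq_succ; lra.
have SG0 : nq (succ @ G) != 0 by rewrite gt_eqF //; lra.
have one1 : 1 <= nq (nm M 1) by rewrite nq_one.
have h1 := chain_bound Hg uq (lexx (nq (succ @ G))) n.
have E : qv (cv M s_qmul @ q @ (cv M s_qfrac @ (succ @ G) @ (succ @ G))) = qv q.
  by rewrite qv_mul qv_frac // divff // mulr1.
have := @osc_close_rat f G (nm M 1) q
  (cv M s_qmul @ q @ (cv M s_qfrac @ (succ @ G) @ (succ @ G))) G1 one1 Ho uq.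
rewrite E subrr normr0 invr_gt0 => /(_ uq ltac:(lra) n n) h2.
have h3 := hx_bound HM (f @ (cv M s_rofnat @ zero)) n.
have e1 := ep_le1 HM n.
move: h1 h2 h3; rewrite /bound_of -/G !nq_add nq_one invr1 !nq_succ ep_0.
move: (hx _ n) (hx _ n) (hx _ n) => a b c.
rewrite !ler_norml => /andP[h5 h6] /andP[h7 h8] h9.
have {}h9 : `|b| <= nq (cv M s_rbound @ (f @ (cv M s_rofnat @ zero))) by lra.
by move: h9; rewrite ler_norml => /andP[h9 h10]; apply/andP; split; lra.
Qed.

Lemma pt_unit K i : nq i <= nq (cv M s_pow2 @ K) ->
  qv (cv M s_qfrac @ i @ (cv M s_pow2 @ K)) = nq i * ep K /\ 0 <= nq i * ep K <= 1.
Proof.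
move=> iK; have K0 := pow2_gt0 HM K.
split; first by rewrite qv_frac ?pow2_ge1.
by rewrite mulr_ge0 ?nq_ge0 ?(ltW (ep_gt0 _ _)) //= ler_pdivrMr // mul1r.
Qed.

Lemma Fv_bound f g K i : mmodulus f g -> nq i <= nq (cv M s_pow2 @ K) ->
  `|Fv f K i| <= nq (bound_of f g) + 6.
Proof. by move=> Hg /pt_unit[E u]; apply: value_bound Hg _; rewrite E. Qed.

Lemma psum_lipschitz f g K s t : mmodulus f g ->
  nq s <= nq t -> nq t <= nq (cv M s_pow2 @ K) + 1 ->
  `|psum f K t - psum f K s| <= (nq t - nq s) * ep K * (nq (bound_of f g) + 6).
Proof.
move=> Hg st tK.
have := @psum_deviation _ HM f K s t 0 (nq (bound_of f g) + 6).
rewrite mulr0 subr0; apply=> // i si it; rewrite subr0; apply: Fv_bound => //.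
by apply: (nq_lt_le (HM := HM)); lra.
Qed.

(** The search moves on while the partition point is at most x, so that it stops
    within one cell of x, or at the right end. There and at the left end x is at
    most [ep K] away, as it is a point of [0,1]. *)
Lemma part_index_spec x K (c := cv M s_part_index @ x @ K) : munit x ->
  nq c <= nq (cv M s_pow2 @ K) /\ `|nq c * ep K - hx x K| <= ep K.
Proof.
move=> ux; set P := cv M s_pow2 @ K.
have P1 : 1 <= nq P by apply: pow2_ge1.
have [h Eh Hh] : exists2 h : car M (ty0 ~> ty0 ~> ty0), c = rec @ P @ zero @ h &
    forall r i, h @ r @ i = if hx x K < nq r * ep K then r else succ @ r.
  rewrite {}/c; uncv s_part_index part_index; evs HM; eexists; first reflexivity.
  move=> r i; evs HM; rewrite (iteE HM).
  have -> : (nq (cv M s_qlt @ (cv M s_hat @ x @ K) @ (cv M s_qfrac @ r @ (cv M s_pow2 @ K))) == 0) =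
    (hx x K < nq r * ep K); last by [].
  apply/eqP/idP; rewrite -(nq_zero HM).
    by move/nq_inj; rewrite (qltE HM) qv_frac ?pow2_ge1.
  by move=> H; congr nq; rewrite (qltE HM) qv_frac ?pow2_ge1.
rewrite {}Eh.
have H i : nq (rec @ i @ zero @ h) <= nq i /\
   (rec @ i @ zero @ h <> zero -> (nq (rec @ i @ zero @ h) - 1) * ep K <= hx x K) /\
   (~ hx x K < nq (rec @ i @ zero @ h) * ep K -> rec @ i @ zero @ h = i).
  move: i; apply: (formula_ind HM (rho := ⟪h, x, K⟫) (p :=
    FAnd (FEq (monus · (Rec · #0 · Zero · #1) · #0) Zero)
    (FAnd (FImp (FNot (FEq (Rec · #0 · Zero · #1) Zero))
       (FEq (qle · (qfrac · (pred · (Rec · #0 · Zero · #1)) · (pow2 · #3)) · (hat · #2 · #3)) Zero))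
     (FImp (FNot (FEq (qlt · (hat · #2 · #3) · (qfrac · (Rec · #0 · Zero · #1) · (pow2 · #3))) Zero))
        (FEq (Rec · #0 · Zero · #1) #0))))).
  - move=> i; evs HM; rewrite (monusE HM) (qleE HM) (qltE HM) !qv_frac ?pow2_ge1 //.
    set C := rec @ i @ zero @ h.
    have E : C <> zero -> nq (cv M s_pred @ C) = nq C - 1.
      move=> C0; apply: nq_pred; apply: nq_ge1; apply/eqP; rewrite -(nq_zero HM).
      by move/nq_inj.
    split=> -[H1 [H2 H3]]; split=> //; split=> // C0.
      by have := H2 C0; rewrite E.
    by rewrite E //; exact: H2.
  - by rewrite (rec0 HM) lexx; split=> //; split.
  move=> i [H1 [H2 H3]]; rewrite (recS HM) Hh nq_succ.
  case: ifP => [lt|/negbT]; last rewrite -leNgt => ge.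
    by split; [lra|split=> // /(_ lt)].
  have E : rec @ i @ zero @ h = i by apply: H3; apply/negP; rewrite -leNgt.
  rewrite E in ge *; rewrite nq_succ; split=> //; split=> // _.
  by rewrite addrK.
have [H1 [H2 H3]] := H P; split=> //.
have e0 := ep_gt0 HM K; have /andP[x0 x1] := munit_bounds K ux.
have PK : nq P * ep K = 1 by apply: pow2_ep.
have [C0|C0] := pselect (rec @ P @ zero @ h = zero).
  rewrite C0 nq_zero mul0r sub0r normrN ler_norml x0 /=.
  have [lt|ge] := ltrP (hx x K) 0; first lra.
  have : rec @ P @ zero @ h = P by apply: H3; rewrite C0 nq_zero mul0r; apply/negP; rewrite -leNgt.
  by rewrite C0 => E; exfalso; apply: (@absurd_lt _ HM); move: P1; rewrite -E nq_zero; lra.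
have := H2 C0; rewrite mulrBl mul1r => h1; rewrite ler_norml; apply/andP; split; last lra.
have [lt|ge] := ltrP (hx x K) (nq (rec @ P @ zero @ h) * ep K); first lra.
by rewrite H3 ?PK; [lra|apply/negP; rewrite -leNgt].
Qed.

End Integral.

(** With e = 2^-n, eG = 2^-G and eb = 2^(-3b) this says that the index n + G + 3b + 4
    is large enough: G >= 1 gives eG <= 1/2, while (3b + 1) eb <= 1 and b >= 2 give
    (5b + 32) eb <= 7, and 7/32 is less than 1/4. *)
Lemma fine_arith (R : realFieldType) (e eG eb G b : R) :
  1 <= G -> 2 <= b -> e <= 1 -> 0 < e -> (G + 1) * eG <= 1 -> 0 < eG ->
  (3 * b + 1) * eb <= 1 -> 0 < eb ->
  (G + 1) * (e * eG * (eb * 16^-1)) <= 1 /\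
  e / 4 + (5 * (b + 6) + 2) * (e * eG * (eb * 16^-1)) < e / 2.
Proof.
move=> G1 b2 e1 e0 hG eG0 hb eb0.
have eG2 : eG <= 1 / 2 by nra.
have eb7 : eb <= 1 / 7 by nra.
have beb : b * eb <= 1 / 3 by nra.
split.
  have h1 : e * eb <= 1 by nra.
  have -> : (G + 1) * (e * eG * (eb * 16^-1)) = ((G + 1) * eG) * (e * eb) / 16 by ring.
  have h2 : 0 < e * eb by apply: mulr_gt0.
  have h3 : 0 < (G + 1) * eG by apply: mulr_gt0 => //; lra.
  nra.
have -> : (5 * (b + 6) + 2) * (e * eG * (eb * 16^-1)) =
  e * (eG * (5 * (b * eb) + 32 * eb) / 16) by ring.
have h1 : 5 * (b * eb) + 32 * eb <= 7 by lra.
have h0 : 0 < 5 * (b * eb) + 32 * eb by nra.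
have h2 : eG * (5 * (b * eb) + 32 * eb) <= 1 / 2 * 7 by apply: ler_pM => //; lra.
nra.
Qed.

Lemma mulrDl1 (R : realFieldType) (a b : R) : (a + 1) * b = a * b + b.
Proof. by rewrite mulrDl mul1r. Qed.

(** The length d of the cells that were counted may be replaced by the distance D. *)
Lemma increment_arith (R : realFieldType) (S d D c eta e : R) :
  `|S - d * c| <= `|d| * eta -> `|d - D| <= 2 * e ->
  0 <= eta ->
  `|S - D * c| <= `|D| * eta + 2 * e * (`|c| + eta).
Proof.
move=> h1 h2 eta0.
have -> : S - D * c = (S - d * c) + (d - D) * c by ring.
apply: le_trans (ler_normD _ _) _; rewrite normrM.
have h3 : `|d - D| * `|c| <= 2 * e * `|c| by rewrite ler_wpM2r.
have h4 : `|d| <= `|D| + 2 * e.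
  have := ler_normD D (d - D); rewrite addrC subrK; lra.
have h5 : `|d| * eta <= (`|D| + 2 * e) * eta by rewrite ler_wpM2r.
lra.
Qed.

Section FTC.
Variables (M : structure) (HM : is_model M).
Notation N := (car M ty0).
Notation nq := (nq HM).
Notation qv := (qv HM).
Notation ep := (ep HM).
Notation hx := (hx HM).
Notation Q := (QM HM).
Notation mosc := (mosc HM).
Notation munit := (munit HM).
Notation mmodulus := (mmodulus HM).
Notation Fv := (Fv HM).
Notation psum := (psum HM).
Notation "m ⊕ n" := (cv M s_add @ m @ n) (at level 50, left associativity).
Notation "m ⊗ n" := (cv M s_mul @ m @ n) (at level 40, left associativity).
Implicit Types (m n k i j p l K : N) (x y e d : car M ty1) (f : car M ty2) (g : car M ty1).

(** The Riemann sum up to x; the cell in which x lies is included. *)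
Definition psum_at f x K : Q := psum f K (succ @ (cv M s_part_index @ x @ K)).

(** The cells up to the partition index of x contribute the oscillation 1/h and
    rounding errors. The remaining five cells of length at most [ep K] count with
    the bound of f: the last cell of each sum, and three for the distance between
    the two partition points, as each is within one cell of its approximation of x
    and the two approximations are within one cell of each other. *)
Lemma psum_at_refine f g h x K j : mmodulus f g -> 1 <= nq h -> munit x ->
  (nq (g @ h) + 1) * ep K <= 1 ->
  `|psum_at f x K - psum_at f x (K ⊕ j)| <=
    (nq h)^-1 + (5 * (nq (bound_of f g) + 6) + 2) * ep K.
Proof.
move=> Hg h1 ux gK; rewrite /psum_at.
set K' := K ⊕ j; set p := cv M s_part_index @ x @ K; set p' := cv M s_part_index @ x @ K'.
have [g1 Ho] := Hg h h1.
pose J := cv M s_pow2 @ j; pose B := nq (bound_of f g) + 6.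
have J0 : 0 < nq J := pow2_gt0 HM j.
have eK0 := ep_gt0 HM K; have eK0' := ep_gt0 HM K'.
have eKK : ep K' <= ep K by apply: ep_le; rewrite nq_add; have := nq_ge0 HM j; lra.
have eJ : nq J * ep K' = ep K by rewrite ep_add mulrCA pow2_ep mulr1.
have B0 : 0 <= B by rewrite /B; have := nq_ge0 HM (bound_of f g); lra.
have PK' : nq (cv M s_pow2 @ K') = nq (cv M s_pow2 @ K) * nq J by apply: pow2_add.
have [pK px] : nq p <= nq (cv M s_pow2 @ K) /\ `|nq p * ep K - hx x K| <= ep K.
  exact: part_index_spec.
have [pK' px'] : nq p' <= nq (cv M s_pow2 @ K') /\ `|nq p' * ep K' - hx x K'| <= ep K'.
  exact: part_index_spec.
have pJ : nq (p ⊗ J) <= nq (cv M s_pow2 @ K') by rewrite nq_mul PK' ler_pM2r.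
have a1 : `|psum f K (succ @ p) - psum f K p| <= ep K * B.
  have := @psum_lipschitz _ HM f g K p (succ @ p) Hg.
  by rewrite nq_succ (addrC (nq p)) addrK mul1r; apply; lra.
have a2 : `|psum f K' (succ @ p') - psum f K' p'| <= ep K' * B.
  have := @psum_lipschitz _ HM f g K' p' (succ @ p') Hg.
  by rewrite nq_succ (addrC (nq p')) addrK mul1r; apply; lra.
have a3 : `|psum f K' (p ⊗ J) - psum f K p| <= nq p * (ep K * ((nq h)^-1 + 2 * ep K)).
  apply: (psum_refine (L := cv M s_pow2 @ K)) pK => m r mK rJ.
  have mJ : nq (m ⊗ J ⊕ r) <= nq (cv M s_pow2 @ K').
    rewrite nq_add nq_mul PK'; have := nq_lt mK; have := nq_ge0 HM m.
    move: (nq m) (nq (cv M s_pow2 @ K)) => a b a0 ab.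
    have : (a + 1) * nq J <= b * nq J by rewrite ler_pM2r.
    by rewrite mulrDl mul1r; lra.
  have [E1 u1] := pt_unit mJ; have [E2 u2] := pt_unit (ltW mK).
  rewrite -E1 in u1; rewrite -E2 in u2.
  have := osc_close_rat g1 h1 Ho u1 u2; rewrite E1 E2.
  have -> : nq (m ⊗ J ⊕ r) * ep K' - nq m * ep K = nq r * ep K'.
    by rewrite nq_add nq_mul mulrDl -mulrA eJ addrC addKr.
  have d1 : `|nq r * ep K'| < (nq (g @ h))^-1.
    rewrite ger0_norm ?mulr_ge0 ?nq_ge0 ?ltW //.
    apply: (@lt_trans _ _ (ep K)); first by rewrite -eJ ltr_pM2r.
    rewrite -[X in _ < X]mul1r ltr_pdivlMr; last lra.
    by move: gK; rewrite mulrDl mul1r mulrC; lra.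
  move=> /(_ d1 K' K) H; apply: le_trans H _; lra.
have p1 : nq p * ep K <= 1 by have [_ /andP[]] := pt_unit pK.
have h0 : 0 < (nq h)^-1 by rewrite invr_gt0; lra.
have {}a3 : `|psum f K' (p ⊗ J) - psum f K p| <= (nq h)^-1 + 2 * ep K.
  apply: le_trans a3 _; rewrite mulrA.
  by rewrite -[X in _ <= X]mul1r ler_wpM2r //; lra.
have a4 : `|psum f K' (p ⊗ J) - psum f K' p'| <= 3 * ep K * B.
  have xx : `|hx x K - hx x K'| <= ep K.
    by apply: hx_le; rewrite nq_add; have := nq_ge0 HM j; lra.
  have dd : `|nq (p ⊗ J) * ep K' - nq p' * ep K'| <= 3 * ep K.
    rewrite nq_mul -mulrA eJ; move: px px' xx; rewrite !ler_norml.
    by move=> /andP[? ?] /andP[? ?] /andP[? ?]; apply/andP; split; lra.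
  have [le|/ltW le] := lerP (nq p') (nq (p ⊗ J)).
    apply: le_trans (psum_lipschitz Hg le _) _; first lra.
    apply: ler_wpM2r => //; move: dd; rewrite ler_norml mulrBl => /andP[_]; lra.
  rewrite distrC; apply: le_trans (psum_lipschitz Hg le _) _; first lra.
  apply: ler_wpM2r => //; move: dd; rewrite ler_norml mulrBl => /andP[+ _]; lra.
have eB : ep K' * B <= ep K * B by rewrite ler_wpM2r.
rewrite -/B; have -> : (5 * B + 2) * ep K = 5 * (ep K * B) + 2 * ep K by ring.
move: a1 a2 a3 a4 eB; rewrite -mulrA; move: (ep K' * B) (ep K * B) => u v.
rewrite !ler_norml => /andP[? ?] /andP[? ?] /andP[? ?] /andP[? ?] ?.
by apply/andP; split; lra.
Qed.

Notation idx f g n := (cv M s_int_index @ f @ g @ n).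
Notation two_n n := (cv M s_pow2 @ (n ⊕ nm M 2)).

Lemma nq_idx f g n :
  nq (idx f g n) = nq n + nq (g @ two_n n) + (3 * nq (bound_of f g) + 4).
Proof.
by uncv s_int_index int_index; evs HM; rewrite !(nq_add, nq_mul) !nq_num /bound_of ?nq_add ?nq_num.
Qed.

Lemma ep_two n : (nq (two_n n))^-1 = ep n / 4.
Proof.
rewrite -[LHS]/(ep (n ⊕ nm M 2)) ep_add; congr (_ * _).
by rewrite /= !ep_S ep_0; lra.
Qed.

Lemma half_pow_bound (b : N) : (3 * nq b + 1) * ep (nm M 3 ⊗ b) <= 1.
Proof. by have := ep_small HM (nm M 3 ⊗ b); rewrite nq_mul nq_num. Qed.

Lemma idx_fine f g n : mmodulus f g ->
  (nq (g @ two_n n) + 1) * ep (idx f g n) <= 1 /\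
  (nq (two_n n))^-1 + (5 * (nq (bound_of f g) + 6) + 2) * ep (idx f g n) < ep n / 2.
Proof.
move=> Hg; set G := g @ two_n n; set b := bound_of f g.
have G1 : 1 <= nq G by have [] := Hg (two_n n) (pow2_ge1 HM _).
have b2 : 2 <= nq b.
  have [g1 _] : 1 <= nq (g @ nm M 1) /\ mosc f (g @ nm M 1) (nm M 1).
    by apply: Hg; rewrite nq_num.
  rewrite /b /bound_of !nq_add nq_num.
  by have := nq_ge0 HM (cv M s_rbound @ (f @ (cv M s_rofnat @ zero))); lra.
have -> : idx f g n = n ⊕ G ⊕ (nm M 3 ⊗ b ⊕ nm M 4).
  apply: (@nq_inj _ HM); rewrite nq_idx -/G -/b (nq_add HM (n ⊕ G)) (nq_add HM n).
  by rewrite (nq_add HM (nm M 3 ⊗ b)) nq_mul !nq_num.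
rewrite ep_two !ep_add.
have -> : ep (nm M 4) = 16^-1 by rewrite /= !ep_S ep_0; lra.
have := ep_gt0 HM (nm M 3 ⊗ b); have := half_pow_bound b.
have := ep_gt0 HM G; have := ep_small HM G.
have := ep_gt0 HM n; have := ep_le1 HM n.
move: (ep n) (ep G) (ep (nm M 3 ⊗ b)) (nq G) (nq b) G1 b2.
exact: fine_arith.
Qed.

(** The indices for n and m need not be ordered, because g is arbitrary. Both sums
    are compared with the one at the sum of the two indices. *)
Lemma psum_at_cauchy f g x n m : mmodulus f g -> munit x -> nq n < nq m ->
  `|psum_at f x (idx f g n) - psum_at f x (idx f g m)| < ep n.
Proof.
move=> Hg ux n_m.
have [f1 f2] := idx_fine n Hg; have [f3 f4] := idx_fine m Hg.
have h1 := psum_at_refine (idx f g m) Hg (pow2_ge1 HM _) ux f1.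
have h2 := psum_at_refine (idx f g n) Hg (pow2_ge1 HM _) ux f3.
(* both sums are refined to the same partition *)
have E : idx f g m ⊕ idx f g n = idx f g n ⊕ idx f g m.
  by apply: (@nq_inj _ HM); rewrite !nq_add addrC.
rewrite E in h2; have em : ep m <= ep n by apply: ep_le; exact: ltW.
have {}h1 := le_lt_trans h1 f2; have {}h2 := le_lt_trans h2 f4.
move: h1 h2; rewrite !ltr_norml => /andP[? ?] /andP[? ?].
by apply/andP; split; lra.
Qed.

Lemma hx_integral f g x n : mmodulus f g -> munit x ->
  hx (cv M s_integral @ f @ g @ x) n = psum_at f x (idx f g n).
Proof.
move=> Hg ux.
have E k : qv (cv M s_integral @ f @ g @ x @ k) = psum_at f x (idx f g k).
  by uncv s_integral integral; evs HM; rewrite riemann_sumE.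
by rewrite hx_real // => i j ij; rewrite !E; exact: psum_at_cauchy.
Qed.

(** The sums differ by the samples between the partition indices of x and y. All
    of these are taken near the interval between x and y, hence within 1/k of
    f(x), and the number of cells times [ep K] is y - x up to two cells. *)
Lemma psum_at_increment f g l k x y K (dl : Q) (c := hx (f @ x) K)
    (D := hx y K - hx x K) :
  mmodulus f g -> 1 <= nq l -> 1 <= nq k -> mosc f l k -> munit x -> munit y ->
  (forall p, nq K <= nq p -> `|hx y p - hx x p| <= (nq l)^-1 - dl) -> 4 * ep K <= dl ->
  `|psum_at f y K - psum_at f x K - D * c| <=
    `|D| * ((nq k)^-1 + 2 * ep K) + 2 * ep K * (`|c| + (nq k)^-1 + 2 * ep K).
Proof.
move=> Hg l1 k1 Ho ux uy Hxy Kdl; rewrite /psum_at.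
have [pK px] := part_index_spec K ux; have [qK qy] := part_index_spec K uy.
move: pK px qK qy; set p := cv M s_part_index @ x @ K; set q := cv M s_part_index @ y @ K.
move=> pK px qK qy; have e0 := ep_gt0 HM K.
have near i : nq i <= nq (cv M s_pow2 @ K) -> `|nq i * ep K - hx x K| <= `|D| + 2 * ep K ->
    `|Fv f K i - c| <= (nq k)^-1 + 2 * ep K.
  move=> iK ix; have [Ei ui] := pt_unit iK; rewrite -Ei in ui.
  have := @osc_close _ HM f l k (pt K i) x (ep K) K l1 k1 Ho (munit_rofq ui) ux e0.
  move=> /(_ _ K K) H; have {}H := H _; apply: le_trans (H _) _; last lra.
  move=> r Kr; rewrite /pt hx_rofq Ei.
  have := hx_le x Kr; have := Hxy K (lexx _); move: ix; rewrite -/D.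
  rewrite ler_norml => /andP[? ?] ?; rewrite ler_norml => /andP[? ?].
  by rewrite ler_norml; apply/andP; split; lra.
set eta := (nq k)^-1 + 2 * ep K in near *.
have eta0 : 0 <= eta by rewrite /eta; have : 0 < (nq k)^-1; [rewrite invr_gt0|]; lra.
have dev : `|psum f K (succ @ q) - psum f K (succ @ p) - (nq q - nq p) * ep K * c| <=
    `|(nq q - nq p) * ep K| * eta.
  move: (px); rewrite ler_norml => /andP[x1 x2].
  move: (qy); rewrite ler_norml => /andP[y1 y2].
  have [le|/ltW le] := lerP (nq p) (nq q).
    have := @psum_deviation _ HM f K (succ @ p) (succ @ q) c eta.
    rewrite !nq_succ (_ : nq q + 1 - (nq p + 1) = nq q - nq p); last ring.
    rewrite [`|(nq q - nq p) * ep K|]ger0_norm; last by apply: mulr_ge0; lra.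
    apply; last lra.
    move=> i pi iq; have {}iq : nq i <= nq q by apply: (nq_lt_le (HM := HM)).
    apply: near; first lra.
    have : nq p * ep K + ep K <= nq i * ep K by rewrite -mulrDl1 ler_pM2r.
    have : nq i * ep K <= nq q * ep K by rewrite ler_pM2r.
    have := ler_norm D; rewrite /D => *.
    by rewrite ler_norml; apply/andP; split; lra.
  have := @psum_deviation _ HM f K (succ @ q) (succ @ p) c eta.
  rewrite !nq_succ (_ : nq p + 1 - (nq q + 1) = nq p - nq q); last ring.
  rewrite [`|(nq q - nq p) * ep K|]ler0_norm; last first.
    by rewrite -oppr_ge0 -mulNr opprB; apply: mulr_ge0; lra.
  move=> H; rewrite (_ : - ((nq q - nq p) * ep K) = (nq p - nq q) * ep K); last ring.
  rewrite (_ : psum f K (succ @ q) - _ - _ =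
    - (psum f K (succ @ p) - psum f K (succ @ q) - (nq p - nq q) * ep K * c)); last ring.
  rewrite normrN; apply: H; last lra.
  move=> i qi ip; have {}ip : nq i <= nq p by apply: (nq_lt_le (HM := HM)).
  apply: near; first lra.
  have : nq q * ep K + ep K <= nq i * ep K by rewrite -mulrDl1 ler_pM2r.
  have : nq i * ep K <= nq p * ep K by rewrite ler_pM2r.
  have := ler_norm (- D); rewrite normrN /D => *.
  by rewrite ler_norml; apply/andP; split; lra.
have dist : `|(nq q - nq p) * ep K - D| <= 2 * ep K.
  move: px qy; rewrite !ler_norml mulrBl /D => /andP[? ?] /andP[? ?].
  by apply/andP; split; lra.
move: dev dist; move: (psum _ _ _ - _) ((nq q - nq p) * ep K) => S d'.
move=> h1 h2; rewrite -[_ + _ + 2 * ep K]addrA -/eta; exact: increment_arith h1 h2 eta0.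
Qed.

End FTC.

(** * The fundamental theorem in a model *)

Lemma quot_close (R : realFieldType) (a b u v dl C r e : R) :
  0 < dl -> 0 <= C -> dl <= `|u| -> dl <= `|v| -> `|b| <= C -> `|a - b| <= 2 * r ->
  `|u - v| <= r -> r * (2 / dl + C / (dl * dl)) < e -> `|a / u - b / v| < e.
Proof.
move=> d0 C0 u0 v0 bC ab uv H; apply: le_lt_trans H.
have un0 : u != 0 by rewrite -normr_gt0; lra.
have vn0 : v != 0 by rewrite -normr_gt0; lra.
have r0 : 0 <= r by apply: le_trans (normr_ge0 _) uv.
have -> : a / u - b / v = (a - b) / u + b * (v - u) / (u * v) by field; rewrite un0 vn0.
apply: le_trans (ler_normD _ _) _; rewrite [r * _]mulrDr; apply: lerD.
  rewrite normf_div mulrCA mulrA; apply: ler_pM => //; first by rewrite invr_ge0.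
  by rewrite lef_pV2 // posrE; lra.
rewrite normf_div !normrM (distrC v).
have k1 : `|b| * `|u - v| <= C * r by apply: ler_pM.
have k2 : dl * dl <= `|u| * `|v| by apply: ler_pM => //; lra.
have d2 : 0 < dl * dl by apply: mulr_gt0.
have -> : r * (C / (dl * dl)) = C * r / (dl * dl) by ring.
apply: ler_pM => //; rewrite ?mulr_ge0 ?invr_ge0 ?mulr_ge0 //.
by rewrite lef_pV2 // posrE; lra.
Qed.

Lemma quot_approx (R : realFieldType) (a c u dl ka r : R) :
  0 < dl -> dl <= `|u| -> 0 <= r -> `|a - u * c| <= `|u| * ka + r ->
  `|a / u - c| <= ka + r / dl.
Proof.
move=> d0 u0 r0 H; have un0 : u != 0 by rewrite -normr_gt0; lra.
have -> : a / u - c = (a - u * c) / u by field.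
rewrite normf_div ler_pdivrMr; last lra.
apply: le_trans H _; rewrite mulrDl mulrC lerD2l.
by rewrite -mulrA ler_peMr // mulrC ler_pdivlMr // mul1r.
Qed.

Lemma increment_arith2 (R : realFieldType) (J I D E c B ka en eK : R) :
  `|c| <= B -> `|D - E| <= 2 * en -> `|E| <= 1 -> 0 < ka -> ka <= 1 -> 0 < eK ->
  eK <= en -> en <= 1 ->
  `|J - I - D * c| <= `|D| * (ka + 2 * eK) + 2 * eK * (`|c| + ka + 2 * eK) ->
  `|J - I - E * c| <= `|E| * ka + en * (4 * B + 14).
Proof.
move=> cB DE E1 k0 k1 e0 een en1 H.
have -> : J - I - E * c = (J - I - D * c) + (D - E) * c by ring.
apply: le_trans (ler_normD _ _) _; rewrite normrM.
have h1 : `|D - E| * `|c| <= 2 * en * B by apply: ler_pM.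
have h2 : `|D| <= `|E| + 2 * en by have := ler_normD E (D - E); rewrite addrC subrK; lra.
have B0 : 0 <= B by apply: le_trans (normr_ge0 _) cB.
have h3 : `|D| * (ka + 2 * eK) <= (`|E| + 2 * en) * (ka + 2 * en).
  by apply: ler_pM => //; lra.
have h4 : 2 * eK * (`|c| + ka + 2 * eK) <= 2 * en * (B + 3).
  by apply: ler_pM; rewrite ?mulr_ge0 ?addr_ge0 //; lra.
have h5 : `|E| * en <= en by rewrite ler_piMl //; lra.
have h6 : en * ka <= en by rewrite ler_piMr //; lra.
have h7 : en * en <= en by rewrite ler_piMr //; lra.
lra.
Qed.

(** The estimates behind d e = J - I, where d is read at another index than e. *)
Lemma quot_mul_approx (R : realFieldType) (a b u v dl C r e : R) :
  0 < dl -> dl <= `|u| -> `|a| <= C -> `|v - u| <= r -> r <= e -> `|a - b| <= e ->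
  `|a / u * v - b| <= e * (C / dl + 1).
Proof.
move=> d0 u0 aC vu re ab; have un0 : u != 0 by rewrite -normr_gt0; lra.
have -> : a / u * v - b = a * (v - u) / u + (a - b) by field.
apply: le_trans (ler_normD _ _) _; rewrite [e * _]mulrDr mulr1; apply: lerD => //.
rewrite normf_div normrM; have -> : e * (C / dl) = C * e / dl by ring.
apply: ler_pM; rewrite ?mulr_ge0 ?invr_ge0 //; first by apply: ler_pM => //; lra.
by rewrite lef_pV2 // posrE; lra.
Qed.

Lemma shift_approx (R : realFieldType) (a c u v ka B C r : R) :
  0 < ka -> ka <= 1 -> `|c| <= C -> `|u - v| <= r ->
  `|a - v * c| <= `|v| * ka + r * B -> `|a - u * c| <= `|u| * ka + r * (B + 1 + C).
Proof.
move=> k0 k1 cC uv H; have -> : a - u * c = (a - v * c) - (u - v) * c by ring.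
apply: le_trans (ler_normB _ _) _; rewrite normrM.
have h1 : `|u - v| * `|c| <= r * C by apply: ler_pM.
have h2 : `|v| <= `|u| + r by have := ler_normB u (u - v); rewrite opprB addrC subrK; lra.
have h3 : `|v| * ka <= (`|u| + r) * ka by apply: ler_wpM2r => //; lra.
have r0 : 0 <= r by apply: le_trans uv.
have h4 : r * ka <= r by rewrite ler_piMr.
lra.
Qed.

Section Derivative.
Variables (M : structure) (HM : is_model M).
Notation N := (car M ty0).
Notation nq := (nq HM).
Notation qv := (qv HM).
Notation ep := (ep HM).
Notation hx := (hx HM).
Notation Q := (QM HM).
Notation mosc := (mosc HM).
Notation munit := (munit HM).
Notation mmodulus := (mmodulus HM).
Notation "m ⊕ n" := (cv M s_add @ m @ n) (at level 50, left associativity).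
Implicit Types (m n k i j p l K : N) (x y e d : car M ty1) (f : car M ty2) (g : car M ty1).

(** Inversion of rationals as an object of the model; zero gets the value zero. *)
Lemma qinv_exists : exists v : car M ty1, forall q, qv (v @ q) = (qv q)^-1.
Proof.
exists (eval enil (λ q : ty0, ite · (monus · (qpos · q) · (qneg · q))
  · (ite · (monus · (qneg · q) · (qpos · q)) · (qcode · Zero · Zero · Zero)
         · (qcode · Zero · (qden · q) · (pred · (monus · (qneg · q) · (qpos · q)))))
  · (qcode · (qden · q) · Zero · (pred · (monus · (qpos · q) · (qneg · q)))))).
move=> q; evs HM; rewrite !(iteE HM) /qv.
set a := cv M s_qpos @ q; set b := cv M s_qneg @ q.
have d0 := den_gt0 HM q.
have [ab|ba] := lerP (nq a) (nq b).
  rewrite (nq_monus_le ab) nq_zero eqxx.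
  have E := nq_monus_ge ab; rewrite E; case: eqP => [ba|ne].
    have -> : nq a - nq b = 0 by clear E; lra.
    by rewrite -[LHS]/(qv _) qv_code nq_zero subrr !mul0r invr0.
  have h1 : 1 <= nq (cv M s_monus @ b @ a) by apply: nq_ge1; rewrite E; apply/eqP.
  rewrite -[LHS]/(qv _) qv_code nq_pred // E nq_zero sub0r subrK invf_div.
  by rewrite -(opprB (nq b)) invrN mulrN mulNr.
have E := nq_monus_ge (ltW ba).
have h1 : 1 <= nq (cv M s_monus @ a @ b) by apply: nq_ge1; rewrite E gt_eqF // subr_gt0.
have -> : (nq (cv M s_monus @ a @ b) == 0) = false by rewrite gt_eqF //; lra.
by rewrite -[LHS]/(qv _) qv_code nq_pred // E nq_zero subr0 subrK invf_div.
Qed.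

(** A real v that stays away from zero can be divided by, after a shift [w] of the
    indices that compensates the loss of precision. *)
Lemma quotient_exists (u v : car M ty1) (w : N) (dl C : Q) :
  0 < dl -> 0 <= C -> (forall n, nq w <= nq n -> dl <= `|hx v n|) ->
  (forall n, `|hx u n| <= C) -> ep w * (2 / dl + C / (dl * dl)) < 1 ->
  exists d, forall n, hx d n = hx u (n ⊕ w) / hx v (n ⊕ w).
Proof.
move=> d0 C0 Hv Hu Hw; have [inv Hinv] := qinv_exists.
have [d E] : exists d, forall n, qv (d @ n) = hx u (n ⊕ w) / hx v (n ⊕ w).
  exists (eval ⟪inv, u, v, w⟫ (λ n : ty0,
    qmul · (hat · ↑#1 · (add · n · ↑#3)) · (↑#0 · (hat · ↑#2 · (add · n · ↑#3))))).
  by move=> n; evs HM; rewrite qv_mul Hinv.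
exists d => n; rewrite hx_real // => i j ij; rewrite !E.
have w0 := nq_ge0 HM w; have i0 := nq_ge0 HM i; have j0 := nq_ge0 HM j.
have ijw : nq (i ⊕ w) <= nq (j ⊕ w) by rewrite !nq_add; lra.
apply: (@quot_close _ _ _ _ _ dl C (ep (i ⊕ w))) => //.
- by apply: Hv; rewrite nq_add; lra.
- by apply: Hv; rewrite nq_add; lra.
- by have := hx_le u ijw; have := ep_gt0 HM (i ⊕ w); lra.
- exact: hx_le.
by rewrite ep_add -mulrA gtr_pMr // ep_gt0.
Qed.

Lemma munit_of_inner l x : 1 <= nq l -> minner HM l x -> munit x.
Proof.
move=> l1 [h0 h1]; have l0 : 0 < (nq l)^-1 by rewrite invr_gt0; lra.
split=> n; rewrite hx_rofnat nq_num.
  by have := h0 n; rewrite hx_rinv //; lra.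
by have := h1 n; rewrite hx_rsub hx_rofnat hx_rinv // nq_num; lra.
Qed.

Lemma munit_shift l x e : 1 <= nq l -> minner HM l x ->
  mRlt HM (cv M s_rabs @ e) (cv M s_rinv @ l) -> munit (cv M s_radd @ x @ e).
Proof.
move=> l1 [h0 h1] /mRlt_gap[dl d0 [n0 Hn0]].
split; apply: mRle_intro => dl' d0'.
  have [|n1 n01 en1] := @ep_below _ HM (dl' / 2) n0; first lra.
  exists n1 => n n1n; rewrite hx_radd hx_rofnat nq_num.
  have := Hn0 (succ @ n); rewrite nq_succ hx_rabs hx_rinv // => /(_ ltac:(lra)) he.
  have {}he : `|hx e (succ @ n)| <= (nq l)^-1 by lra.
  have := h0 (succ @ n); rewrite hx_rinv // => hx0.
  have : ep (succ @ n) <= ep n1 by apply: ep_le; rewrite nq_succ; lra.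
  by move: he; rewrite ler_norml => /andP[? ?]; lra.
have [|n1 n01 en1] := @ep_below _ HM (dl' / 2) n0; first lra.
exists n1 => n n1n; rewrite hx_radd hx_rofnat nq_num.
have := Hn0 (succ @ n); rewrite nq_succ hx_rabs hx_rinv // => /(_ ltac:(lra)) he.
have {}he : `|hx e (succ @ n)| <= (nq l)^-1 by lra.
have := h1 (succ @ n); rewrite hx_rsub hx_rofnat hx_rinv // nq_num => hx0.
have : ep (succ @ n) <= ep n1 by apply: ep_le; rewrite nq_succ; lra.
by move: he; rewrite ler_norml => /andP[? ?]; lra.
Qed.

(** The approximation of y - x at the index of the partition is replaced by the
    n-th approximation of e; this costs a multiple of 2^-n. *)
Lemma increment_close f g l k x e (dl : Q) n (c := hx (f @ x) (cv M s_int_index @ f @ g @ n))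
   (y := cv M s_radd @ x @ e) :
  mmodulus f g -> 1 <= nq l -> 1 <= nq k -> mosc f l k -> munit x -> munit y ->
  0 < dl -> (forall p, nq n <= nq p -> `|hx e p| + dl <= (nq l)^-1) -> 8 * ep n <= dl ->
  `|hx (cv M s_integral @ f @ g @ y) n - hx (cv M s_integral @ f @ g @ x) n - hx e n * c|
   <= `|hx e n| * (nq k)^-1 + ep n * (4 * nq (cv M s_rbound @ (f @ x)) + 14).
Proof.
move=> Hg l1 k1 Ho ux uy d0 He ndl; rewrite !hx_integral //.
set K := cv M s_int_index @ f @ g @ n in c *.
have nK : nq n <= nq K.
  rewrite nq_idx; have := nq_ge0 HM (g @ (cv M s_pow2 @ (n ⊕ nm M 2))).
  have := nq_ge0 HM (bound_of f g); lra.
have eK := ep_le nK; have eK0 := ep_gt0 HM K; have e1 := ep_le1 HM n.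
have hy p : hx y p = hx x (succ @ p) + hx e (succ @ p) by apply: hx_radd.
have Hxy p : nq K <= nq p -> `|hx y p - hx x p| <= (nq l)^-1 - dl / 2.
  move=> Kp; rewrite hy; have := He (succ @ p); rewrite nq_succ => /(_ ltac:(lra)) h1.
  have := hx_le x (_ : nq p <= nq (succ @ p)); rewrite nq_succ => /(_ ltac:(lra)).
  have : ep p <= ep n by apply: ep_le; lra.
  move: h1; rewrite -lerBrDr ler_norml => /andP[? ?] ?; rewrite ler_norml => /andP[? ?].
  by rewrite ler_norml; apply/andP; split; lra.
have := psum_at_increment Hg l1 k1 Ho ux uy Hxy; rewrite -/c => /(_ ltac:(lra)).
have cB : `|c| <= nq (cv M s_rbound @ (f @ x)).
  by have := hx_bound HM (f @ x) K; rewrite ep_0; lra.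
have De : `|hx y K - hx x K - hx e n| <= 2 * ep n.
  rewrite hy; have := hx_le x (_ : nq K <= nq (succ @ K)); rewrite nq_succ => /(_ ltac:(lra)).
  have := hx_le e (_ : nq n <= nq (succ @ K)); rewrite nq_succ => /(_ ltac:(lra)).
  rewrite !ler_norml => /andP[? ?] /andP[? ?]; by apply/andP; split; lra.
have en1 : `|hx e n| <= 1.
  have := He n (lexx _); have : (nq l)^-1 <= 1 by rewrite invf_le1 //; lra.
  lra.
have ka0 : 0 < (nq k)^-1 by rewrite invr_gt0; lra.
have ka1 : (nq k)^-1 <= 1 by rewrite invf_le1 //; lra.
exact: (increment_arith2 cB De en1 ka0 ka1 eK0 eK e1).
Qed.

(** Both requirements on d hold up to a multiple of 2^-n at index n, hence in the
    limit. *)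
Theorem derivative_of_integral f g l k N0 x e :
  1 <= nq l -> 1 <= nq k -> 1 <= nq N0 ->
  mmodulus f g -> mosc f N0 k -> minner HM l x ->
  mRlt HM (cv M s_rofnat @ nm M 0) (cv M s_rabs @ e) ->
  mRlt HM (cv M s_rabs @ e) (cv M s_rinv @ N0) ->
  mRlt HM (cv M s_rabs @ e) (cv M s_rinv @ l) ->
  mdq HM f g e x k.
Proof.
move=> l1 k1 N1 Hg Ho Hx He0 HeN Hel.
have ux := munit_of_inner l1 Hx; have uy := munit_shift l1 Hx Hel.
have [dl d0 [n0 Hn0]] := mRlt_gap He0.
have {}Hn0 n : nq n0 <= nq n -> dl <= `|hx e n|.
  by move/Hn0; rewrite hx_rofnat nq_num hx_rabs add0r.
have [dN dN0 [n1 Hn1]] := mRlt_gap HeN.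
have {}Hn1 n : nq n1 <= nq n -> `|hx e n| + dN <= (nq N0)^-1.
  by move/Hn1; rewrite hx_rabs hx_rinv.
set y := cv M s_radd @ x @ e in uy.
set J := cv M s_integral @ f @ g @ y; set I := cv M s_integral @ f @ g @ x.
set JI := cv M s_rsub @ J @ I.
pose C := nq (cv M s_rbound @ JI).
have HC n : `|hx JI n| <= C by have := hx_bound HM JI n; rewrite ep_0 /C; lra.
have C0 : 0 <= C by apply: nq_ge0.
pose F := nq (cv M s_rbound @ (f @ x)).
have F0 : 0 <= F by apply: nq_ge0.
pose B := 4 * F + 14.
have B0 : 0 <= B by rewrite /B; lra.
have dl0 : 0 <= dl^-1 by rewrite invr_ge0 ltW.
have T0 : 0 <= 2 / dl + C / (dl * dl) by rewrite addr_ge0 // ?mulr_ge0 // ?invr_ge0 ?mulr_ge0 // ltW.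
have [|w w01 ew1] := @ep_below _ HM (dN / 8) (n0 ⊕ n1); first lra.
have [|w' ww' ew2] := @ep_below _ HM (2 / dl + C / (dl * dl) + 1)^-1 w.
  by rewrite invr_gt0; lra.
have w0 : nq n0 <= nq w by move: w01; rewrite nq_add; have := nq_ge0 HM n1; lra.
have w1 : nq n1 <= nq w by move: w01; rewrite nq_add; have := nq_ge0 HM n0; lra.
have w'0 n : nq w <= nq (n ⊕ w').
  by rewrite nq_add; have := nq_ge0 HM n; lra.
have [|||d Hd] := @quotient_exists JI e w' dl C d0 C0.
- by move=> n nw; apply: Hn0; lra.
- exact: HC.
- have ew0 := ep_gt0 HM w'.
  move: ew2; rewrite -[_^-1]mul1r ltr_pdivlMr; last lra.
  rewrite mulrDr mulr1; lra.
exists d; split.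
- apply: mReq_intro => eta eta0.
  have Cd0 : 0 <= C / dl by apply: mulr_ge0.
  have CT : 0 < C / dl + 1 by lra.
  have [|n2 _ en2] := @ep_below _ HM (eta / (C / dl + 1)) zero.
    by apply: divr_gt0.
  exists n2 => n n2n; rewrite hx_rmul.
  set m1 := n ⊕ _; rewrite Hd; set m2 := m1 ⊕ w'.
  have en : ep n <= ep n2 by apply: ep_le.
  have nm1 : nq n <= nq m1.
    by rewrite /m1 nq_add; have := nq_ge0 HM (cv M s_rbound @ d ⊕ cv M s_rbound @ e); lra.
  have m12 : nq m1 <= nq m2 by rewrite /m2 nq_add; have := nq_ge0 HM w'; lra.
  apply: (@le_trans _ _ (ep n * (C / dl + 1))).
    apply: (quot_mul_approx (r := ep m1)) => //.
    + by apply: Hn0; have := w'0 m1; rewrite -/m2; lra.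
    + exact: hx_le.
    + exact: ep_le.
    + by rewrite distrC; apply: hx_le; lra.
  by move: en2; rewrite ltr_pdivlMr // => h; apply: le_trans (ltW h); rewrite ler_pM2r.
apply: mRle_intro => eta eta0.
(* B comes from the increments, 1 + F from the shift of the index of e by one,
   and the last 1 from replacing the approximation of f(x) *)
pose T := (B + 1 + F) / dl + 1.
have Bd0 : 0 <= (B + 1 + F) / dl by apply: mulr_ge0 => //; lra.
have T1 : 0 < T by rewrite /T; lra.
have [|n2 _ en2] := @ep_below _ HM (eta / T) zero; first by apply: divr_gt0.
exists n2 => n n2n; rewrite hx_rabs hx_rsub hx_rinv // Hd.
set m := succ @ n ⊕ w'.
have wm := w'0 (succ @ n); rewrite -/m in wm.
have ka0 : 0 < (nq k)^-1 by rewrite invr_gt0; lra.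
have ka1 : (nq k)^-1 <= 1 by rewrite invf_le1 //; lra.
have n_m : nq n <= nq m by rewrite /m nq_add nq_succ; have := nq_ge0 HM w'; lra.
have mS : nq m <= nq (succ @ m) by rewrite nq_succ; lra.
have emS : ep (succ @ m) <= ep m by apply: ep_le.
have em : ep m <= ep n by apply: ep_le.
have h1 : `|hx JI m - hx e (succ @ m) * hx (f @ x) (cv M s_int_index @ f @ g @ (succ @ m))| <=
    `|hx e (succ @ m)| * (nq k)^-1 + ep m * B.
  rewrite /JI hx_rsub.
  apply: le_trans (increment_close Hg N1 k1 Ho ux uy dN0 _ _) _.
  - by move=> p mp; apply: Hn1; lra.
  - have : ep (succ @ m) <= ep w by apply: ep_le; lra.
    lra.
  by rewrite lerD2l; apply: ler_wpM2r.
set c := hx (f @ x) _ in h1.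
have cF : `|c| <= F.
  by have := hx_bound HM (f @ x) (cv M s_int_index @ f @ g @ (succ @ m)); rewrite ep_0 -/c -/F; lra.
have h2 := shift_approx ka0 ka1 cF (hx_le e mS) h1.
have h3 : `|hx JI m / hx e m - c| <= (nq k)^-1 + ep m * (B + 1 + F) / dl.
  apply: quot_approx => //; first by apply: Hn0; lra.
  by apply: mulr_ge0; [apply/ltW/ep_gt0|lra].
have h4 : `|c - hx (f @ x) (succ @ n)| <= ep n.
  rewrite distrC; apply: (@le_trans _ _ (ep (succ @ n))); last by apply: ep_le; rewrite nq_succ; lra.
  apply: hx_le; rewrite nq_idx.
  have := nq_ge0 HM (g @ (cv M s_pow2 @ (succ @ m ⊕ nm M 2))); have := nq_ge0 HM (bound_of f g).
  by have := nq_ge0 HM w'; rewrite [nq (succ @ m)]nq_succ /m nq_add; lra.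
have en : ep n <= ep n2 by apply: ep_le.
have h5 : ep n * T <= eta.
  by move: en2; rewrite ltr_pdivlMr // => h; apply: le_trans (ltW h); rewrite ler_pM2r.
have h6 : ep m * (B + 1 + F) / dl <= ep n * ((B + 1 + F) / dl).
  by rewrite -mulrA; apply: ler_wpM2r => //; apply: mulr_ge0 => //; lra.
have := ler_normD (hx JI m / hx e m - c) (c - hx (f @ x) (succ @ n)).
rewrite addrA subrK; move: h5; rewrite /T [ep n * _]mulrDr mulr1; lra.
Qed.

End Derivative.

(** * The two sentences *)

Lemma mRlt_rinv M (HM : is_model M) x m n : 1 <= nq HM m -> nq HM m <= nq HM n ->
  mRlt HM x (cv M s_rinv @ n) -> mRlt HM x (cv M s_rinv @ m).
Proof.
move=> m1 mn /mRlt_gap[dl d0 [n0 Hn0]]; apply: (mRlt_intro d0 (n0 := n0)) => p /Hn0.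
rewrite !hx_rinv //; last lra.
suff : (nq HM n)^-1 <= (nq HM m)^-1 by lra.
by rewrite lef_pV2 ?posrE; lra.
Qed.

(** The witness N + l is independent of the modulus g, which serves only to
    evaluate the integral. *)
Lemma EPA_proves_FTC : EPA_proves FTC.
Proof.
apply: completeness => M HM; rewrite /FTC /allN; cbn [sat] => l f.
rewrite (sat_pos HM); evs HM => l1 _.
rewrite /unif_cont /allN; cbn [sat] => Huc k; move: (Huc k) => {Huc}.
rewrite !(sat_pos HM) !sat_exN; evs HM => Huc k1; have [N] := Huc k1.
cbn [sat]; rewrite (sat_pos HM) (sat_osc HM); evs HM => -[N1 Ho].
exists (cv M s_add @ N @ l); cbn [sat]; rewrite (sat_pos HM); evs HM.
have NN : nq HM (cv M s_add @ N @ l) = nq HM N + nq HM l by apply: nq_add.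
split=> [|g]; first by rewrite NN; lra.
rewrite (sat_modulus HM); evs HM => Hg e x.
rewrite (sat_inner HM) !(sat_Rlt HM) (sat_dq HM); evs HM => Hx [e0 eN].
apply: (derivative_of_integral (l := l) (N0 := N)) => //.
  by apply: mRlt_rinv eN; lra.
by apply: mRlt_rinv eN; lra.
Qed.

(** The extracted term. The summand 1 makes 1/N strictly less than 1/g(k) and
    than 1/l. *)
Definition ftc_index : tm nil (ty1 ~> ty0 ~> ty0 ~> ty0) :=
  λ g : ty1, λ k : ty0, λ l : ty0, Succ · (add · (↑↑g · ↑k) · l).

Lemma EPA_proves_FTC_ef : EPA_proves (FTC_ef ftc_index).
Proof.
apply: completeness => M HM; rewrite /FTC_ef /allN; cbn [sat] => f g l.
rewrite (sat_pos HM) (sat_modulus HM); evs HM => _ l1 Hg k.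
rewrite (sat_pos HM); evs HM => k1 n x.
rewrite (sat_pos HM) (sat_inner HM) (sat_dq HM); evs HM => n1.
rewrite /ftc_index; evs HM; rewrite (monusE HM) nq_succ nq_add => tn Hx.
have [g1 Ho] := Hg k k1.
have hinv m : hx HM (cv M s_rabs @ (cv M s_rinv @ n)) m = (nq HM n)^-1.
  by rewrite hx_rabs hx_rinv // ger0_norm // invr_ge0; lra.
have lt m : 1 <= nq HM m -> nq HM m + 1 <= nq HM n ->
    mRlt HM (cv M s_rabs @ (cv M s_rinv @ n)) (cv M s_rinv @ m).
  move=> m1 mn; apply: (mRlt_intro (dl := (nq HM m)^-1 - (nq HM n)^-1) (n0 := zero)).
    by rewrite subr_gt0 ltf_pV2 ?posrE; lra.
  by move=> p _; rewrite hinv hx_rinv //; lra.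
apply: (derivative_of_integral (l := l) (N0 := g @ k)) => //.
- apply: (mRlt_intro (dl := (nq HM n)^-1) (n0 := zero)) => [|p _].
    by rewrite invr_gt0; lra.
  by rewrite hinv hx_rofnat nq_num add0r.
- by apply: lt => //; lra.
- by apply: lt => //; lra.
Qed.

Theorem theorem2p4 :
  EPA_proves FTC /\
  exists t : tm nil (Arr ty1 (Arr ty0 (Arr ty0 ty0))), EPA_proves (FTC_ef t).
Proof.
split; first exact: EPA_proves_FTC.
by exists ftc_index; exact: EPA_proves_FTC_ef.
Qed.
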